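(* Let $d\ge 2$, let $H$ be any $d$-regular graph on $h$ vertices, and let $G$ be a random $n$-lift of $H$. Then for all $n$ sufficiently large, with probability at least $1-n^{-hd}$, $G$ contains an induced subgraph $G'$ with at most $hd$ vertices such that $\lambda^*(G)\le 1189248\,\lambda(G')$.
   Context: Let $H$ be a graph with vertex set $[h]$. An $n$-lift $G$ of $H$ has vertex set $\{(i,j): i\in[h], j\in[n]\}$; the set $V_i=\{(i,j):j\in[n]\}$ is the fibre of $i$. For each edge $ii'$ of $H$ a perfect matching between $V_i$ and $V_{i'}$ is placed, and these are the only edges of $G$. A random $n$-lift is obtained by choosing these matchings independently and uniformly at random. Let $M$ be the adjacency matrix of $G$. The eigenvalues of $M$ restricted to the ($M$-invariant) subspace of vectors $x$ with $\sum_{v\in V_i}x_v=0$ for all $i$ are the new eigenvalues; $\lambda^*(G)$ is the largest absolute value of a new eigenvalue. For any graph $F$, $\lambda(F)$ denotes the largest eigenvalue of its adjacency matrix. *)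

(* Defs.v *)
(* Eigenvalues are taken in algC (algebraic complex numbers),
   where all eigenvalues of an integer matrix live. *)
From HB Require Import structures.
From mathcomp Require Import all_boot all_order all_algebra all_fingroup all_field.
Set Implicit Arguments. Unset Strict Implicit. Unset Printing Implicit Defensive.
Import Order.TTheory GRing.Theory Num.Theory.
Local Open Scope ring_scope.

Definition simple_graph (h : nat) (e : rel 'I_h) : Prop :=
  symmetric e /\ irreflexive e.

Definition regular (h : nat) (e : rel 'I_h) (d : nat) : Prop :=
  forall i : 'I_h, #|[set j | e i j]| = d.

(* Lift data: for each pair (i,i') with i < i', a bijection V_i -> V_i'
   (a perfect matching between the fibres). Coordinates for pairs that are
   not edges with i < i' are unused (they do not affect the uniform
   probability of any event). *)
Definition lift_data (h n : nat) := {ffun 'I_h * 'I_h -> {perm 'I_n}}.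

Definition lift_adj (h n : nat) (e : rel 'I_h) (s : lift_data h n)
  : rel ('I_h * 'I_n) :=
  fun v w =>
    e v.1 w.1 &&
    (if (v.1 < w.1)%N then s (v.1, w.1) v.2 == w.2
     else s (w.1, v.1) w.2 == v.2).

Definition adj_mx (T : finType) (r : rel T) (A : {set T}) : 'M[algC]_#|A| :=
  \matrix_(p, q) ((r (enum_val p) (enum_val q))%:R : algC).

Definition largest_eigenvalue (m : nat) (M : 'M[algC]_m) (l : algC) : Prop :=
  eigenvalue M l /\ forall a, eigenvalue M a -> a <= l.

Definition fibre_zero (h n : nat) (x : 'rV[algC]_#|[set: 'I_h * 'I_n]|) : Prop :=
  forall i : 'I_h, \sum_(p | (enum_val p).1 == i) x 0 p = 0.

Definition new_eigenvalue (h n : nat) (e : rel 'I_h) (s : lift_data h n) (a : algC)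
  : Prop :=
  exists2 x : 'rV[algC]_#|[set: 'I_h * 'I_n]|,
    x != 0 & fibre_zero x /\ x *m adj_mx (lift_adj e s) [set: 'I_h * 'I_n] = a *: x.

Definition good_lift (h n d : nat) (e : rel 'I_h) (s : lift_data h n) : Prop :=
  exists S : {set 'I_h * 'I_n}, (#|S| <= h * d)%N /\
    exists l : algC, largest_eigenvalue (adj_mx (lift_adj e s) S) l /\
      forall a, new_eigenvalue e s a -> `|a| <= 1189248%:R * l.

(* Main.v *)
(* A new eigenvector [x], scaled so that |x|^2 = h n, annihilates the matrix N whose entries
   are 1/n on adjacent fibres, so its eigenvalue is x^T (M - N) x / (h n).  As M - N has zero
   diagonal this form is affine in each coordinate of [x], and every coordinate can be rounded
   to 0 or a signed power of 2 without decreasing the absolute value of the form.  It remains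
   to bound the form on dyadic vectors [z] with |z|^2 <= 5 h n, up to the part of it
   that lives on a set [W] of at most h d vertices; that part is at most lambda(W) |z|^2, while a
   star in G has largest eigenvalue at least 2^q, where 4^q <= d <= 4^(q+1).

   In the spirit of Kahn and Szemeredi, let n 4^(K i) be the order of magnitude of the mass of
   [z] on the fibre of i.  A pair (u, v) with levels |z u| = 2^k, |z v| = 2^l is light if
   l <= q + K u.1 and k <= q + K v.1.  Light pairs are controlled by a union bound over all
   [z], with a moment generating function bound for random permutations.  Heavy pairs with
   levels at distance at least q are controlled by the degree d alone.  For the other heavy
   pairs with fixed levels k, l, vertices of small degree are peeled off; the remaining core
   has, with high probability, fewer than n / E vertices, so the union of all these cores is
   small, and peeling vertices of degree less than 16 from it leaves a set with many inner
   edges, which with high probability has at most h d vertices. *)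
Require Import Defs.
From HB Require Import structures.
From mathcomp Require Import all_boot all_order all_algebra all_fingroup all_field.
From mathcomp Require Import Rstruct spectral reals sequences exp.
From mathcomp Require Import ring lra zify.
Set Implicit Arguments. Unset Strict Implicit. Unset Printing Implicit Defensive.
Import Order.TTheory GRing.Theory Num.Theory.
Local Open Scope ring_scope.

(** * Moment generating functions of random permutations *)

(** The bound h d on the order of G' comes from a union bound: a fixed set of v vertices carries 8 v
    inner edges with probability about (v/n)^(8v), there are about n^v such sets, and the total
    drops well below n^(-hd) once v > h d. Smaller dense sets are not excluded, so their part of the
    form is kept and compared with lambda(G').

    Two exponential moment bounds are needed. For light pairs the exponents are bounded, and a
    centred bound with a variance term holds. For dense sets and cores the exponents are large, and
    a cruder, uncentred bound suffices.

    Levels must be capped by some m for the union bound over vectors to be finite. This loses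
    nothing: light pairs only involve levels at most q + 20 h, and the few vertices of level at
    least m - q are handled together with the cores. As m and E depend on d and h only, every
    estimate exp(-c n) beats n^(-hd) for large n.

    The probabilistic part lives over a real field with an exponential, the eigenvalues in [algC].
    Dyadic vectors have integer coordinates, so the final inequality, multiplied by n, is one
    between integers and can change fields. *)

Lemma sum_perm_expand (A : nmodType) n (F : 'S_n.+1 -> A) (i : 'I_n.+1) :
  \sum_s F s = \sum_k \sum_(t : 'S_n) F (lift_perm i k t).
Proof.
rewrite pair_big /=.
have inj : injective (fun p : 'I_n.+1 * 'S_n => lift_perm i p.1 p.2).
  move=> [k t] [k' t'] /= eq_lift.
  have eq_k : k = k' by rewrite -(lift_perm_id i k t) eq_lift lift_perm_id.
  subst k'; congr (_, _); apply/permP => j; apply: (@lift_inj _ k).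
  by rewrite -!(lift_perm_lift i) eq_lift.
rewrite (reindex (fun p : 'I_n.+1 * 'S_n => lift_perm i p.1 p.2)) //.
apply: onW_bij; apply: inj_card_bij => //.
by rewrite card_prod !card_Sn card_ord factS.
Qed.

(** An injection on [J] extends to (n - |J|)! permutations, and dropping injectivity turns the sum
    over injections into the product of the row sums. The induction deletes a row of [J] and the
    column of its image, which can only decrease the row sums because [g] is nonnegative. *)
Lemma sum_perm_prod_subset (R : realType) n (g : 'I_n -> 'I_n -> R) (J : {set 'I_n}) :
  (forall j k, 0 <= g j k) ->
  \sum_(s : 'S_n) \prod_(j in J) g j (s j) <=
    (n - #|J|)`!%:R * \prod_(j in J) \sum_k g j k.
Proof.
elim: n g J => [|n IH] g J g_ge0; last case: (set_0Vmem J) => [->|[j0 j0J]].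
- have prod0 (F : 'I_0 -> R) : \prod_(j in J) F j = 1 by rewrite big1 // => -[].
  rewrite (prod0 (fun j => \sum_k g j k)) mulr1 sub0n.
  apply: (@le_trans _ _ (\sum_(s : 'S_0) 1)); last by rewrite sumr_const card_Sn.
  by apply: ler_sum => s _; rewrite (prod0 (fun j => g j (s j))).
- rewrite cards0 subn0 big_set0 mulr1.
  under eq_bigr do rewrite big_set0.
  by rewrite sumr_const card_Sn.
rewrite (sum_perm_expand _ j0).
pose J' := [set j | lift j0 j \in J].
have -> : (n.+1 - #|J|)%N = (n - #|J'|)%N.
  rewrite -!sum1_card (bigD1_ord j0) //= add1n subSS.
  by congr (_ - _)%N; apply: eq_bigl => j; rewrite inE.
rewrite [X in _ <= _ * X](bigD1_ord j0) //= mulrA [_ * \sum_i _]mulrC -mulrA mulr_suml.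
apply: ler_sum => k _.
have E t : \prod_(j in J) g j (lift_perm j0 k t j) =
    g j0 k * \prod_(j in J') g (lift j0 j) (lift k (t j)).
  rewrite (bigD1_ord j0) //= lift_perm_id; congr (_ * _).
  by apply: eq_big => [j|j _]; rewrite ?inE ?lift_perm_lift.
rewrite (eq_bigr _ (fun t _ => E t)).
rewrite -mulr_sumr; apply: ler_wpM2l => //.
apply: le_trans (IH (fun j k' => g (lift j0 j) (lift k k')) J' (fun _ _ => g_ge0 _ _)) _.
apply: ler_wpM2l; rewrite ?ler0n //.
rewrite [leRHS](eq_bigl (fun j => j \in J')) => [|j]; last by rewrite inE.
apply: ler_prod => j _; apply/andP; split; first by rewrite sumr_ge0.
by rewrite [leRHS](bigD1_ord k) //= lerDr.
Qed.

(** The falling factorial n (n-1) ... (n-t+1) is at least (n/e)^t. The induction step is (1 + 1/n)^t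
    <= e for t <= n. *)
Lemma expn_fact_le (R : realType) n t : (t <= n)%N ->
  n%:R ^+ t * (n - t)`!%:R <= expR 1 ^+ t * n`!%:R :> R.
Proof.
elim: n t => [|n IH] [|t] // le_tn; rewrite ?expr0 ?subn0 ?mul1r //; rewrite subSS.
have [n0|n_gt0] := posnP n.
  move: le_tn; rewrite n0 ltnS leqn0 => /eqP ->.
  rewrite !expr1 sub0n fact0 factS fact0 !mulr1.
  by apply: le_trans (expR_ge1Dx _); rewrite lerDl ler01.
rewrite ltnS in le_tn; have {}IH := IH t le_tn.
have n0 : 0 < n%:R :> R by rewrite ltr0n.
have step : n.+1%:R ^+ t <= n%:R ^+ t * expR 1 :> R.
  have -> : n.+1%:R = n%:R * (1 + n%:R^-1) :> R by rewrite mulrDr mulr1 divff ?lt0r_neq0 // -natr1.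
  rewrite exprMn; apply: ler_wpM2l; first by rewrite exprn_ge0 ?ler0n.
  apply: (@le_trans _ _ (expR (n%:R^-1) ^+ t)).
    apply: lerXn2r; rewrite ?nnegrE ?expR_ge0 ?expR_ge1Dx //.
    by rewrite addr_ge0 ?invr_ge0 ?ler0n.
  rewrite -expRM_natl ler_expR ler_pdivrMr // mul1r ler_nat //.
rewrite factS natrM !exprS.
apply: (@le_trans _ _ (n.+1%:R * (n%:R ^+ t * expR 1) * (n - t)`!%:R)).
  by rewrite ler_wpM2r ?ler0n // ler_wpM2l ?ler0n.
have -> : n.+1%:R * (n%:R ^+ t * expR 1) * (n - t)`!%:R =
    expR 1 * n.+1%:R * (n%:R ^+ t * (n - t)`!%:R) :> R by ring.
have -> : expR 1 * expR 1 ^+ t * (n.+1%:R * n`!%:R) =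
    expR 1 * n.+1%:R * (expR 1 ^+ t * n`!%:R) :> R by ring.
by rewrite ler_wpM2l // mulr_ge0 ?expR_ge0 ?ler0n.
Qed.

(** The product is expanded over subsets [J]. Each term loses a factor at most e/n per element of
    [J] against n!, and the sum over [J] refolds into a product of factors 1 + r <= exp r. The
    entries may be arbitrarily large. *)
Lemma perm_mgf_upper (R : realType) n (y : 'I_n -> 'I_n -> R) :
  (forall j k, 0 <= y j k) ->
  \sum_(s : 'S_n) \prod_j (1 + y j (s j)) <=
    n`!%:R * expR (expR 1 / n%:R * \sum_j \sum_k y j k).
Proof.
move=> y_ge0.
have r_ge0 j : 0 <= \sum_k y j k by rewrite sumr_ge0.
have c_ge0 : 0 <= expR 1 / n%:R :> R by rewrite divr_ge0 ?expR_ge0 ?ler0n.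
apply: (@le_trans _ _ (n`!%:R * \prod_j (1 + expR 1 / n%:R * \sum_k y j k))); last first.
  apply: ler_wpM2l; rewrite ?ler0n // mulr_sumr expR_sum.
  apply: ler_prod => j _; apply/andP; split; last exact: expR_ge1Dx.
  by apply: addr_ge0 => //; apply: mulr_ge0.
have prod1D (F : 'I_n -> R) :
    \prod_j (1 + F j) = \sum_(J : {set 'I_n}) \prod_(j in J) F j.
  rewrite (eq_bigr (fun j => F j + 1)) => [|j _]; last by rewrite addrC.
  by rewrite bigA_distr; apply: eq_bigr => J _; rewrite -big_mkcond.
rewrite prod1D (eq_bigr _ (fun (s : 'S_n) _ => prod1D (fun j => y j (s j)))).
rewrite exchange_big mulr_sumr /=; apply: ler_sum => J _.
rewrite big_split /= prodr_const mulrA.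
apply: le_trans (sum_perm_prod_subset J y_ge0) _.
apply: ler_wpM2r; first exact: prodr_ge0.
have leJ : (#|J| <= n)%N by rewrite -[n in (_ <= n)%N]card_ord max_card.
move: #|J| leJ => t le_tn; have [n0|n_gt0] := posnP n.
  by move: le_tn; rewrite n0 leqn0 => /eqP ->; rewrite expr0 mulr1.
rewrite expr_div_n mulrA ler_pdivlMr ?exprn_gt0 ?ltr0n //.
by have := expn_fact_le R le_tn; rewrite mulrC [leRHS]mulrC.
Qed.

Lemma sum_sqr_dev (R : realFieldType) N (x : 'I_N.+1 -> R) :
  \sum_k (x k - (\sum_l x l) / N.+1%:R) ^+ 2 =
    \sum_k x k ^+ 2 - (\sum_k x k) ^+ 2 / N.+1%:R.
Proof.
set s := \sum_l x l; set m := s / _.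
have N0 : N.+1%:R != 0 :> R by rewrite pnatr_eq0.
rewrite (eq_bigr (fun k => x k ^+ 2 - 2 * m * x k + m ^+ 2)) => [|k _]; last by ring.
rewrite big_split sumrB -mulr_sumr sumr_const card_ord -/s -mulr_natl /m /=.
by field; rewrite ?natr1 ?nat1r pnatr_eq0.
Qed.

Lemma sum_sqr_dev_le (R : realFieldType) N (x : 'I_N.+1 -> R) :
  \sum_k (x k - (\sum_l x l) / N.+1%:R) ^+ 2 <= \sum_k x k ^+ 2.
Proof. by rewrite sum_sqr_dev lerBlDr lerDl mulr_ge0 ?sqr_ge0 ?invr_ge0 ?ler0n. Qed.

Lemma sqr_sum_le (R : realFieldType) N (x : 'I_N.+1 -> R) :
  (\sum_k x k) ^+ 2 <= N.+1%:R * \sum_k x k ^+ 2.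
Proof.
have : 0 <= \sum_k (x k - (\sum_l x l) / N.+1%:R) ^+ 2.
  by apply: sumr_ge0 => k _; apply: sqr_ge0.
by rewrite sum_sqr_dev subr_ge0 ler_pdivrMr ?ltr0Sn // mulrC.
Qed.

(** Inversion of 1 - x <= exp(-x), since (1 - x)(1 + x + 2 x^2) = 1 + x^2 (1 - 2 x) >= 1. *)
Lemma expR_le_quad (R : realType) (x : R) : x <= 2^-1 -> expR x <= 1 + x + 2 * x ^+ 2.
Proof.
move=> x_le.
have pos : 0 < 1 - x by lra.
have : 1 - x <= expR (- x) by apply: expR_ge1Dx.
rewrite expRN -[leRHS]mul1r ler_pdivlMr ?expR_gt0 // => le1.
rewrite -(ler_pM2l pos); apply: le_trans le1 _; rewrite -subr_ge0.
have -> : (1 - x) * (1 + x + 2 * x ^+ 2) - 1 = x ^+ 2 * (1 - 2 * x) by ring.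
by apply: mulr_ge0; rewrite ?sqr_ge0 //; lra.
Qed.

(** The linear terms of the quadratic bound on exp cancel around the mean [c], so only the variance
    is paid. *)
Lemma sum_expR_le (R : realType) N (z : 'I_N.+1 -> R) :
  let c := (\sum_l z l) / N.+1%:R in
  (forall k, z k - c <= 2^-1) ->
  \sum_k expR (z k) <= N.+1%:R * expR (c + 2 / N.+1%:R * \sum_k (z k - c) ^+ 2).
Proof.
move=> c dev_le; set v := \sum_k (z k - c) ^+ 2.
have N0 : N.+1%:R != 0 :> R by rewrite pnatr_eq0.
have sum0 : \sum_k (z k - c) = 0.
  rewrite sumrB sumr_const card_ord -[c *+ _]mulr_natl /c.
  by rewrite mulrC mulfVK // subrr.
rewrite (eq_bigr (fun k => expR c * expR (z k - c))) => [|k _]; last first.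
  by rewrite -expRD addrC subrK.
rewrite -mulr_sumr expRD mulrCA ler_pM2l ?expR_gt0 //.
apply: (@le_trans _ _ (\sum_k (1 + (z k - c) + 2 * (z k - c) ^+ 2))).
  by apply: ler_sum => k _; apply: expR_le_quad.
rewrite big_split big_split /= sum0 addr0 sumr_const card_ord -mulr_sumr -/v.
have -> : 1 *+ N.+1 + 2 * v = N.+1%:R * (1 + 2 / N.+1%:R * v) by field; rewrite ?natr1 ?nat1r pnatr_eq0.
by rewrite ler_wpM2l ?ler0n ?expR_ge1Dx.
Qed.

Lemma sum_minor (A : zmodType) n (f : 'I_n.+1 -> 'I_n.+1 -> A) i k :
  \sum_j \sum_l f (lift i j) (lift k l) =
  \sum_j \sum_l f j l - \sum_l f i l - \sum_j f j k + f i k.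
Proof.
have D1 i0 (F : 'I_n.+1 -> A) : \sum_j F j = F i0 + \sum_j F (lift i0 j).
  exact: (bigD1_ord i0).
rewrite (D1 i (fun j => \sum_l f j l)) (D1 i (fun j => f j k)).
rewrite (eq_bigr (fun j => \sum_l f (lift i j) l - f (lift i j) k)); last first.
  by move=> j _; rewrite (D1 k) addrAC subrr add0r.
by rewrite sumrB (addrC (\sum_l f i l)) addrK opprD addrA [RHS]addrAC subrK.
Qed.

Lemma sqrD4_le (R : realFieldType) (x y z t : R) :
  (x - y - z + t) ^+ 2 <= 4 * (x ^+ 2 + y ^+ 2 + z ^+ 2 + t ^+ 2).
Proof.
rewrite -subr_ge0.
have -> : 4 * (x ^+ 2 + y ^+ 2 + z ^+ 2 + t ^+ 2) - (x - y - z + t) ^+ 2 =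
  (x + y) ^+ 2 + (x + z) ^+ 2 + (x - t) ^+ 2 + (y - z) ^+ 2 + (y + t) ^+ 2 + (z + t) ^+ 2.
  by ring.
by rewrite !addr_ge0 ?sqr_ge0.
Qed.

(** Here x = n in a matrix of order n + 1; S and Q are the sums of entries and of squares, r and q
    those of the expanded row. The left side averages, over the image of that row, the exponent
    supplied by the induction hypothesis. It falls short of the target exponent by 128 q / (x + 1),
    which is what remains to pay for the fluctuation. *)
Lemma minor_mean (R : realFieldType) (x r S q Q : R) : 0 < x ->
  (r + ((x + 1) * (S - r) - S + r) / x + 128 / x * ((x + 1) * (Q - q) - Q + q)) / (x + 1) =
    S / (x + 1) + 128 / (x + 1) * Q - 128 / (x + 1) * q.
Proof.
move=> x_gt0; have x0 := lt0r_neq0 x_gt0.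
have x1 : x + 1 != 0 by rewrite lt0r_neq0 // addr_gt0.
by field; rewrite x0 x1.
Qed.

(** Deviation of the same exponent from its average, as four centred terms: the entry [a], its
    column sum [s], the square sum [c] of its column, and its square [a2]. *)
Lemma minor_dev (R : realFieldType) (x a a2 r s c S q Q : R) : 0 < x ->
  a + (S - r - s + a) / x + 128 / x * (Q - q - c + a2) -
    (S / (x + 1) + 128 / (x + 1) * Q - 128 / (x + 1) * q) =
  (a - r / (x + 1)) * ((x + 1) / x) - (s - S / (x + 1)) / x
    - 128 / x * (c - Q / (x + 1)) + 128 / x * (a2 - q / (x + 1)).
Proof.
move=> x_gt0; have x0 := lt0r_neq0 x_gt0.
have x1 : x + 1 != 0 by rewrite lt0r_neq0 // addr_gt0.
by field; rewrite x0 x1.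
Qed.

(* Induction on [n], expanding along the row of largest square sum. *)
Lemma perm_mgf (R : realType) n (a : 'I_n -> 'I_n -> R) :
  (forall j k, `|a j k| <= 128^-1) ->
  \sum_(s : 'S_n) expR (\sum_j a j (s j)) <=
    n`!%:R * expR ((\sum_j \sum_k a j k) / n%:R +
                   128 / n%:R * \sum_j \sum_k a j k ^+ 2).
Proof.
elim: n a => [|n IH] a a_le.
  have sum0 (A : zmodType) (F : 'I_0 -> A) : \sum_j F j = 0 by rewrite big1 // => -[].
  rewrite !sum0 mul0r mulr0 addr0 expR0 mulr1.
  apply: (@le_trans _ _ (\sum_(s : 'S_0) 1)); last by rewrite sumr_const card_Sn.
  by apply: ler_sum => s _; rewrite sum0 expR0.
have [n0|n_gt0] := posnP n.
  subst n; rewrite (sum_perm_expand _ ord0) !big_ord1 divr1.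
  rewrite (eq_bigr (fun=> expR (a ord0 ord0))) => [|t _]; last first.
    by rewrite big_ord1 lift_perm_id.
  rewrite sumr_const card_Sn mul1r ler_expR lerDl.
  by rewrite divr1 mulr_ge0 ?sqr_ge0 ?ler0n.
pose q j := \sum_k a j k ^+ 2.
(* Maximality gives Q <= N q(i), so the variance of the column terms is also of order q(i). *)
pose i := [arg max_(j > ord0 | true) q j]%O.
have q_max j : q j <= q i.
  by rewrite /i; case: Order.TotalTheory.arg_maxP => // j' _; apply.
set S := \sum_j \sum_k a j k; set Q := \sum_j \sum_k a j k ^+ 2.
pose r := \sum_k a i k.
pose s k := \sum_j a j k.
pose c k := \sum_j a j k ^+ 2.
have Sn : \sum_k s k = S by rewrite exchange_big.
have Qn : \sum_k c k = Q by rewrite exchange_big.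
have [x Ex] : exists x : R, x = n%:R by exists n%:R.
have [N EN] : exists N : R, N = n.+1%:R by exists n.+1%:R.
have N_gt0 : 0 < N by rewrite EN ltr0Sn.
have xN : N = x + 1 by rewrite EN Ex natr1.
rewrite (sum_perm_expand _ i).
have mulN (y : R) : y *+ n.+1 = N * y by rewrite EN mulr_natl.
have x_ge1 : 1 <= x by rewrite Ex ler1n.
have x_gt0 : 0 < x by apply: lt_le_trans x_ge1; apply: ltr01.
(* [z k] is the exponent obtained when row [i] is sent to [k] and the induction hypothesis is
   applied to the remaining minor. *)
pose z k := a i k + (S - r - s k + a i k) / x + 128 / x * (Q - q i - c k + a i k ^+ 2).
apply: (@le_trans _ _ (n`!%:R * \sum_k expR (z k))).
  rewrite mulr_sumr; apply: ler_sum => k _.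
  have E (t : 'S_n) : \sum_j a j (lift_perm i k t j) =
      a i k + \sum_j a (lift i j) (lift k (t j)).
    rewrite (bigD1_ord i) //= lift_perm_id; congr (_ + _).
    by apply: eq_bigr => j _; rewrite lift_perm_lift.
  rewrite (eq_bigr (fun t : 'S_n => expR (a i k) * expR (\sum_j a (lift i j) (lift k (t j))))).
    rewrite -mulr_sumr /z -addrA expRD mulrCA ler_pM2l ?expR_gt0 //.
    apply: le_trans (IH (fun j l => a (lift i j) (lift k l)) (fun _ _ => a_le _ _)) _.
    by rewrite Ex (sum_minor a i k) (sum_minor (fun j l => a j l ^+ 2) i k).
  by move=> t _; rewrite E expRD.
have avg : (\sum_l z l) / N = S / N + 128 / N * Q - 128 / N * q i.
  rewrite /z !big_split /= -mulr_suml -mulr_sumr !big_split /= !sumrN !sumr_const card_ord.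
  rewrite -/(q i) Sn Qn -/r !mulN.
  by rewrite xN -(minor_mean r S (q i) Q x_gt0) !mulrBr.
have q_ge0 : 0 <= q i by apply: sumr_ge0 => k _; apply: sqr_ge0.
have sqr_le j k : a j k ^+ 2 <= 128^-1 ^+ 2.
  by rewrite -real_normK ?num_real // lerXn2r ?nnegrE ?invr_ge0 ?ler0n.
have Q_le : Q <= N * q i.
  rewrite /Q; apply: (@le_trans _ _ (\sum_(j < n.+1) q i)); first by apply: ler_sum => j _; apply: q_max.
  by rewrite sumr_const card_ord mulN.
have q_le : q i <= N * 128^-1 ^+ 2.
  apply: (@le_trans _ _ (\sum_(j < n.+1) 128^-1 ^+ 2)); first by apply: ler_sum => j _; apply: sqr_le.
  by rewrite sumr_const card_ord mulN.
have c_ge0 k : 0 <= c k by apply: sumr_ge0 => j _; apply: sqr_ge0.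
have c_le k : c k <= N * 128^-1 ^+ 2.
  apply: (@le_trans _ _ (\sum_(j < n.+1) 128^-1 ^+ 2)); first by apply: ler_sum => j _; apply: sqr_le.
  by rewrite sumr_const card_ord mulN.
have s_le k : `|s k| <= N / 128.
  apply: (le_trans (ler_norm_sum _ _ _)).
  apply: (@le_trans _ _ (\sum_(j < n.+1) 128^-1)); first by apply: ler_sum => j _; apply: a_le.
  by rewrite sumr_const card_ord mulN.
have S_le : `|S / N| <= N / 128.
  rewrite normrM normfV (gtr0_norm N_gt0) ler_pdivrMr // -Sn.
  apply: (le_trans (ler_norm_sum _ _ _)).
  apply: (@le_trans _ _ (\sum_(j < n.+1) N / 128)); first by apply: ler_sum => j _; apply: s_le.
  by rewrite sumr_const card_ord mulN mulrC.
have r_le : `|r / N| <= 128^-1.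
  rewrite normrM normfV (gtr0_norm N_gt0) ler_pdivrMr //.
  apply: (le_trans (ler_norm_sum _ _ _)).
  apply: (@le_trans _ _ (\sum_(j < n.+1) 128^-1)); first by apply: ler_sum => j _; apply: a_le.
  by rewrite sumr_const card_ord mulN mulrC.
pose A k := (a i k - r / N) * (N / x).
pose B k := (s k - S / N) / x.
pose C k := 128 / x * (c k - Q / N).
pose D k := 128 / x * (a i k ^+ 2 - q i / N).
have dev k : z k - (\sum_l z l) / N = A k - B k - C k + D k.
  by rewrite avg /z /A /B /C /D xN minor_dev.
have Nx_le : N / x <= 2 by rewrite ler_pdivrMr //; lra.
have Nx_ge : 0 <= N / x by rewrite divr_ge0 ?ltW.
have Nx2_le : (N / x) ^+ 2 <= 4.
  have -> : 4 = 2 ^+ 2 :> R by ring.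
  by rewrite lerXn2r ?nnegrE ?ler0n.
have xV_ge : 0 <= x^-1 by rewrite invr_ge0 ltW.
have xV_le : x^-1 <= 1 by rewrite invf_le1.
have dev_le k : z k - (\sum_l z l) / N <= 2^-1.
  rewrite dev.
  have A_le : A k <= 4 / 128.
    have := a_le i k; have := r_le; rewrite !ler_norml => /andP[? ?] /andP[? ?].
    by rewrite /A; nra.
  have B_ge : - (4 / 128) <= B k.
    have := s_le k; have := S_le; rewrite !ler_norml => /andP[? ?] /andP[? ?].
    by rewrite /B ler_pdivlMr //; lra.
  have C_ge : - (2 / 128) <= C k.
    have QN : Q / N <= N / 128 ^+ 2.
      rewrite ler_pdivrMr //; apply: (le_trans Q_le).
      by rewrite mulrC ler_pM2r //; apply: (le_trans q_le); lra.
    by rewrite /C mulrAC ler_pdivlMr //; have := c_ge0 k; lra.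
  have D_le : D k <= 1 / 128.
    have qN : 0 <= q i / N by rewrite divr_ge0 // ltW.
    by rewrite /D mulrAC ler_pdivrMr //; have := sqr_le i k; lra.
  lra.
apply: (@le_trans _ _ (n`!%:R * (N * expR ((\sum_l z l) / N + 2 / N * \sum_k (z k - (\sum_l z l) / N) ^+ 2)))).
  by apply: ler_wpM2l; rewrite ?ler0n // EN; apply: sum_expR_le; rewrite -EN.
rewrite mulrA [n`!%:R * N]mulrC EN -natrM -factS ler_pM2l ?ltr0n ?fact_gt0 //.
rewrite ler_expR -EN {1}avg.
(* 2/N times 64 q(i) is exactly the gap 128 q(i) / N between the target and the average in [avg]. *)
suff dev2 : \sum_k (z k - (\sum_l z l) / N) ^+ 2 <= 64 * q i.
  rewrite -addrA gerDl addrC subr_le0.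
  apply: (@le_trans _ _ (2 / N * (64 * q i))).
    have N2 : 0 <= 2 / N by rewrite divr_ge0 ?ler0n // ltW.
    exact: ler_wpM2l N2 _ _ dev2.
  by rewrite mulrA [2 / N * 64]mulrAC -natrM.
have sumA : \sum_k A k ^+ 2 <= 4 * q i.
  rewrite /A (eq_bigr (fun k => (a i k - r / N) ^+ 2 * (N / x) ^+ 2)); last by move=> *; rewrite exprMn.
  rewrite -mulr_suml; have := sum_sqr_dev_le (a i); rewrite -/r -EN -/(q i) => le_q.
  rewrite mulrC; apply: ler_pM; rewrite ?sqr_ge0 //.
  by apply: sumr_ge0 => k _; apply: sqr_ge0.
have sumB : \sum_k B k ^+ 2 <= 4 * q i.
  rewrite /B (eq_bigr (fun k => (s k - S / N) ^+ 2 * x^-1 ^+ 2)); last by move=> *; rewrite exprMn.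
  rewrite -mulr_suml; have := sum_sqr_dev_le s; rewrite -EN Sn => le_s.
  have s2_le : \sum_k s k ^+ 2 <= N * (N * q i).
    apply: (@le_trans _ _ (\sum_k N * c k)); first by apply: ler_sum => k _; rewrite EN; apply: sqr_sum_le.
    by rewrite -mulr_sumr Qn ler_pM2l.
  apply: (@le_trans _ _ (N * (N * q i) * x^-1 ^+ 2)).
    by rewrite ler_wpM2r ?sqr_ge0 //; apply: (le_trans le_s).
  have -> : N * (N * q i) * x^-1 ^+ 2 = (N / x) ^+ 2 * q i by ring.
  by rewrite ler_wpM2r.
have sumC : \sum_k C k ^+ 2 <= 4 * q i.
  rewrite /C (eq_bigr (fun k => (128 / x) ^+ 2 * (c k - Q / N) ^+ 2)); last by move=> *; rewrite exprMn.
  rewrite -mulr_sumr; have := sum_sqr_dev_le c; rewrite -EN Qn => le_c.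
  have c2_le : \sum_k c k ^+ 2 <= N * 128^-1 ^+ 2 * (N * q i).
    apply: (@le_trans _ _ (\sum_k N * 128^-1 ^+ 2 * c k)).
      by apply: ler_sum => k _; rewrite expr2 ler_wpM2r.
    by rewrite -mulr_sumr Qn ler_wpM2l // mulr_ge0 ?sqr_ge0 // ltW.
  apply: (@le_trans _ _ ((128 / x) ^+ 2 * (N * 128^-1 ^+ 2 * (N * q i)))).
    by rewrite ler_wpM2l ?sqr_ge0 //; apply: (le_trans le_c).
  have -> : (128 / x) ^+ 2 * (N * 128^-1 ^+ 2 * (N * q i)) = (N / x) ^+ 2 * q i.
    by field; lra.
  by rewrite ler_wpM2r.
have sumD : \sum_k D k ^+ 2 <= q i.
  rewrite /D (eq_bigr (fun k => (128 / x) ^+ 2 * (a i k ^+ 2 - q i / N) ^+ 2)); last by move=> *; rewrite exprMn.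
  rewrite -mulr_sumr; have := sum_sqr_dev_le (fun k => a i k ^+ 2); rewrite -EN -/(q i) => le_a.
  have a4_le : \sum_k (a i k ^+ 2) ^+ 2 <= 128^-1 ^+ 2 * q i.
    by rewrite mulr_sumr; apply: ler_sum => k _; rewrite [leLHS]expr2 ler_wpM2r ?sqr_ge0.
  apply: (@le_trans _ _ ((128 / x) ^+ 2 * (128^-1 ^+ 2 * q i))).
    by rewrite ler_wpM2l ?sqr_ge0 //; apply: (le_trans le_a).
  have -> : (128 / x) ^+ 2 * (128^-1 ^+ 2 * q i) = x^-1 ^+ 2 * q i by field; lra.
  by rewrite -[leRHS]mul1r ler_wpM2r // exprn_ile1.
(* The four bounds add up to 4 (4 + 4 + 4 + 1) q(i) = 52 q(i). *)
apply: (@le_trans _ _ (\sum_k 4 * (A k ^+ 2 + B k ^+ 2 + C k ^+ 2 + D k ^+ 2))).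
  by apply: ler_sum => k _; rewrite dev; apply: sqrD4_le.
by rewrite -mulr_sumr !big_split /=; lra.
Qed.

(** * Moment generating functions of random lifts *)

Lemma sum_pairE (A : zmodType) (I J : finType) (F : I * J -> A) :
  \sum_u F u = \sum_i \sum_j F (i, j).
Proof. by rewrite pair_big; apply: eq_bigr => -[]. Qed.

Lemma sum_offdiag (A : zmodType) h (T : 'I_h -> 'I_h -> A) :
  (forall i, T i i = 0) ->
  \sum_i \sum_j T i j = \sum_(p : 'I_h * 'I_h | (p.1 < p.2)%N) (T p.1 p.2 + T p.2 p.1).
Proof.
move=> T0; rewrite pair_big /= (bigID (fun p : 'I_h * 'I_h => (p.1 < p.2)%N)) /=.
rewrite big_split /=; congr (_ + _).
rewrite (bigID (fun p : 'I_h * 'I_h => p.1 == p.2)) /= big1 ?add0r; last first.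
  by move=> [i j] /= /andP[_ /eqP ->].
rewrite (reindex_inj (h := fun p : 'I_h * 'I_h => (p.2, p.1))) /=; last first.
  by move=> [i j] [k l] [-> ->].
apply: eq_bigl => -[i j] /=.
by rewrite -leqNgt ltn_neqAle andbC eq_sym.
Qed.

Lemma sum_lift_prod (R : comRingType) h n (G : 'I_h * 'I_h -> {perm 'I_n} -> R) :
  \sum_(s : lift_data h n) \prod_p G p (s p) = \prod_p \sum_t G p t.
Proof. by rewrite bigA_distr_bigA. Qed.

Lemma card_lift_data (R : comRingType) h n :
  #|lift_data h n|%:R = \prod_(p : 'I_h * 'I_h) n`!%:R :> R.
Proof. by rewrite card_ffun card_Sn natrX prodr_const. Qed.

(* The sum over ordered pairs of fibres becomes a sum over the unordered edges of the
   base graph, each of which carries one independent permutation. *)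
Definition edge_coef (R : ringType) h n (e : rel 'I_h) (a : 'I_h * 'I_n -> 'I_h * 'I_n -> R)
    (p : 'I_h * 'I_h) (j k : 'I_n) : R :=
  if (p.1 < p.2)%N && e p.1 p.2 then a (p.1, j) (p.2, k) + a (p.2, k) (p.1, j) else 0.

Lemma sum_lift_adj (R : comRingType) h n (e : rel 'I_h)
    (a : 'I_h * 'I_n -> 'I_h * 'I_n -> R) (s : lift_data h n) :
  symmetric e -> irreflexive e ->
  \sum_u \sum_v a u v * (lift_adj e s u v)%:R = \sum_p \sum_j edge_coef e a p j (s p j).
Proof.
move=> sym irr.
pose T i i' := \sum_j \sum_j' a (i, j) (i', j') * (lift_adj e s (i, j) (i', j'))%:R.
transitivity (\sum_i \sum_i' T i i').
  rewrite sum_pairE; apply: eq_bigr => i _.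
  by rewrite /T [RHS]exchange_big; apply: eq_bigr => j _; rewrite sum_pairE.
rewrite sum_offdiag; last first.
  by move=> i; rewrite /T !big1 // => j _; rewrite big1 // => j' _; rewrite /lift_adj /= irr mulr0.
rewrite big_mkcond; apply: eq_bigr => -[i i'] _ /=.
have [lt_ii'|] := boolP (i < i')%N; last first.
  by rewrite /edge_coef /= => /negPf ->; rewrite big1.
have [eii'|/negPf neii'] := boolP (e i i'); last first.
  rewrite /edge_coef /= neii' andbF big1 // /T /lift_adj /= [e i' i]sym neii' /=.
  by rewrite !big1 ?addr0 // => j _; rewrite big1 // => j' _; rewrite mulr0.
rewrite /edge_coef /= lt_ii' eii' big_split /=; congr (_ + _).
  apply: eq_bigr => j _; rewrite (bigD1 (s (i, i') j)) //= big1 => [|j' ne].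
    by rewrite /lift_adj /= lt_ii' eii' eqxx mulr1 addr0.
  by rewrite /lift_adj /= lt_ii' eii' eq_sym (negPf ne) mulr0.
rewrite /T exchange_big /=; apply: eq_bigr => j _.
rewrite (bigD1 (s (i, i') j)) //= big1 => [|j' ne].
  by rewrite /lift_adj /= ltnNge (ltnW lt_ii') /= [e i' i]sym eii' eqxx mulr1 addr0.
by rewrite /lift_adj /= ltnNge (ltnW lt_ii') /= [e i' i]sym eii' eq_sym (negPf ne) mulr0.
Qed.

Lemma sum_base_adj (R : comRingType) h n (e : rel 'I_h)
    (a : 'I_h * 'I_n -> 'I_h * 'I_n -> R) :
  symmetric e -> irreflexive e ->
  \sum_u \sum_v a u v * (e u.1 v.1)%:R = \sum_p \sum_j \sum_k edge_coef e a p j k.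
Proof.
move=> sym irr.
pose T i i' := \sum_j \sum_j' a (i, j) (i', j') * (e i i')%:R.
transitivity (\sum_i \sum_i' T i i').
  rewrite sum_pairE; apply: eq_bigr => i _.
  by rewrite /T [RHS]exchange_big; apply: eq_bigr => j _; rewrite sum_pairE.
rewrite sum_offdiag; last first.
  by move=> i; rewrite /T !big1 // => j _; rewrite big1 // => j' _; rewrite irr mulr0.
rewrite big_mkcond; apply: eq_bigr => -[i i'] _ /=; rewrite /T /edge_coef /=.
have [lt_ii'|_] := boolP (i < i')%N; last by rewrite big1 // => j _; rewrite big1.
rewrite [e i' i]sym; case: (e i i') => /=; last first.
  by rewrite !big1 ?addr0 // => j _; rewrite big1 // => k _; rewrite ?mulr0.
rewrite [X in _ + X]exchange_big -big_split /=; apply: eq_bigr => j _.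
by rewrite -big_split; apply: eq_bigr => k _; rewrite !mulr1.
Qed.

(** The edges carry independent permutations, so [perm_mgf_upper] applies to each. An unordered edge
    has weight x + y from its two orientations, and exp(x + y) <= (exp(2x) + exp(2y)) / 2 separates
    them; this is the origin of both factors 2. *)
Lemma lift_mgf_upper (R : realType) h n (e : rel 'I_h)
    (th : 'I_h * 'I_n -> 'I_h * 'I_n -> R) :
  symmetric e -> irreflexive e -> (forall u v, 0 <= th u v) ->
  \sum_(s : lift_data h n) expR (\sum_u \sum_v th u v * (lift_adj e s u v)%:R) <=
  #|lift_data h n|%:R *
    expR (expR 1 / n%:R * \sum_u \sum_v (expR (2 * th u v) - 1) / 2 * (e u.1 v.1)%:R).
Proof.
move=> sym irr th_ge0.
pose b := edge_coef e th.
have b_ge0 p j k : 0 <= b p j k.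
  by rewrite /b /edge_coef; case: ifP => // _; rewrite addr_ge0.
rewrite (eq_bigr (fun s : lift_data h n => \prod_p expR (\sum_j b p j (s p j)))); last first.
  by move=> s _; rewrite sum_lift_adj // -expR_sum.
rewrite (sum_lift_prod (fun p (t : {perm 'I_n}) => expR (\sum_j b p j (t j)))).
rewrite (card_lift_data R) sum_base_adj // mulr_sumr expR_sum -big_split /=.
apply: ler_prod => p _; apply/andP; split.
  by apply: sumr_ge0 => t _; apply: expR_ge0.
rewrite (eq_bigr (fun t : {perm 'I_n} => \prod_j (1 + (expR (b p j (t j)) - 1)))); last first.
  by move=> t _; rewrite expR_sum; apply: eq_bigr => j _; rewrite addrC subrK.
have le_y := @perm_mgf_upper R n (fun j k => expR (b p j k) - 1).
apply: le_trans (le_y _) _ => [j k|].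
  by rewrite subr_ge0 -expR0 ler_expR.
rewrite ler_wpM2l ?ler0n // ler_expR ler_wpM2l ?divr_ge0 ?expR_ge0 ?ler0n //.
apply: ler_sum => j _; apply: ler_sum => k _; rewrite /b /edge_coef.
case: ifP => _; last by rewrite expR0 subrr.
set x := th _ _; set y := th _ _.
rewrite !expRM_natl expRD -subr_ge0.
have -> : (expR x ^+ 2 - 1) / 2 + (expR y ^+ 2 - 1) / 2 - (expR x * expR y - 1) =
  (expR x - expR y) ^+ 2 / 2 by field.
by rewrite mulr_ge0 ?sqr_ge0 ?invr_ge0 ?ler0n.
Qed.

(** On each edge this is [perm_mgf], whose mean term is cancelled by the centring. The two
    orientations of an edge add up, so entries are halved to 1/256, and (x + y)^2 <= 2 (x^2 + y^2)
    doubles 128 to 256. *)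
Lemma lift_mgf (R : realType) h n (e : rel 'I_h)
    (a : 'I_h * 'I_n -> 'I_h * 'I_n -> R) :
  symmetric e -> irreflexive e -> (forall u v, `|a u v| <= 256^-1) ->
  \sum_(s : lift_data h n)
    expR (\sum_u \sum_v a u v * ((lift_adj e s u v)%:R - (e u.1 v.1)%:R / n%:R)) <=
  #|lift_data h n|%:R *
    expR (256 / n%:R * \sum_u \sum_v a u v ^+ 2 * (e u.1 v.1)%:R).
Proof.
move=> sym irr a_le.
pose b := edge_coef e a.
pose m := (\sum_p \sum_j \sum_k b p j k) / n%:R.
rewrite (eq_bigr (fun s : lift_data h n => expR (- m) * \prod_p expR (\sum_j b p j (s p j)))); last first.
  move=> s _; rewrite -expR_sum -expRD -sum_lift_adj // addrC; congr expR.
  rewrite /m -sum_base_adj // mulr_suml -sumrB; apply: eq_bigr => u _.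
  rewrite mulr_suml -sumrB; apply: eq_bigr => v _.
  by rewrite mulrBr mulrA.
rewrite -mulr_sumr (sum_lift_prod (fun p (t : {perm 'I_n}) => expR (\sum_j b p j (t j)))).
rewrite expRN [leLHS]mulrC ler_pdivrMr ?expR_gt0 // -[leRHS]mulrA -expRD.
rewrite (card_lift_data R) addrC /m mulr_suml sum_base_adj // mulr_sumr -big_split /= expR_sum -big_split /=.
apply: ler_prod => p _; apply/andP; split.
  by apply: sumr_ge0 => t _; apply: expR_ge0.
have le_b := @perm_mgf R n (b p).
apply: le_trans (le_b _) _ => [j k|].
  rewrite /b /edge_coef; case: ifP => _; last by rewrite normr0 invr_ge0.
  by apply: (le_trans (ler_normD _ _)); have := a_le (p.1, j) (p.2, k); have := a_le (p.2, k) (p.1, j); lra.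
rewrite ler_wpM2l ?ler0n // ler_expR lerD2l.
have -> : 256 = 128 * 2 :> R by ring.
rewrite [128 * 2 / _]mulrAC -[leRHS]mulrA ler_wpM2l ?divr_ge0 ?ler0n //.
rewrite mulr_sumr; apply: ler_sum => j _; rewrite mulr_sumr; apply: ler_sum => k _.
rewrite /b /edge_coef; case: ifP => _; last by rewrite expr0n mulr0.
set x := a _ _; set y := a _ _; rewrite -subr_ge0.
have -> : 2 * (x ^+ 2 + y ^+ 2) - (x + y) ^+ 2 = (x - y) ^+ 2 by ring.
exact: sqr_ge0.
Qed.

(** * Dense small sets *)

Lemma expR_sub1_ge0 (R : realType) (x : R) : 0 <= x -> 0 <= expR x - 1.
Proof. by move=> x_ge0; rewrite subr_ge0 (le_trans _ (expR_ge1Dx x)) // lerDl. Qed.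

Lemma expR1_le4 (R : realType) : expR 1 <= 4 :> R.
Proof.
have half : expR 2^-1 <= 2 :> R by have := @expR_le_quad R 2^-1 (lexx _); lra.
have -> : expR 1 = expR 2^-1 ^+ 2 :> R by rewrite -expRM_natl divff ?pnatr_eq0.
have -> : 4 = 2 ^+ 2 :> R by ring.
by rewrite lerXn2r ?nnegrE ?expR_ge0 ?ler0n.
Qed.

Lemma expR1_ge2 (R : realType) : 2 <= expR 1 :> R.
Proof. by apply: le_trans (expR_ge1Dx 1); rewrite -natr1. Qed.

(** A single term of the binomial expansion of (1 + v/m)^m <= exp v. *)
Lemma bin_expR_le (R : realType) m v :
  'C(m, v)%:R * (v%:R / m%:R) ^+ v <= expR v%:R :> R.
Proof.
have [m0|m_gt0] := posnP m.
  by subst m; rewrite bin0n; case: v => [|v]; rewrite ?mul1r ?mul0r ?expR_ge0 ?expR0.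
have x_ge0 : 0 <= v%:R / m%:R :> R by rewrite divr_ge0 ?ler0n.
have [le_vm|lt_mv] := leqP v m; last by rewrite bin_small ?mul0r ?expR_ge0.
apply: (@le_trans _ _ ((1 + v%:R / m%:R) ^+ m)).
  rewrite exprDn (bigD1 (inord v)) //= inordK // expr1n mul1r mulr_natl lerDl.
  by apply: sumr_ge0 => i _; rewrite mulrn_wge0 // mulr_ge0 ?exprn_ge0 ?ler01.
apply: (@le_trans _ _ (expR (v%:R / m%:R) ^+ m)).
  by rewrite lerXn2r ?nnegrE ?expR_ge0 ?expR_ge1Dx // addr_ge0.
by rewrite -expRM_natr divfK // pnatr_eq0 -lt0n.
Qed.

Lemma sum_card_set (A : nmodType) (T : finType) (f : nat -> A) (P : pred nat) :
  \sum_(W : {set T} | P #|W|) f #|W| = \sum_(v < #|T|.+1 | P v) f v *+ 'C(#|T|, v).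
Proof.
have inW (W : {set T}) : (inord #|W| : 'I_#|T|.+1) = #|W| :> nat.
  by apply: inordK; rewrite ltnS max_card.
rewrite (partition_big (fun W : {set T} => inord #|W| : 'I_#|T|.+1) (fun v : 'I_#|T|.+1 => P v)) /=; last first.
  by move=> W; move: (inW W) => /= ->.
apply: eq_bigr => v Pv.
rewrite -card_draws -sum1dep_card -sumrMnr big_mkcond [RHS]big_mkcond /=.
apply: eq_bigr => W _.
have -> : (inord #|W| == v) = (#|W| == v :> nat) by rewrite -val_eqE /= (inW W).
by case: eqP => [->|]; rewrite ?andbF // andbT Pv mulr1n.
Qed.

(** Markov's inequality in exponential form, with counting in place of probability. *)
Lemma card_le_sum_expR (R : realType) (T : finType) (P : pred T) (X : T -> R) :
  (forall s, P s -> 0 <= X s) -> #|[set s | P s]|%:R <= \sum_s expR (X s).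
Proof.
move=> X_ge0; rewrite -sum1_card natr_sum big_mkcond; apply: ler_sum => s _.
rewrite inE; case: ifP => [/X_ge0|_]; last exact: expR_ge0.
by rewrite -expR0 ler_expR.
Qed.

Lemma card_exists_le (T I : finType) (Q : pred I) (P : I -> pred T) :
  (#|[set s | [exists i, Q i && P i s]]| <= \sum_(i | Q i) #|[set s | P i s]|)%N.
Proof.
apply: (@leq_trans #|\bigcup_(i | Q i) [set s | P i s]|).
  apply/subset_leq_card/subsetP => s; rewrite inE => /existsP[i /andP[Qi Pi]].
  by apply/bigcupP; exists i => //; rewrite inE.
elim/big_rec2: _ => [|i m S _ IH]; first by rewrite cards0.
by apply: leq_trans (leq_card_setU _ _) _; rewrite leq_add2l.
Qed.

(** For a symmetric loopless [e] this is twice the number of edges inside [W]. *)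
Definition inner_degree_sum h n (e : rel 'I_h) (s : lift_data h n) (W : {set 'I_h * 'I_n}) : nat :=
  \sum_(u in W) \sum_(v in W) lift_adj e s u v.

Lemma dense_set_count (R : realType) h n (e : rel 'I_h) (W : {set 'I_h * 'I_n}) :
  symmetric e -> irreflexive e -> (0 < #|W|)%N -> (#|W| <= n)%N ->
  #|[set s : lift_data h n | (16 * #|W| <= inner_degree_sum e s W)%N]|%:R <=
  #|lift_data h n|%:R * (expR (2 * #|W|%:R) * (#|W|%:R / n%:R) ^+ (8 * #|W|)) :> R.
Proof.
move=> sym irr; set v := #|W| => v_gt0 le_vn.
have v0 : 0 < v%:R :> R by rewrite ltr0n.
have n0 : 0 < n%:R :> R by rewrite ltr0n (leq_trans v_gt0).
(* With exp(2 t) = n/v, the v^2 pairs contribute at most e v / 2 <= 2 v to the exponent, while the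
   threshold contributes exp(-16 v t) = (v/n)^(8v). *)
pose t := ln (n%:R / v%:R) / 2 : R.
have t2 : expR (2 * t) = n%:R / v%:R by rewrite mulrC divfK ?pnatr_eq0 // lnK // posrE divr_gt0.
have t_ge0 : 0 <= t by rewrite divr_ge0 ?ln_ge0 // ler_pdivlMr // mul1r ler_nat.
pose th (u w : 'I_h * 'I_n) := t * ((u \in W) && (w \in W))%:R.
pose X (s : lift_data h n) := \sum_u \sum_w th u w * (lift_adj e s u w)%:R - t * (16 * v)%:R.
have XE s : \sum_u \sum_w th u w * (lift_adj e s u w)%:R = t * (inner_degree_sum e s W)%:R.
  rewrite /inner_degree_sum natr_sum mulr_sumr [RHS]big_mkcond; apply: eq_bigr => u _.
  rewrite /th; case: (u \in W) => /=; last by rewrite big1 // => w _; rewrite mulr0 mul0r.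
  rewrite natr_sum mulr_sumr [RHS]big_mkcond; apply: eq_bigr => w _.
  by case: (w \in W); rewrite ?mulr1 // mulr0 mul0r.
apply: (le_trans (card_le_sum_expR (X := X) _)).
  by move=> s le_s; rewrite /X XE -mulrBr mulr_ge0 // subr_ge0 ler_nat.
rewrite /X (eq_bigr (fun s : lift_data h n => expR (- (t * (16 * v)%:R)) *
   expR (\sum_u \sum_w th u w * (lift_adj e s u w)%:R))); last first.
  by move=> s _; rewrite -expRD addrC.
rewrite -mulr_sumr.
have th_ge0 u w : 0 <= th u w by rewrite mulr_ge0 ?ler0n.
apply: (@le_trans _ _ (expR (- (t * (16 * v)%:R)) * (#|lift_data h n|%:R * expR (2 * v%:R)))).
  apply: ler_wpM2l; first exact: expR_ge0.
  apply: le_trans (lift_mgf_upper sym irr th_ge0) _.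
  apply: ler_wpM2l; rewrite ?ler0n // ler_expR.
  have sum_le : \sum_u \sum_w (expR (2 * th u w) - 1) / 2 * (e u.1 w.1)%:R <= n%:R * v%:R / 2 :> R.
    apply: (@le_trans _ _ (\sum_(u in W) \sum_(w in W) n%:R / v%:R / 2)); last first.
      rewrite !sumr_const -/v -mulrnA -[_ *+ _]mulr_natl natrM.
      by rewrite (_ : _ * _ = n%:R * v%:R / 2) //; field; rewrite lt0r_neq0.
    rewrite [leRHS]big_mkcond; apply: ler_sum => u _; rewrite /th.
    case: (u \in W) => /=; last first.
      by rewrite big1 // => w _; rewrite !mulr0 expR0 subrr !mul0r.
    rewrite [leRHS]big_mkcond; apply: ler_sum => w _.
    case: (w \in W) => /=; last by rewrite !mulr0 expR0 subrr !mul0r.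
    have nv : 1 <= n%:R / v%:R :> R by rewrite ler_pdivlMr // mul1r ler_nat.
    by rewrite mulr1 t2; case: (e _ _) => /=; rewrite ?mulr1 ?mulr0; lra.
  apply: (@le_trans _ _ (4 / n%:R * (n%:R * v%:R / 2))).
    apply: ler_pM => //; rewrite ?divr_ge0 ?expR_ge0 ?ler0n //.
      by apply: sumr_ge0 => u _; apply: sumr_ge0 => w _; apply: mulr_ge0; rewrite ?ler0n // divr_ge0 ?ler0n // expR_sub1_ge0 // mulr_ge0 ?ler0n.
    by rewrite ler_wpM2r ?invr_ge0 ?ler0n // expR1_le4.
  by rewrite (_ : _ * _ = 2 * v%:R) //; field; rewrite lt0r_neq0.
rewrite mulrCA ler_wpM2l ?ler0n // mulrC ler_wpM2l ?expR_ge0 //.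
have -> : (16 * v)%:R = (8 * v)%:R * 2 :> R by rewrite -natrM mulnAC.
by rewrite mulrC mulrAC -mulrA [t * 2]mulrC expRN expRM_natl t2 -exprVn invf_div.
Qed.

Lemma exp_le_expR (R : realType) v w : (0 < w)%N ->
  v%:R ^+ w <= w%:R ^+ w * expR v%:R :> R.
Proof.
move=> w_gt0; have w0 : 0 < w%:R :> R by rewrite ltr0n.
apply: (@le_trans _ _ ((w%:R * expR (v%:R / w%:R)) ^+ w)); last first.
  by rewrite exprMn -expRM_natr divfK // lt0r_neq0.
rewrite lerXn2r ?nnegrE ?ler0n ?mulr_ge0 ?expR_ge0 //.
rewrite mulrC -ler_pdivrMr //; apply: le_trans (expR_ge1Dx _).
by rewrite lerDr.
Qed.

(** Bounds the union bound terms of all sizes v >= w by that of the smallest size: v - w of the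
    factors are at most 1/64, and in the others v^w is traded for w^w e^v. *)
Lemma ratio_pow_le (R : realType) n v w : (0 < w <= v)%N -> (64 * v <= n)%N ->
  (v%:R / n%:R) ^+ v <= ((64 * w)%:R / n%:R) ^+ w :> R.
Proof.
move=> /andP[w_gt0 le_wv] le_vn.
have n0 : 0 < n%:R :> R by rewrite ltr0n; lia.
have x_ge0 : 0 <= v%:R / n%:R :> R by rewrite divr_ge0 ?ler0n.
have x_le : v%:R / n%:R <= 64^-1 :> R.
  by rewrite ler_pdivrMr // mulrC ler_pdivlMr // -natrM ler_nat mulnC.
rewrite -{2}(subnK le_wv) exprD.
apply: (@le_trans _ _ (64^-1 ^+ (v - w) * (v%:R / n%:R) ^+ w)).
  by rewrite ler_wpM2r ?exprn_ge0 // lerXn2r ?nnegrE ?invr_ge0 ?ler0n.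
rewrite !expr_div_n mulrA ler_pM2r ?invr_gt0 ?exprn_gt0 //.
apply: (@le_trans _ _ (64^-1 ^+ (v - w) * (w%:R ^+ w * 4 ^+ v))).
  rewrite ler_wpM2l ?exprn_ge0 ?invr_ge0 ?ler0n //.
  apply: le_trans (exp_le_expR R v w_gt0) _.
  rewrite ler_wpM2l ?exprn_ge0 ?ler0n // -[v%:R]mul1r expRM_natr.
  rewrite lerXn2r ?nnegrE ?expR_ge0 ?ler0n //. by rewrite expR1_le4.
rewrite natrM exprMn mulrCA mulrC ler_wpM2r ?exprn_ge0 ?ler0n //.
rewrite exprVn mulrC ler_pdivrMr ?exprn_gt0 ?ltr0n // -exprD subnKC //.
rewrite lerXn2r ?nnegrE ?ler0n //. by rewrite ler_nat.
Qed.

Definition dense_small_set h n (e : rel 'I_h) D (s : lift_data h n) : bool :=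
  [exists W : {set 'I_h * 'I_n}, (D < #|W|)%N && (64 * h * #|W| <= n)%N &&
     (16 * #|W| <= inner_degree_sum e s W)%N].

(** With x = v/n, the number of sets is at most (e h / x)^v, so the term for size v is at most (e^3
    h x)^v x^(6v). The size cap in [dense_small_set] gives e^3 h x <= 1, and x^(6v) is
    O(n^(-6(D+1))) by [ratio_pow_le]. The factor 3 leaves room for three kinds of failure. *)
Lemma dense_small_set_rare (R : realType) h (e : rel 'I_h) D :
  symmetric e -> irreflexive e -> (0 < h)%N ->
  exists N, forall n, (N <= n)%N ->
    (#|[set s : lift_data h n | dense_small_set e D s]| * (3 * n ^ D) <= #|lift_data h n|)%N.
Proof.
move=> sym irr h_gt0; pose c := ((64 * D.+1) ^ (6 * D.+1))%N.
exists (6 * h * c)%N => n le_Nn.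
have c_gt0 : (0 < c)%N by rewrite expn_gt0.
have n_gt0 : (0 < n)%N by apply: leq_trans le_Nn; rewrite !muln_gt0 h_gt0 c_gt0.
have n0 : 0 < n%:R :> R by rewrite ltr0n.
pose P v := (D < v)%N && (64 * h * v <= n)%N.
pose L : R := #|lift_data h n|%:R.
have L_ge0 : 0 <= L by rewrite ler0n.
pose f v : R := L * (expR (2 * v%:R) * (v%:R / n%:R) ^+ (8 * v)).
have cardV : #|{: 'I_h * 'I_n}| = (h * n)%N by rewrite card_prod !card_ord.
have term v : P v -> f v *+ 'C(h * n, v) <= L * ((64 * D.+1)%:R / n%:R) ^+ (6 * D.+1).
  move=> /andP[lt_Dv le_vn].
  have v_gt0 : (0 < v)%N by lia.
  have v0 : 0 < v%:R :> R by rewrite ltr0n.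
  have h0 : 0 < h%:R :> R by rewrite ltr0n.
  have le_vn' : (64 * v <= n)%N by nia.
  rewrite -[_ *+ 'C(_, _)]mulr_natr /f -mulrA ler_wpM2l //.
  have [x Ex] : exists x : R, x = v%:R / n%:R by exists (v%:R / n%:R).
  rewrite -Ex.
  have x_gt0 : 0 < x by rewrite Ex divr_gt0.
  have hx : 64 * h%:R * x <= 1 by rewrite Ex mulrA ler_pdivrMr // mul1r -!natrM ler_nat.
  have binx : 'C(h * n, v)%:R * x ^+ v <= h%:R ^+ v * expR v%:R.
    have := bin_expR_le R (h * n) v; rewrite natrM invfM mulrCA -Ex exprMn exprVn.
    by rewrite mulrCA mulrC ler_pdivrMr ?exprn_gt0 // mulrC [leRHS]mulrC mulrC.
  have bin_le : 'C(h * n, v)%:R <= h%:R ^+ v * expR v%:R / x ^+ v.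
    by rewrite ler_pdivlMr ?exprn_gt0.
  apply: (@le_trans _ _ (expR (2 * v%:R) * x ^+ (8 * v) * (h%:R ^+ v * expR v%:R / x ^+ v))).
    by rewrite ler_wpM2l // mulr_ge0 ?expR_ge0 // exprn_ge0 // ltW.
  have -> : expR (2 * v%:R) * x ^+ (8 * v) * (h%:R ^+ v * expR v%:R / x ^+ v) =
      (expR 3 * h%:R * x) ^+ v * x ^+ (v * 6).
    have -> : expR (2 * v%:R) = expR v%:R ^+ 2 :> R by rewrite expRM_natl.
    have -> : expR 3 = expR 1 ^+ 3 :> R by rewrite -expRM_natl mulr1.
    have -> : expR v%:R = expR 1 ^+ v :> R by rewrite -expRM_natl mulr1.
    have -> : x ^+ (8 * v) = (x ^+ v) ^+ 8 by rewrite -exprM mulnC.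
    rewrite [x ^+ (v * 6)]exprM !exprMn.
    have y0 : x ^+ v != 0 by rewrite lt0r_neq0 // exprn_gt0.
    move: (x ^+ v) (expR 1 ^+ v) (h%:R ^+ v) y0 => y E H y0.
    by field.
  have e3 : expR 3 <= 64 :> R.
    have -> : 64 = 4 ^+ 3 :> R by ring.
    have -> : expR 3 = expR 1 ^+ 3 :> R by rewrite -expRM_natl mulr1.
    rewrite lerXn2r ?nnegrE ?expR_ge0 ?ler0n //. by rewrite expR1_le4.
  apply: (@le_trans _ _ (1 * x ^+ (v * 6))).
    rewrite ler_wpM2r ?exprn_ge0 ?(ltW x_gt0) // exprn_ile1 //.
      by rewrite !mulr_ge0 ?expR_ge0 ?ler0n // ltW.
    apply: le_trans hx; rewrite ler_wpM2r ?(ltW x_gt0) // ler_wpM2r ?ler0n //.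
  rewrite mul1r [(6 * _)%N]mulnC !exprM lerXn2r ?nnegrE ?exprn_ge0 ?(ltW x_gt0) ?divr_ge0 ?ler0n //.
  by rewrite Ex; apply: ratio_pow_le.
have le1 : #|[set s : lift_data h n | dense_small_set e D s]|%:R <=
    (h * n).+1%:R * (L * ((64 * D.+1)%:R / n%:R) ^+ (6 * D.+1)).
  apply: (@le_trans _ _ (\sum_(W : {set 'I_h * 'I_n} | P #|W|) f #|W|)).
    have := card_exists_le (fun W : {set 'I_h * 'I_n} => P #|W|)
      (fun W (s : lift_data h n) => 16 * #|W| <= inner_degree_sum e s W)%N.
    rewrite -(ler_nat R) natr_sum => /le_trans; apply; apply: ler_sum => W /andP[lt_DW le_Wn].
    have W_gt0 : (0 < #|W|)%N by apply: leq_trans lt_DW.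
    have W_le : (#|W| <= n)%N by apply: leq_trans le_Wn; rewrite leq_pmull // muln_gt0.
    exact: dense_set_count.
  rewrite sum_card_set cardV big_mkcond.
  apply: (@le_trans _ _ (\sum_(v < (h * n).+1) L * ((64 * D.+1)%:R / n%:R) ^+ (6 * D.+1))).
    apply: ler_sum => v _; case: ifP => [/term//|_].
    by rewrite mulr_ge0 // exprn_ge0 // divr_ge0 ?ler0n.
  by rewrite sumr_const card_ord -[leLHS]mulr_natl.
rewrite -(ler_nat R) natrM.
apply: le_trans (ler_wpM2r (ler0n _ _) le1) _.
rewrite mulrCA -mulrA -[leRHS]mulr1 ler_wpM2l //.
rewrite expr_div_n mulrAC mulrA ler_pdivrMr ?exprn_gt0 // mul1r -!natrX -!natrM ler_nat -/c.
apply: (@leq_trans (n ^ D.+2)); last by rewrite leq_pexp2l //; lia.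
rewrite !expnS.
have : (3 * (h * n).+1 * c <= n * n)%N by nia.
have := expn_gt0 n D; nia.
Qed.

(** * Cores *)

Lemma lift_adj_sym h n (e : rel 'I_h) (s : lift_data h n) :
  symmetric e -> irreflexive e -> symmetric (lift_adj e s).
Proof.
move=> sym irr u v; rewrite /lift_adj sym.
case: ltngtP => // /val_inj eq_uv; last by rewrite -eq_uv irr.
Qed.

Lemma lift_adj_irr h n (e : rel 'I_h) (s : lift_data h n) :
  irreflexive e -> irreflexive (lift_adj e s).
Proof. by move=> irr u; rewrite /lift_adj irr. Qed.

Definition degree_in h n (e : rel 'I_h) (s : lift_data h n) (u : 'I_h * 'I_n)
  (B : {set 'I_h * 'I_n}) : nat := \sum_(v in B) lift_adj e s u v.

Definition fibre_part h n (A : {set 'I_h * 'I_n}) (i : 'I_h) : {set 'I_h * 'I_n} :=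
  [set u in A | u.1 == i].

(* Large enough to bound [32 * 4 ^ q * (2 / 5) ^ y], small enough for
   [\sum_(y <= 2 * q) 2 ^ y * core_cap q y] to be [O(4 ^ q)]. *)
Definition core_cap (q y : nat) : nat := 256 * (1 + 4 ^ q * 2 ^ y %/ 5 ^ y).

(* The obstruction left by peeling the bipartite graph between the vertices of level [k] and of
   level [l] in heavy position, with [y = q + k - l]. *)
Definition is_core h n (e : rel 'I_h) (q y : nat) (A B : {set 'I_h * 'I_n})
    (s : lift_data h n) : bool :=
  [&& [forall i, #|fibre_part A i| * 4 ^ y <= n]%N,
      [forall u in A, 64 < degree_in e s u B]%N &
      [forall v in B, core_cap q y < degree_in e s v A]%N].

(* Exponential weight of an edge leaving a fibre in which the set has density about 2^-k. *)
Definition core_weight (R : realType) (k : nat) : R := (6 + k%:R) / 12.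

(** Factor charged to a vertex [v] of [B]. If [i] is the fibre of a neighbour of [v] in [A] with
    least [k], every edge from [A] to [v] weighs at least [core_weight R (k i)]. As [i] depends on
    the lift, all candidates are summed. *)
Definition core_degree_weight (R : realType) h n (e : rel 'I_h) (c : nat)
    (A : {set 'I_h * 'I_n}) (k : 'I_h -> nat) (v : 'I_h * 'I_n) : R :=
  \sum_(i | e i v.1 && (fibre_part A i != set0)) expR (- (c%:R * core_weight R (k i) / 4)).

Lemma core_cap_ge (R : realType) q y : 32 * 4 ^+ q * (2 / 5) ^+ y <= (core_cap q y)%:R / 8 :> R.
Proof.
have -> : (core_cap q y)%:R / 8 = 32 * (1 + (4 ^ q * 2 ^ y %/ 5 ^ y)%:R) :> R.
  by rewrite /core_cap natrM natrD; field.
rewrite -mulrA ler_wpM2l ?ler0n // expr_div_n mulrA ler_pdivrMr ?exprn_gt0 //.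
rewrite -!natrX -natrM nat1r -natrM ler_nat ltnW // ltn_ceil //.
by rewrite expn_gt0.
Qed.

(** A fibre of density 2^-k whose edges have weight w = [core_weight R k] contributes 2^-k exp(2 w)
    = e (exp(1/6) / 2)^k to the exponential moment. Since exp(1/3) <= 14/9 < 8/5, two steps of k
    gain a factor 2/5, whence the 2/5 behind [core_cap]. *)
Lemma core_decay (R : realType) k y : (2 * y <= k)%N ->
  (expR (6^-1) / 2) ^+ k <= (2 / 5) ^+ y :> R.
Proof.
move=> le_yk.
have x_ge0 : 0 <= expR (6^-1) / 2 :> R by rewrite divr_ge0 ?expR_ge0 ?ler0n.
have x2 : (expR (6^-1) / 2) ^+ 2 <= 2 / 5 :> R.
  rewrite expr_div_n -expRM_natl.
  have -> : 2 * 6^-1 = 3^-1 :> R by field.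
  have third : (3^-1 : R) <= 2^-1 by lra.
  have := expR_le_quad third.
  have -> : 1 + 3^-1 + 2 * 3^-1 ^+ 2 = 14 / 9 :> R by field.
  lra.
have x1 : expR (6^-1) / 2 <= 1 :> R.
  rewrite -(@expr_le1 _ 2) //; apply: le_trans x2 _; lra.
rewrite -(subnK le_yk) exprD exprM -[leRHS]mul1r.
apply: ler_pM; rewrite ?exprn_ge0 //; first by rewrite exprn_ile1.
by rewrite lerXn2r ?nnegrE ?exprn_ge0 // divr_ge0 ?ler0n.
Qed.

(** An exponential moment bound for the total weight Y of the edges between [A] and [B]. In a core,
    Y is bounded below both by the degrees in [A] and by those in [B], and shares of Y are charged
    to each side. Part of the share of [B] is exp(-|B| [core_cap] / 8), which cancels the
    exponential moment. *)
Lemma core_pair_count (R : realType) h n (e : rel 'I_h) d q y (A B : {set 'I_h * 'I_n})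
    (k : 'I_h -> nat) :
  symmetric e -> irreflexive e -> regular e d -> (d <= 4 ^ q.+1)%N -> (0 < n)%N ->
  (forall i, fibre_part A i != set0 -> (#|fibre_part A i| * 2 ^ k i <= n)%N) ->
  (forall i, fibre_part A i != set0 -> (2 * y <= k i)%N) ->
  #|[set s : lift_data h n | is_core e q y A B s]|%:R <=
  #|lift_data h n|%:R * (expR (- (32 * \sum_(u in A) core_weight R (k u.1))) *
     \prod_(v in B) core_degree_weight R e (core_cap q y) A k v).
Proof.
move=> sym irr reg le_dq n_gt0 A_le k_ge.
pose W (u : 'I_h * 'I_n) := core_weight R (k u.1).
have W_ge u : 2^-1 <= W u by rewrite /W /core_weight; have := ler0n R (k u.1); lra.
have W_ge0 u : 0 <= W u by have := W_ge u; lra.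
pose c : R := (core_cap q y)%:R.
pose wt := core_degree_weight R e (core_cap q y) A k.
pose th (u v : 'I_h * 'I_n) := W u * ((u \in A) && (v \in B))%:R.
have th_ge0 u v : 0 <= th u v by rewrite mulr_ge0 ?ler0n.
have n0 : 0 < n%:R :> R by rewrite ltr0n.
pose Y (s : lift_data h n) := \sum_u \sum_v th u v * (lift_adj e s u v)%:R.
have YE s : Y s = \sum_(u in A) \sum_(v in B) W u * (lift_adj e s u v)%:R.
  rewrite [RHS]big_mkcond; apply: eq_bigr => u _; rewrite /th.
  case: (u \in A) => /=; last by rewrite big1 // => v _; rewrite mulr0 mul0r.
  rewrite [RHS]big_mkcond; apply: eq_bigr => v _.
  by case: (v \in B); rewrite ?mulr1 // mulr0 mul0r.
pose K := expR (- (32 * \sum_(u in A) W u)) * \prod_(v in B) (wt v * expR (- (c / 8))).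
have wt_ge0 v : 0 <= wt v by apply: sumr_ge0 => i _; apply: expR_ge0.
have K_ge0 : 0 <= K.
  by rewrite mulr_ge0 ?expR_ge0 // prodr_ge0 // => v _; rewrite mulr_ge0 ?expR_ge0.
have core_le s : is_core e q y A B s -> 1 <= expR (Y s) * K.
  move=> /and3P[_ /forall_inP degA /forall_inP degB].
  rewrite mulrC -ler_pdivrMr ?expR_gt0 // mul1r -expRN /K.
  (* One half is at least 32 times the weight of [A], by the degrees above 64; the other half is
     spent on [B]. *)
  have -> : - Y s = - (Y s / 2) + - (Y s / 2) by field.
  rewrite expRD; apply: ler_pM; rewrite ?expR_ge0 //.
    rewrite ler_expR lerN2 ler_pdivlMr // mulrAC -natrM YE mulr_sumr.
    apply: ler_sum => u uA; rewrite -mulr_sumr mulrC ler_wpM2l //.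
    by rewrite -natr_sum ler_nat ltnW // degA.
  rewrite YE exchange_big mulr_suml -sumrN expR_sum.
  apply: ler_prod => v vB; rewrite expR_ge0 /=.
  set Yv := \sum_(u in A) _.
  have degv : (core_cap q y < \sum_(u in A) lift_adj e s u v)%N.
    have := degB v vB; rewrite /degree_in.
    by under eq_bigr do rewrite (lift_adj_sym s sym irr).
  have [u1 u1P] : exists u, (u \in A) && lift_adj e s u v.
    apply/existsP; rewrite -[[exists u, _]]negbK; apply/negP => /existsPn no_u.
    move: degv; rewrite big1 // => u uA; have := no_u u; rewrite uA /=.
    by case: (lift_adj _ _ _ _).
  have Yv_ge t : (forall u, u \in A -> lift_adj e s u v -> t <= W u) -> 0 <= t -> c * t <= Yv.
    move=> t_le t_ge0; apply: (@le_trans _ _ (\sum_(u in A) t * (lift_adj e s u v)%:R)).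
      rewrite -mulr_sumr mulrC ler_wpM2l // -natr_sum ler_nat ltnW //.
    apply: ler_sum => u uA; case: (boolP (lift_adj e s u v)) => [adj|_]; last by rewrite !mulr0.
    by rewrite !mulr1 t_le.
  have -> : - (Yv / 2) = - (Yv / 4) + - (Yv / 4) by field.
  rewrite expRD; apply: ler_pM; rewrite ?expR_ge0 //; last first.
    rewrite ler_expR lerN2.
    have : c * 2^-1 <= Yv by apply: Yv_ge => [u _ _|]; rewrite ?invr_ge0 ?ler0n ?W_ge.
    lra.
  (* The neighbour with least [k] has the least weight, so one quarter of [Yv] yields its summand in
     [core_degree_weight]; the other quarter used the uniform lower bound 1/2 on weights. *)
  case: (@arg_minnP _ u1 (fun u => (u \in A) && lift_adj e s u v) (fun u => k u.1)) => // u0.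
  move=> /andP[u0A adj0] u0_min.
  have : c * W u0 <= Yv.
    apply: Yv_ge => // u uA adj; have := u0_min u; rewrite uA adj => /(_ isT).
    rewrite -(ler_nat R) /W /core_weight; lra.
  move=> le_Yv; apply: (@le_trans _ _ (expR (- (c * W u0 / 4)))).
    by rewrite ler_expR lerN2 ler_pM2r // invr_gt0 ltr0n.
  rewrite /wt /core_degree_weight (bigD1 u0.1) /=.
    by rewrite lerDl; apply: sumr_ge0 => i _; apply: expR_ge0.
  have /andP[-> _] := adj0; apply/set0Pn; exists u0; by rewrite inE u0A eqxx.
apply: (@le_trans _ _ (\sum_s expR (Y s) * K)).
  rewrite -sum1_card natr_sum big_mkcond; apply: ler_sum => s _; rewrite inE.
  by case: ifP => [/core_le//|_]; rewrite mulr_ge0 ?expR_ge0.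
rewrite -mulr_suml.
apply: (@le_trans _ _ ((#|lift_data h n|%:R * expR (#|B|%:R * (c / 8))) * K)); last first.
  rewrite -mulrA ler_wpM2l ?ler0n // /K big_split /= prodr_const -expRM_natl mulrN.
  rewrite mulrCA ler_wpM2l ?expR_ge0 // [expR (- (_%:R * _))]expRN mulrCA divff ?mulr1 //.
  by rewrite lt0r_neq0 ?expR_gt0.
rewrite ler_wpM2r //.
apply: le_trans (lift_mgf_upper sym irr th_ge0) _.
rewrite ler_wpM2l ?ler0n // ler_expR.
pose M : R := n%:R * expR 1 * (2 / 5) ^+ y.
have fib_le i : fibre_part A i != set0 -> #|fibre_part A i|%:R * expR (2 * core_weight R (k i)) <= M.
  move=> nz.
  have -> : expR (2 * core_weight R (k i)) = expR 1 * 2 ^+ k i * (expR (6^-1) / 2) ^+ k i.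
    have E : 2 * (expR 6^-1 / 2) = expR 6^-1 :> R by rewrite mulrCA divff ?pnatr_eq0 ?mulr1.
    rewrite -[RHS]mulrA -exprMn E -expRM_natr -expRD; congr expR.
    by rewrite /core_weight; field.
  apply: (@le_trans _ _ (n%:R * expR 1 * (expR (6^-1) / 2) ^+ k i)).
    rewrite mulrA ler_wpM2r ?exprn_ge0 ?divr_ge0 ?expR_ge0 ?ler0n // mulrCA mulrC.
    by rewrite ler_wpM2r ?expR_ge0 // -natrX -natrM ler_nat A_le.
  by rewrite ler_wpM2l ?mulr_ge0 ?ler0n ?expR_ge0 // core_decay // k_ge.
have M_ge0 : 0 <= M by rewrite !mulr_ge0 ?expR_ge0 ?ler0n ?exprn_ge0 ?divr_ge0 ?ler0n.
have sum_le : \sum_u \sum_v (expR (2 * th u v) - 1) / 2 * (e u.1 v.1)%:R <=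
    #|B|%:R * (d%:R * M / 2).
  have -> : #|B|%:R * (d%:R * M / 2) = \sum_v (if v \in B then d%:R * M / 2 else 0).
    by rewrite -big_mkcond sumr_const -[RHS]mulr_natl.
  rewrite exchange_big /=.
  apply: ler_sum => v _; rewrite /th; case: (v \in B); last first.
    by rewrite big1 // => u _; rewrite andbF !mulr0 expR0 subrr !mul0r.
  apply: (@le_trans _ _ (\sum_(u in A) expR (2 * W u) / 2 * (e u.1 v.1)%:R)).
    rewrite [leRHS]big_mkcond; apply: ler_sum => u _; rewrite andbT.
    case: (u \in A) => /=; last by rewrite !mulr0 expR0 subrr !mul0r.
    rewrite ler_wpM2r ?ler0n // mulr1 ler_pM2r ?invr_gt0 //; lra.
  rewrite (partition_big (fun u => u.1) predT) //=.
  apply: (@le_trans _ _ (\sum_i M / 2 * (e i v.1)%:R)).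
    apply: ler_sum => i _.
    rewrite (eq_bigr (fun=> expR (2 * core_weight R (k i)) / 2 * (e i v.1)%:R)); last first.
      by move=> u /andP[_ /eqP <-].
    rewrite sumr_const -mulrnAl ler_wpM2r ?ler0n //.
    have -> : #|[pred u in A | u.1 == i]| = #|fibre_part A i|.
      by apply: eq_card => u; rewrite !inE.
    rewrite -mulrnAl ler_pM2r ?invr_gt0 // -[_ *+ _]mulr_natl.
    have [->|nz] := eqVneq (fibre_part A i) set0; last exact: fib_le.
    by rewrite cards0 mul0r.
  rewrite -mulr_sumr -natr_sum.
  have -> : (\sum_i e i v.1)%N = d.
    by rewrite -(reg v.1) -sum1dep_card [RHS]big_mkcond; apply: eq_bigr => i _; rewrite sym; case: (e _ _).
  by rewrite mulrC mulrA.
apply: (@le_trans _ _ (expR 1 / n%:R * (#|B|%:R * (d%:R * M / 2)))).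
  by rewrite ler_wpM2l ?divr_ge0 ?expR_ge0 ?ler0n.
have -> : expR 1 / n%:R * (#|B|%:R * (d%:R * M / 2)) =
    #|B|%:R * (expR 1 ^+ 2 / 2 * d%:R * (2 / 5) ^+ y).
  by rewrite /M; field; rewrite lt0r_neq0.
(* By e <= 4 and d <= 4 * 4^q, the coefficient e^2 d / 2 is at most 32 * 4^q, the constant of
   [core_cap_ge]. *)
rewrite ler_wpM2l ?ler0n //; apply: le_trans (core_cap_ge R q y).
rewrite ler_wpM2r ?exprn_ge0 ?divr_ge0 ?ler0n //.
have e2 : expR 1 ^+ 2 <= 4 ^+ 2 :> R.
  by rewrite lerXn2r ?nnegrE ?expR_ge0 ?ler0n ?expR1_le4.
have d_le : d%:R <= 4 * 4 ^+ q :> R by rewrite -exprS -natrX ler_nat.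
apply: (@le_trans _ _ (8 * (4 * 4 ^+ q))); last by rewrite mulrA -natrM.
by apply: ler_pM; rewrite ?divr_ge0 ?sqr_ge0 ?ler0n //; lra.
Qed.

Lemma expR_gt_poly (R : realType) (c : R) (p C : nat) : 0 < c ->
  exists N, forall n, (N <= n)%N -> C%:R * n%:R ^+ p <= expR (c * n%:R).
Proof.
move=> c_gt0; pose x := C%:R * (p.+1)`!%:R / c ^+ p.+1.
have x_ge0 : 0 <= x by rewrite divr_ge0 ?mulr_ge0 ?ler0n // exprn_ge0 // ltW.
exists (Num.trunc x).+1 => n le_n.
have le_xn : x <= n%:R.
  by apply: le_trans (ltW (truncnS_gt x)) _; rewrite ler_nat.
have cn_ge0 : 0 <= c * n%:R by rewrite mulr_ge0 ?ler0n // ltW.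
apply: (@le_trans _ _ ((c * n%:R) ^+ p.+1 / (p.+1)`!%:R)); last first.
  by apply: le_trans (expR_ge1Dxn p cn_ge0); rewrite lerDr.
rewrite ler_pdivlMr ?ltr0n ?fact_gt0 // exprMn [n%:R ^+ p.+1]exprSr mulrA.
have -> : C%:R * n%:R ^+ p * (p.+1)`!%:R = x * (c ^+ p.+1 * n%:R ^+ p).
  by rewrite /x [RHS]mulrA divfK 1?mulrAC // lt0r_neq0 // exprn_gt0.
by rewrite [leRHS]mulrC ler_wpM2r // mulr_ge0 ?exprn_ge0 ?ler0n // ltW.
Qed.

(** Makes [core_cap] at least of order q - y, so that the factors of [core_degree_weight] beat the
    degree d <= 4^(q+1) even where 4^q (2/5)^y is small. *)
Lemma leq_core_cap q y : (q <= y + 4 ^ q * 2 ^ y %/ 5 ^ y)%N.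
Proof.
rewrite -leq_subLR leq_divRL ?expn_gt0 //.
have [le_qy|/ltnW le_yq] := leqP q y.
  by rewrite (eqP (_ : (q - y == 0)%N)) // subn_eq0.
rewrite -{2}(subnK le_yq) expnD -mulnA -expnMn.
apply: leq_mul; first by apply: ltnW; apply: ltn_expl.
by case: (posnP y) => [->//|y_gt0]; rewrite leq_exp2r.
Qed.

(** Summing [core_pair_count] over all [B] gives a product of 1 + wt(v), at most the exponential of
    the total of wt. A nonempty fibre of [A] of density about 2^-k is seen from d n vertices and
    adds to that total at most its own size, so the choice of [B] costs only exp |A|. *)
Lemma core_set_count (R : realType) h n (e : rel 'I_h) d q y (A : {set 'I_h * 'I_n})
    (k : 'I_h -> nat) :
  symmetric e -> irreflexive e -> regular e d -> (d <= 4 ^ q.+1)%N -> (0 < n)%N ->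
  (forall i, fibre_part A i != set0 ->
     #|fibre_part A i| * 2 ^ k i <= n < #|fibre_part A i| * 2 ^ (k i).+1)%N ->
  #|[set s : lift_data h n | [exists B, is_core e q y A B s]]|%:R <=
  #|lift_data h n|%:R * \prod_(u in A) expR (- (13 + (k u.1 + 2)%:R)) :> R.
Proof.
move=> sym irr reg le_dq n_gt0 A_dens.
have [/forallP A_le|/forallPn[i A_gt]] := boolP [forall i, #|fibre_part A i| * 4 ^ y <= n]%N; last first.
  rewrite (_ : [set s | _] = set0) ?cards0 ?mulr_ge0 ?ler0n ?prodr_ge0 // => [u _|].
    exact: expR_ge0.
  apply/setP => s; rewrite !inE; apply/negbTE/negP => /existsP[B /and3P[/forallP A_le _ _]].
  by have := A_le i; rewrite (negPf A_gt).
have k_ge i : fibre_part A i != set0 -> (2 * y <= k i)%N.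
  move=> nz; have /andP[_ lt_n] := A_dens i nz.
  have := leq_ltn_trans (A_le i) lt_n; rewrite ltn_pmul2l ?card_gt0 //.
  by rewrite (_ : 4 = 2 ^ 2)%N // -expnM ltn_exp2l.
pose c : R := (core_cap q y)%:R.
pose wt := core_degree_weight R e (core_cap q y) A k.
have wt_ge0 v : 0 <= wt v by apply: sumr_ge0 => i _; apply: expR_ge0.
pose E i : R := expR (- (c * core_weight R (k i) / 4)).
have E_le i : fibre_part A i != set0 -> d%:R * 2 ^+ (k i).+1 * E i <= 1.
  move=> nz; rewrite /E expRN ler_pdivrMr ?expR_gt0 // mul1r.
  set t := (4 ^ q * 2 ^ y %/ 5 ^ y)%N.
  have qt : (q <= y + t)%N by apply: leq_core_cap.
  apply: (@le_trans _ _ (expR 1 ^+ (5 * (1 + t) * (6 + k i)))).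
    apply: (@le_trans _ _ (2 ^+ (5 * (1 + t) * (6 + k i)))); last first.
      by rewrite lerXn2r ?nnegrE ?expR_ge0 ?ler0n ?expR1_ge2.
    rewrite -!natrX -natrM ler_nat.
    apply: (@leq_trans (4 ^ q.+1 * 2 ^ (k i).+1)); first by rewrite leq_mul2r le_dq orbT.
    rewrite (_ : 4 = 2 ^ 2)%N // -expnM -expnD leq_exp2l //.
    have := k_ge i nz; nia.
  rewrite -expRM_natr mul1r ler_expR /c /core_weight /core_cap -/t !natrM !natrD.
  have -> : 256 * (1 + t%:R) * ((6 + (k i)%:R) / 12) / 4 =
    (16 / 3) * ((1 + t%:R) * (6 + (k i)%:R)) :> R by field.
  rewrite -[5 * _ * _]mulrA ler_wpM2r ?mulr_ge0 ?addr_ge0 ?ler0n //; lra.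
have sum_wt : \sum_v wt v <= #|A|%:R.
  rewrite /wt /core_degree_weight (exchange_big_dep (fun i => fibre_part A i != set0)) /=; last first.
    by move=> v i _ /andP[].
  have cardA : #|A|%:R = \sum_(i | fibre_part A i != set0) #|fibre_part A i|%:R :> R.
    rewrite -natr_sum -sum1_card (partition_big (fun u => u.1) predT) //=; congr _%:R.
    rewrite [RHS]big_mkcond; apply: eq_bigr => i _.
    rewrite (eq_bigl (fun u => u \in fibre_part A i)) => [|u]; last by rewrite inE.
    by rewrite sum1_card; case: eqVneq => [->|//]; rewrite cards0.
  rewrite cardA; apply: ler_sum => i nz; rewrite sumr_const -/(E i).
  have -> : #|[pred v : 'I_h * 'I_n | e i v.1 && (fibre_part A i != set0)]| = (d * n)%N.
    rewrite -(reg i) -[n in (_ * n)%N]card_ord -cardX; apply: eq_card => -[i' j].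
    by rewrite !inE /= nz !andbT.
  rewrite -[_ *+ (d * n)]mulr_natl natrM.
  have /andP[_ lt_n] := A_dens i nz.
  apply: (@le_trans _ _ (d%:R * (#|fibre_part A i| * 2 ^ (k i).+1)%:R * E i)).
    by rewrite ler_wpM2r ?expR_ge0 // ler_wpM2l ?ler0n // ler_nat ltnW.
  have -> : d%:R * (#|fibre_part A i| * 2 ^ (k i).+1)%:R * E i =
    #|fibre_part A i|%:R * (d%:R * 2 ^+ (k i).+1 * E i).
    by rewrite natrM natrX; ring.
  by rewrite -[leRHS]mulr1 ler_wpM2l ?ler0n ?E_le.
pose x : R := expR (- (32 * \sum_(u in A) core_weight R (k u.1))).
apply: (@le_trans _ _ (\sum_(B : {set 'I_h * 'I_n})
    #|lift_data h n|%:R * (x * \prod_(v in B) wt v))).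
  have := card_exists_le predT (fun B (s : lift_data h n) => is_core e q y A B s).
  rewrite -(ler_nat R) natr_sum => /le_trans; apply; apply: ler_sum => B _.
  by apply: (@core_pair_count R h n e d q y A B k) => // i /A_dens /andP[].
rewrite -!mulr_sumr ler_wpM2l ?ler0n //.
apply: (@le_trans _ _ (x * expR #|A|%:R)).
  rewrite ler_wpM2l ?expR_ge0 //.
  apply: (@le_trans _ _ (\prod_v (wt v + 1))).
    by rewrite bigA_distr; apply: ler_sum => B _; rewrite -big_mkcond.
  apply: (@le_trans _ _ (expR (\sum_v wt v))); last by rewrite ler_expR.
  rewrite expR_sum; apply: ler_prod => v _; rewrite addrC expR_ge1Dx andbT.
  by rewrite addr_ge0.
have -> : #|A|%:R = \sum_(u in A) 1 :> R by rewrite sumr_const.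
rewrite /x -expRD -expR_sum ler_expR mulr_sumr -sumrN -big_split /=.
(* Per vertex, 32 [core_weight] - 1 = 15 + 8k/3 >= 13 + (k + 2). *)
apply: ler_sum => u _; rewrite natrD /core_weight.
have := ler0n R (k u.1); lra.
Qed.

(** Since y = q + k - l with levels at distance less than q, only y <= 2 q can occur. *)
Definition has_large_core h n (e : rel 'I_h) (q E : nat) (s : lift_data h n) : bool :=
  [exists y : 'I_(2 * q).+1, [exists A : {set 'I_h * 'I_n},
     (n < E * #|A|)%N && [exists B, is_core e q y A B s]]].

Lemma card_fibre_part h n (A : {set 'I_h * 'I_n}) i : (#|fibre_part A i| <= n)%N.
Proof.
rewrite -[n in (_ <= n)%N]card_ord -(card_in_imset (f := snd) (D := fibre_part A i)).
  exact: max_card.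
move=> [i1 j1] [i2 j2]; rewrite !inE /= => /andP[_ /eqP ->] /andP[_ /eqP ->] /= -> //.
Qed.

Lemma sum_fibre_part (R : ringType) h n (A : {set 'I_h * 'I_n}) :
  #|A|%:R = \sum_i #|fibre_part A i|%:R :> R.
Proof.
rewrite -natr_sum -sum1_card (partition_big (fun u => u.1) predT) //=; congr _%:R.
apply: eq_bigr => i _; rewrite -sum1_card.
by apply: eq_bigl => u; rewrite inE.
Qed.

(** The sets [A] are grouped by the dyadic densities of their fibres, which gives at most (n + 2)^h
    profiles. Within a profile, the weights exp(-(k + 2)) have total at most |A| over all vertices,
    so summing over [A] costs one factor exp |A|. Of the gain exp(-13 |A|), exp(-12 |A|) remains,
    and |A| > n/E. *)
Lemma large_core_count (R : realType) h n (e : rel 'I_h) d q E y :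
  symmetric e -> irreflexive e -> regular e d -> (d <= 4 ^ q.+1)%N -> (0 < n)%N -> (0 < E)%N ->
  #|[set s : lift_data h n | [exists A : {set 'I_h * 'I_n},
     (n < E * #|A|)%N && [exists B, is_core e q y A B s]]]|%:R <=
  (n.+2 ^ h)%:R * (#|lift_data h n|%:R * expR (- (12 * (n%:R / E%:R)))) :> R.
Proof.
move=> sym irr reg le_dq n_gt0 E_gt0.
have n0 : 0 < n%:R :> R by rewrite ltr0n.
(* [None] marks an empty fibre, [Some k] a density in (2^-(k+1), 2^-k]. *)
pose dens (r : {ffun 'I_h -> option 'I_n.+1}) (A : {set 'I_h * 'I_n}) :=
  [forall i, if r i is Some k then
     (0 < #|fibre_part A i|)%N && (#|fibre_part A i| * 2 ^ k <= n < #|fibre_part A i| * 2 ^ k.+1)%N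
   else fibre_part A i == set0].
have densP A : exists r, dens r A.
  exists [ffun i => if fibre_part A i == set0 then None
    else Some (inord (trunc_log 2 (n %/ #|fibre_part A i|)))].
  apply/forallP => i; rewrite ffunE; case: eqVneq => // nz.
  have a_gt0 : (0 < #|fibre_part A i|)%N by rewrite card_gt0.
  have m_gt0 : (0 < n %/ #|fibre_part A i|)%N by rewrite divn_gt0 // card_fibre_part.
  have /andP[le_m lt_m] := trunc_log_bounds (isT : 1 < 2)%N m_gt0.
  rewrite a_gt0 /= inordK; last first.
    rewrite ltnS; apply: (leq_trans (ltnW (ltn_expl _ (isT : 1 < 2)%N))).
    by apply: (leq_trans le_m); apply: leq_div.
  by rewrite mulnC -leq_divRL // le_m /= mulnC -ltn_divLR.
pose w (r : {ffun 'I_h -> option 'I_n.+1}) (u : 'I_h * 'I_n) : R :=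
  if r u.1 is Some k then expR (- (k + 2)%:R) else 0.
pose L : R := #|lift_data h n|%:R.
pose cnt A := #|[set s : lift_data h n | [exists B, is_core e q y A B s]]|.
have w_ge0 r u : 0 <= w r u by rewrite /w; case: (r _) => // k; apply: expR_ge0.
pose ab (r : {ffun 'I_h -> option 'I_n.+1}) : R := \sum_u w r u.
have cnt_le r A : dens r A -> (n < E * #|A|)%N ->
    (cnt A)%:R <= L * expR (- (12 * (n%:R / E%:R))) * (expR (- ab r) * \prod_(u in A) w r u).
  move=> /forallP dr lt_n.
  pose k i : nat := if r i is Some k then k else 0%N.
  have dk i : fibre_part A i != set0 ->
      (#|fibre_part A i| * 2 ^ k i <= n < #|fibre_part A i| * 2 ^ (k i).+1)%N.
    by move=> nz; have := dr i; rewrite /k; case: (r i) => [k' /andP[]|] //; rewrite (negPf nz).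
  apply: le_trans (core_set_count R y sym irr reg le_dq n_gt0 dk) _.
  rewrite -[leRHS]mulrA ler_wpM2l ?ler0n //.
  have wE u : u \in A -> w r u = expR (- (k u.1 + 2)%:R).
    move=> uA; have := dr u.1; rewrite /w /k; case: (r u.1) => // /eqP E0.
    have : u \in fibre_part A u.1 by rewrite inE uA eqxx.
    by rewrite E0 inE.
  rewrite (eq_bigr (fun u => expR (- 13) * w r u)) => [|u uA]; last first.
    by rewrite wE // -expRD -opprD.
  rewrite big_split /= mulrA ler_wpM2r ?prodr_ge0 // prodr_const -expRM_natl -expRD ler_expR.
  have lt_nA : n%:R / E%:R <= #|A|%:R :> R.
    by rewrite ler_pdivrMr ?ltr0n // -natrM ler_nat mulnC ltnW.
  have ab_le : ab r <= #|A|%:R.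
    rewrite /ab sum_pairE sum_fibre_part; apply: ler_sum => i _.
    rewrite /w /=; have := dr i; case: (r i) => [k'|_]; last by rewrite big1 ?ler0n.
    move=> /andP[_ /andP[_ lt_n']].
    rewrite sumr_const card_ord -[_ *+ n]mulr_natl expRN ler_pdivrMr ?expR_gt0 //.
    apply: (@le_trans _ _ (#|fibre_part A i|%:R * 2 ^+ k'.+1)).
      by rewrite -natrX -natrM ler_nat ltnW.
    rewrite ler_wpM2l ?ler0n // -[X in expR X]mul1r expRM_natr.
    apply: (@le_trans _ _ (2 ^+ (k' + 2))).
      by rewrite -!natrX ler_nat leq_exp2l // addn2.
    by rewrite lerXn2r ?nnegrE ?expR_ge0 ?ler0n ?expR1_ge2.
  lra.
apply: (@le_trans _ _ (\sum_(A : {set 'I_h * 'I_n} | (n < E * #|A|)%N) (cnt A)%:R)).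
  have := card_exists_le (fun A : {set 'I_h * 'I_n} => n < E * #|A|)%N
    (fun A (s : lift_data h n) => [exists B, is_core e q y A B s]).
  by rewrite -(ler_nat R) natr_sum.
apply: (@le_trans _ _ (\sum_(A : {set 'I_h * 'I_n}) \sum_r
    L * expR (- (12 * (n%:R / E%:R))) * (expR (- ab r) * \prod_(u in A) w r u))).
  have K_ge0 (r : {ffun 'I_h -> option 'I_n.+1}) (A : {set 'I_h * 'I_n}) :
      0 <= L * expR (- (12 * (n%:R / E%:R))) * (expR (- ab r) * \prod_(u in A) w r u).
    by rewrite !mulr_ge0 ?expR_ge0 ?ler0n ?prodr_ge0.
  rewrite big_mkcond; apply: ler_sum => A _; case: ifP => [lt_n|_]; last exact: sumr_ge0.
  have [r dr] := densP A; rewrite (bigD1 r) //=.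
  by apply: le_trans (cnt_le r A dr lt_n) _; rewrite lerDl sumr_ge0.
rewrite exchange_big /=.
have -> : (n.+2 ^ h)%N = #|{ffun 'I_h -> option 'I_n.+1}|.
  by rewrite card_ffun card_option !card_ord.
set K := L * _; have -> : #|{ffun 'I_h -> option 'I_n.+1}|%:R * K =
    \sum_(r : {ffun 'I_h -> option 'I_n.+1}) K by rewrite sumr_const -[RHS]mulr_natl.
apply: ler_sum => r _.
rewrite -mulr_sumr -[leRHS]mulr1 ler_wpM2l ?mulr_ge0 ?expR_ge0 ?ler0n //.
rewrite -mulr_sumr expRN mulrC ler_pdivrMr ?expR_gt0 // mul1r.
apply: (@le_trans _ _ (\prod_u (w r u + 1))).
  by rewrite bigA_distr; apply: ler_sum => B _; rewrite -big_mkcond.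
rewrite /ab expR_sum; apply: ler_prod => v _; rewrite addrC expR_ge1Dx andbT.
by rewrite addr_ge0.
Qed.

Lemma large_core_rare (R : realType) h (e : rel 'I_h) d q E D :
  symmetric e -> irreflexive e -> regular e d -> (d <= 4 ^ q.+1)%N -> (0 < E)%N ->
  exists N, forall n, (N <= n)%N ->
    (#|[set s : lift_data h n | has_large_core e q E s]| * (3 * n ^ D) <= #|lift_data h n|)%N.
Proof.
move=> sym irr reg le_dq E_gt0.
have c_gt0 : 0 < 12 / E%:R :> R by rewrite divr_gt0 ?ltr0n.
have [N N_le] := expR_gt_poly (h + D) ((2 * q).+1 * 3 ^ h * 3) c_gt0.
exists (maxn N 1) => n; rewrite geq_max => /andP[le_Nn n_gt0].
have := N_le n le_Nn; set x : R := 12 / E%:R * n%:R => le_x.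
pose L : R := #|lift_data h n|%:R.
have cnt_le : #|[set s : lift_data h n | has_large_core e q E s]|%:R <=
    (2 * q).+1%:R * ((n.+2 ^ h)%:R * (L * expR (- x))).
  apply: (@le_trans _ _ (\sum_(y < (2 * q).+1) (n.+2 ^ h)%:R * (L * expR (- x)))); last first.
    by rewrite sumr_const card_ord -[leLHS]mulr_natl.
  have := card_exists_le predT (fun (y : 'I_(2 * q).+1) (s : lift_data h n) =>
    [exists A : {set 'I_h * 'I_n}, (n < E * #|A|)%N && [exists B, is_core e q y A B s]]).
  rewrite -(ler_nat R) natr_sum => /le_trans; apply; apply: ler_sum => y _.
  have -> : x = 12 * (n%:R / E%:R) by rewrite /x; ring.
  by apply: (large_core_count R y sym irr reg).
rewrite -(ler_nat R) natrM; apply: le_trans (ler_wpM2r (ler0n _ _) cnt_le) _.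
have -> : (2 * q).+1%:R * ((n.+2 ^ h)%:R * (L * expR (- x))) * (3 * n ^ D)%:R =
  L * (((2 * q).+1 * n.+2 ^ h * (3 * n ^ D))%:R * expR (- x)).
  by rewrite !natrM; ring.
rewrite -[leRHS]mulr1 ler_wpM2l ?ler0n // expRN ler_pdivrMr ?expR_gt0 // mul1r.
apply: le_trans le_x; rewrite -natrX -natrM ler_nat.
have le_h : (n.+2 ^ h <= 3 ^ h * n ^ h)%N.
  by rewrite -expnMn; case: (posnP h) => [->//|h_gt0]; rewrite leq_exp2r //; lia.
rewrite expnD (_ : _ * _ * 3 * _ = (2 * q).+1 * (3 ^ h * n ^ h) * (3 * n ^ D))%N; last by ring.
by rewrite leq_mul2r leq_mul2l le_h !orbT.
Qed.

(** * Light sums over all dyadic vectors *)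

Lemma card_exists_const_le (R : realType) (T I : finType) (P : I -> pred T) (C : R) :
  (forall i, #|[set s | P i s]|%:R <= C) ->
  #|[set s | [exists i, P i s]]|%:R <= #|I|%:R * C.
Proof.
move=> P_le; apply: (@le_trans _ _ (\sum_(i : I) C)); last first.
  by rewrite sumr_const -[leLHS]mulr_natl.
have := card_exists_le predT P; rewrite -(ler_nat R) natr_sum => /le_trans; apply.
by apply: ler_sum => i _; apply: P_le.
Qed.

Definition dyadic_value (R : realType) (m : nat) (x : option (bool * 'I_m)) : R :=
  if x is Some (b, k) then (-1) ^+ b * 2 ^+ k else 0.

Definition level_dist (k l : nat) : nat := (k - l + (l - k))%N.

(** Light pairs are classified by [j], the smaller of the two sums of level and scale. Lightness
    gives k + l <= q + j, so the normalisation makes the coefficient at most 1/256, as [lift_mgf]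
    requires. The sign [b] gives access to both tails. *)
Definition light_coef (R : realType) h n (e : rel 'I_h) (q m j : nat) (b : bool)
    (K : {ffun 'I_h -> 'I_m}) (z : {ffun 'I_h * 'I_n -> option (bool * 'I_m)})
    (u v : 'I_h * 'I_n) : R :=
  if z u is Some (_, k) then if z v is Some (_, l) then
    if [&& minn (k + K u.1) (l + K v.1) == j, l <= q + K u.1 & k <= q + K v.1]%N
    then (-1) ^+ b * (dyadic_value R (z u) * dyadic_value R (z v) / (256 * 2 ^+ (q + j)))
    else 0
  else 0 else 0.

(* The entropy paid for [z] in the union bound: a fibre of scale [K i] contains at
   most [n * 4 ^ (K i - k)] vertices of level [k > K i]. *)
Definition label_cost h n (m : nat) (K : {ffun 'I_h -> 'I_m})
    (z : {ffun 'I_h * 'I_n -> option (bool * 'I_m)}) : nat :=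
  \sum_u (if z u is Some (_, k) then 2 * (1 + level_dist k (K u.1)) else 0).

(* [n * absence_cost] bounds the logarithm of the sum of [expR (- label_cost)] over all labellings. *)
Definition absence_cost (R : realType) h (m j : nat) (K : {ffun 'I_h -> 'I_m}) : R :=
  \sum_i \sum_(p : bool * 'I_m | (j <= p.2 + K i)%N) 4^-1 ^+ (1 + level_dist p.2 (K i)).

(** The variance exponent of [lift_mgf], the price of the union bound over [z] in two parts, and a
    margin [eta * n] that becomes the failure probability. *)
Definition light_bound (R : realType) h n (e : rel 'I_h) (q m j : nat) (b : bool) (eta : R)
    (K : {ffun 'I_h -> 'I_m}) (z : {ffun 'I_h * 'I_n -> option (bool * 'I_m)}) : R :=
  256 / n%:R * (\sum_u \sum_v light_coef R e q j b K z u v ^+ 2 * (e u.1 v.1)%:R) +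
  (label_cost K z)%:R + n%:R * absence_cost R j K + eta * n%:R.

Definition light_deviation (R : realType) h n (e : rel 'I_h) (q m j : nat) (b : bool)
    (K : {ffun 'I_h -> 'I_m}) (z : {ffun 'I_h * 'I_n -> option (bool * 'I_m)})
    (s : lift_data h n) : R :=
  \sum_u \sum_v light_coef R e q j b K z u v *
    ((lift_adj e s u v)%:R - (e u.1 v.1)%:R / n%:R).

(** Only vertices whose sum of level and scale is at least [j] meet class [j]. Ignoring the others
    keeps the entropy affordable for large [j], where the normalisation is undone by a factor
    2^j. *)
Definition supported_above h n (m j : nat) (K : {ffun 'I_h -> 'I_m})
    (z : {ffun 'I_h * 'I_n -> option (bool * 'I_m)}) : bool :=
  [forall u, if z u is Some (_, k) then (j <= k + K u.1)%N else true].

Definition light_failure (R : realType) h n (e : rel 'I_h) (q m : nat) (eta : R)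
    (s : lift_data h n) : bool :=
  [exists j : 'I_(2 * m), [exists b : bool, [exists K : {ffun 'I_h -> 'I_m},
   [exists z : {ffun 'I_h * 'I_n -> option (bool * 'I_m)}, supported_above j K z &&
     (light_bound e q j b eta K z < light_deviation R e q j b K z s)]]]].

Lemma light_coef_le (R : realType) h n (e : rel 'I_h) (q m j : nat) (b : bool)
    (K : {ffun 'I_h -> 'I_m}) (z : {ffun 'I_h * 'I_n -> option (bool * 'I_m)}) u v :
  `|light_coef R e q j b K z u v| <= 256^-1.
Proof.
have c_ge0 : 0 <= 256^-1 :> R by rewrite invr_ge0 ler0n.
rewrite /light_coef /dyadic_value.
case: (z u) => [[b1 k]|]; last by rewrite normr0.
case: (z v) => [[b2 l]|]; last by rewrite normr0.
case: ifP => [/and3P[/eqP min_j le_l le_k]|_]; last by rewrite normr0.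
have -> : (-1) ^+ b * ((-1) ^+ b1 * 2 ^+ k * ((-1) ^+ b2 * 2 ^+ l) / (256 * 2 ^+ (q + j))) =
    (-1) ^+ b * ((-1) ^+ b1 * ((-1) ^+ b2 * (256^-1 * (2 ^+ k * 2 ^+ l / 2 ^+ (q + j))))) :> R.
  by rewrite [(256 * _)^-1]invfM; ring.
rewrite !normrMsign ger0_norm ?mulr_ge0 ?invr_ge0 ?exprn_ge0 ?ler0n // -[leRHS]mulr1.
rewrite ler_wpM2l // ler_pdivrMr ?exprn_gt0 ?ltr0n // mul1r -exprD -!natrX ler_nat leq_exp2l //.
move: min_j; rewrite /minn; case: ltnP; lia.
Qed.

Lemma sum_option (A : nmodType) (T : finType) (F : option T -> A) :
  \sum_x F x = F None + \sum_x F (Some x).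
Proof.
rewrite (bigD1 None) //=; congr (_ + _).
rewrite (reindex_omap Some id) => [|[x|]] //=.
by apply: eq_bigl => x; rewrite eqxx.
Qed.

(** For fixed [z] this is Markov's inequality with [lift_mgf]. The sum of exp(-[label_cost]) over
    supported [z] factorises over vertices into factors 1 + sum <= exp(sum), and e^-2 <= 1/4 bounds
    their product by exp(n [absence_cost]), which [light_bound] prepaid. *)
Lemma light_failure_count (R : realType) h n (e : rel 'I_h) q m j b (eta : R)
    (K : {ffun 'I_h -> 'I_m}) :
  symmetric e -> irreflexive e ->
  #|[set s : lift_data h n | [exists z : {ffun 'I_h * 'I_n -> option (bool * 'I_m)},
     supported_above j K z && (light_bound e q j b eta K z < light_deviation R e q j b K z s)]]|%:R
  <= #|lift_data h n|%:R * expR (- (eta * n%:R)) :> R.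
Proof.
move=> sym irr; pose L : R := #|lift_data h n|%:R.
pose label := option (bool * 'I_m).
pose wt (u : 'I_h * 'I_n) (x : label) : R :=
  if x is Some p then
    if (j <= p.2 + K u.1)%N then expR (- (2 * (1 + level_dist p.2 (K u.1)))%:R) else 0
  else 1.
have wt_ge0 u x : 0 <= wt u x.
  by rewrite /wt; case: x => [p|]; [case: ifP => _; rewrite ?expR_ge0|exact: ler01].
pose c := L * expR (- (eta * n%:R)) * expR (- (n%:R * absence_cost R j K)).
have c_ge0 : 0 <= c by rewrite !mulr_ge0 ?ler0n ?expR_ge0.
have := card_exists_le (fun z : {ffun 'I_h * 'I_n -> label} => supported_above j K z)
  (fun z (s : lift_data h n) => light_bound e q j b eta K z < light_deviation R e q j b K z s).
rewrite -(ler_nat R) natr_sum => /le_trans; apply.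
apply: (@le_trans _ _ (\sum_(z : {ffun 'I_h * 'I_n -> label}) c * \prod_u wt u (z u))).
  rewrite big_mkcond; apply: ler_sum => z _; case: ifP => [/forallP supp|_]; last first.
    by rewrite mulr_ge0 ?prodr_ge0.
  have -> : \prod_u wt u (z u) = expR (- (label_cost K z)%:R).
    rewrite /label_cost natr_sum -sumrN expR_sum; apply: eq_bigr => u _.
    have := supp u; rewrite /wt; case: (z u) => [[b' k]|] /=; last by rewrite oppr0 expR0.
    by move=> ->.
  apply: le_trans (card_le_sum_expR (X := fun s => light_deviation R e q j b K z s -
    light_bound e q j b eta K z) _) _ => [s /ltW|]; first by rewrite subr_ge0.
  rewrite (eq_bigr (fun s : lift_data h n => expR (- light_bound e q j b eta K z) *
     expR (light_deviation R e q j b K z s))) => [|s _]; last by rewrite -expRD addrC.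
  rewrite -mulr_sumr.
  apply: le_trans (ler_wpM2l (expR_ge0 _) (lift_mgf sym irr (@light_coef_le R h n e q m j b K z))) _.
  have -> : c * expR (- (label_cost K z)%:R) =
      L * expR (- (eta * n%:R) + (- (n%:R * absence_cost R j K) - (label_cost K z)%:R)).
    by rewrite !expRD /c -!mulrA.
  rewrite mulrCA ler_wpM2l ?ler0n // -expRD ler_expR /light_bound.
  set A := 256 / n%:R * _; set B := (label_cost K z)%:R; set C := n%:R * _; set D := eta * _.
  by rewrite !opprD; lra.
rewrite -mulr_sumr -(bigA_distr_bigA wt) /c -/L -mulrA -[leRHS]mulr1.
rewrite ler_wpM2l ?mulr_ge0 ?ler0n ?expR_ge0 // expRN mulrC ler_pdivrMr ?expR_gt0 // mul1r.
rewrite /absence_cost mulr_sumr.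
have -> : \sum_i n%:R * (\sum_(p : bool * 'I_m | (j <= p.2 + K i)%N) 4^-1 ^+ (1 + level_dist p.2 (K i))) =
    \sum_(u : 'I_h * 'I_n) \sum_(p : bool * 'I_m | (j <= p.2 + K u.1)%N) 4^-1 ^+ (1 + level_dist p.2 (K u.1)) :> R.
  by rewrite [RHS]sum_pairE; apply: eq_bigr => i _; rewrite /= sumr_const card_ord -[RHS]mulr_natl.
rewrite expR_sum; apply: ler_prod => u _; rewrite sumr_ge0 //=.
rewrite sum_option {1}/wt; apply: le_trans (expR_ge1Dx _); rewrite lerD2l.
rewrite /wt -big_mkcond; apply: ler_sum => p _.
rewrite natrM expRN expRM_natl exprVn lef_pV2 ?posrE ?exprn_gt0 ?expR_gt0 ?ltr0n //.
rewrite -[X in expR X]mul1r expRM_natr -exprM mulnC exprM.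
rewrite lerXn2r ?nnegrE ?exprn_ge0 ?expR_ge0 ?ler0n //.
have -> : 4 = 2 ^+ 2 :> R by ring.
by rewrite lerXn2r ?nnegrE ?expR_ge0 ?ler0n ?expR1_ge2.
Qed.

Lemma light_failure_rare (R : realType) h (e : rel 'I_h) q m D (eta : R) :
  symmetric e -> irreflexive e -> 0 < eta ->
  exists N, forall n, (N <= n)%N ->
    (#|[set s : lift_data h n | light_failure e q m eta s]| * (3 * n ^ D) <= #|lift_data h n|)%N.
Proof.
move=> sym irr eta_gt0.
have [N N_le] := expR_gt_poly D (2 * m * (2 * m ^ h) * 3) eta_gt0.
exists N => n le_Nn.
have := N_le n le_Nn; set x : R := eta * n%:R => le_x.
pose L : R := #|lift_data h n|%:R.
have cnt_le : #|[set s : lift_data h n | light_failure e q m eta s]|%:R <=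
    (2 * m * (2 * m ^ h))%:R * (L * expR (- x)).
  rewrite natrM -mulrA -[X in X%:R * _]card_ord; apply: card_exists_const_le => j.
  rewrite natrM -mulrA -[X in X%:R * _]card_bool; apply: card_exists_const_le => b.
  have -> : (m ^ h)%N = #|{ffun 'I_h -> 'I_m}| by rewrite card_ffun !card_ord.
  by apply: card_exists_const_le => K; apply: light_failure_count.
rewrite -(ler_nat R) natrM; apply: le_trans (ler_wpM2r (ler0n _ _) cnt_le) _.
rewrite mulrAC -natrM mulrCA -[leRHS]mulr1 ler_wpM2l ?ler0n //.
rewrite expRN ler_pdivrMr ?expR_gt0 // mul1r; apply: le_trans le_x.
by rewrite -natrX -natrM ler_nat mulnA.
Qed.

(** * Light pairs of a dyadic vector *)

Definition zval (R : pzRingType) (x : option (bool * nat)) : R :=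
  if x is Some (b, k) then (-1) ^+ b * 2 ^+ k else 0.

Definition zlev (x : option (bool * nat)) : nat := if x is Some (_, k) then k else 0%N.

Lemma normr_zval (R : realType) x : `|zval R x| = 2 ^+ zlev x * (x != None)%:R.
Proof.
case: x => [[b k]|] /=; last by rewrite normr0 mulr0.
by rewrite normrMsign ger0_norm ?exprn_ge0 ?ler0n // mulr1.
Qed.

Lemma sqr_zval (R : realType) x : zval R x ^+ 2 = 4 ^+ zlev x * (x != None)%:R.
Proof.
case: x => [[b k]|] /=; last by rewrite expr0n mulr0.
by rewrite exprMn sqrr_sign mul1r mulr1 -exprM mulnC exprM (_ : 2 ^+ 2 = 4) //; ring.
Qed.

(* [n * 4 ^ K i] is the square mass of [z] on the fibre over [i] up to a factor 4; the
   additive [n] accounts for the case [K i = 0]. *)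
Definition fibre_scale (R : realType) h n (z : 'I_h * 'I_n -> option (bool * nat))
    (K : 'I_h -> nat) : Prop :=
  forall i, \sum_j zval R (z (i, j)) ^+ 2 <= n%:R * 4 ^+ K i <=
    n%:R + 4 * \sum_j zval R (z (i, j)) ^+ 2.

Lemma sum_pow2_le (R : realType) N p :
  \sum_(j < N | (j <= p)%N) 2 ^+ j <= 2 * 2 ^+ p :> R.
Proof.
suff le_min : \sum_(j < N | (j <= p)%N) 2 ^+ j + 1 <= 2 ^+ minn N p.+1 :> R.
  rewrite -exprS; apply: (@le_trans _ _ (2 ^+ minn N p.+1)).
    by apply: le_trans le_min; rewrite lerDl.
  by rewrite -!natrX ler_nat leq_exp2l // geq_minr.
elim: N => [|N IH]; first by rewrite big_ord0 min0n add0r.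
rewrite big_mkcond big_ord_recr -big_mkcond /=.
case: leqP => le_Np.
  have -> : minn N.+1 p.+1 = N.+1 by apply/minn_idPl.
  move: IH; have -> : minn N p.+1 = N by apply/minn_idPl; lia.
  by rewrite exprS; lra.
have -> : minn N.+1 p.+1 = p.+1 by apply/minn_idPr; lia.
by move: IH; rewrite addr0; have -> : minn N p.+1 = p.+1 by apply/minn_idPr.
Qed.

(** The larger of 4^k and 4^l is 2^(k+l) 2^|k-l|, and this surplus over 2^(k+l) pays the entropy 1 +
    |k-l|. *)
Lemma leq_level_dist (R : realType) k l :
  2 ^+ (k + l) * (1 + level_dist k l)%:R <= 4 ^+ k + 4 ^+ l :> R.
Proof.
rewrite -!natrX -natrM -natrD ler_nat.
wlog le_lk : k l / (l <= k)%N.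
  move=> W; case: (leqP l k) => [|/ltnW]; first exact: W.
  by move/W; rewrite addnC [(4 ^ l + _)%N]addnC /level_dist [(l - k + _)%N]addnC.
apply: (@leq_trans (4 ^ k)); last exact: leq_addr.
have -> : level_dist k l = (k - l)%N by rewrite /level_dist (eqP (_ : l - k == 0)%N) ?addn0 // subn_eq0.
have -> : (4 ^ k = 2 ^ (k + l) * 2 ^ (k - l))%N by rewrite (_ : 4 = 2 ^ 2)%N // -expnM -expnD; congr (2 ^ _)%N; lia.
by rewrite leq_mul2l add1n ltn_expl ?orbT.
Qed.

Lemma sum_level_dist (R : realType) m K :
  \sum_(k < m) 2^-1 ^+ level_dist k K <= 3 :> R.
Proof.
have half (N : nat) : \sum_(k < N) 2^-1 ^+ k <= 2 :> R.
  suff -> : \sum_(k < N) 2^-1 ^+ k = 2 - 2 * 2^-1 ^+ N :> R.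
    by rewrite gerBl mulr_ge0 ?exprn_ge0 ?invr_ge0 ?ler0n.
  elim: N => [|N IH]; first by rewrite big_ord0 expr0 mulr1 subrr.
  by rewrite big_ord_recr IH /= exprS; field.
have half1 (N : nat) : \sum_(k < N) 2^-1 ^+ k.+1 <= 1 :> R.
  rewrite (eq_bigr (fun k : 'I_N => 2^-1 * 2^-1 ^+ k)) => [|k _]; last by rewrite exprS.
  by rewrite -mulr_sumr; have := half N; lra.
have x_ge0 k : 0 <= 2^-1 ^+ k :> R by rewrite exprn_ge0 ?invr_ge0 ?ler0n.
apply: (@le_trans _ _ (\sum_(k < K + m) 2^-1 ^+ level_dist k K)).
  rewrite addnC big_split_ord /= lerDl sumr_ge0 //.
rewrite big_split_ord /=.
have -> : (3 : R) = 1 + 2 by ring.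
apply: lerD; last first.
  apply: le_trans (half m); apply: ler_sum => k _ /=.
  by rewrite /level_dist (_ : (_ + _)%N = k) //; lia.
rewrite (reindex_inj rev_ord_inj) /=; apply: le_trans (half1 K).
apply: ler_sum => k _; rewrite /level_dist (_ : (_ + _)%N = k.+1) //.
by have := ltn_ord k; lia.
Qed.

Definition light_pair h n (q : nat) (K : 'I_h -> nat) (z : 'I_h * 'I_n -> option (bool * nat))
    (u v : 'I_h * 'I_n) : bool :=
  [&& z u != None, z v != None, zlev (z v) <= q + K u.1 & zlev (z u) <= q + K v.1]%N.

Definition level_sum h n (K : 'I_h -> nat) (z : 'I_h * 'I_n -> option (bool * nat))
    (u : 'I_h * 'I_n) : nat := (zlev (z u) + K u.1)%N.

Definition restrict_labels h n m (K : 'I_h -> nat) (j : nat)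
    (z : 'I_h * 'I_n -> option (bool * nat)) : {ffun 'I_h * 'I_n -> option (bool * 'I_m)} :=
  [ffun u => if z u is Some (b, k) then
     if (j <= k + K u.1)%N then omap (pair b) (insub k : option 'I_m) else None else None].

(** Restriction loses no light pair of class [j]: its levels are at most q + K < m, and both level
    sums are at least their minimum [j]. *)
Lemma light_coef_restrict (R : realType) h n (e : rel 'I_h) q m j b (K : {ffun 'I_h -> 'I_m})
    (z : 'I_h * 'I_n -> option (bool * nat)) u v :
  (forall i, q + K i < m)%N ->
  light_coef R e q j b K (restrict_labels m (fun i => K i) j z) u v =
  if light_pair q (fun i => K i) z u v &&
     (minn (level_sum (fun i => K i) z u) (level_sum (fun i => K i) z v) == j)
  then (-1) ^+ b * (zval R (z u) * zval R (z v) / (256 * 2 ^+ (q + j))) else 0.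
Proof.
move=> K_lt; rewrite /light_coef /restrict_labels !ffunE /light_pair /level_sum.
case: (z u) => [[b1 k]|] //=; case: (z v) => [[b2 l]|] //=; last by case: ifP => // _; case: insubP.
set c := (l <= _)%N && _.
have [cT|cF] := boolP c; last first.
  rewrite /= ; case: ifP => // _; case: insubP => //= k' _ kE.
  by case: ifP => // _; case: insubP => //= l' _ lE; rewrite kE lE -/c (negPf cF) andbF.
have /andP[le_l le_k] := cT.
rewrite /=; case: (boolP (j <= k + K u.1)%N) => [le_ju|]; last first.
  by rewrite -ltnNge => lt_j; case: eqP => // min_j; move: lt_j; rewrite -min_j; lia.
rewrite insubT /=; first by apply: leq_ltn_trans le_k (K_lt _).
move=> lt_k.
case: (boolP (j <= l + K v.1)%N) => [le_jv|]; last first.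
  by rewrite -ltnNge => lt_j; case: eqP => // min_j; move: lt_j; rewrite -min_j; lia.
rewrite insubT /=; first by apply: leq_ltn_trans le_l (K_lt _).
by move=> lt_l; rewrite -/c cT andbT.
Qed.

Lemma sum_base_regular (R : ringType) h (e : rel 'I_h) d i0 :
  symmetric e -> regular e d -> \sum_i (e i i0)%:R = d%:R :> R.
Proof.
move=> sym reg; rewrite -(reg i0) -sum1_card natr_sum [RHS]big_mkcond.
by apply: eq_bigr => i _; rewrite inE sym; case: (e _ _).
Qed.

Lemma sum_fibre_scale (R : realType) h n (z : 'I_h * 'I_n -> option (bool * nat)) K :
  fibre_scale R z K -> \sum_u zval R (z u) ^+ 2 <= 5 * (h%:R * n%:R) ->
  \sum_i n%:R * 4 ^+ K i <= 21 * (h%:R * n%:R) :> R.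
Proof.
move=> scale z_le.
apply: (@le_trans _ _ (\sum_i (n%:R + 4 * \sum_j zval R (z (i, j)) ^+ 2))).
  by apply: ler_sum => i _; have /andP[] := scale i.
rewrite big_split sumr_const card_ord -mulr_sumr -[n%:R *+ h]mulr_natl /=.
by rewrite sum_pairE in z_le; lra.
Qed.

(* Charging a light pair to the endpoint of larger level sum costs [z v ^+ 2] times the
   average over a fibre of [|z u|] in units of its root mean square, hence at most [z v ^+ 2]
   per adjacent fibre. *)
Lemma light_variance (R : realType) h n (e : rel 'I_h) d K
    (z : 'I_h * 'I_n -> option (bool * nat)) :
  symmetric e -> regular e d -> (0 < n)%N -> fibre_scale R z K ->
  \sum_u \sum_v zval R (z u) ^+ 2 * zval R (z v) ^+ 2 / 2 ^+ level_sum K z u * (e u.1 v.1)%:R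
  <= d%:R * n%:R * \sum_v zval R (z v) ^+ 2.
Proof.
move=> sym reg n_gt0 scale; rewrite exchange_big /= mulr_sumr; apply: ler_sum => v _.
pose f u := zval R (z u) ^+ 2 / 2 ^+ level_sum K z u.
rewrite (eq_bigr (fun u => zval R (z v) ^+ 2 * (f u * (e u.1 v.1)%:R))) => [|u _]; last first.
  by rewrite /f; ring.
rewrite -mulr_sumr mulrC ler_wpM2r ?sqr_ge0 //.
rewrite sum_pairE -(sum_base_regular R v.1 sym reg) mulr_suml; apply: ler_sum => i _ /=.
rewrite -mulr_suml mulrC ler_wpM2l ?ler0n //.
have P_gt0 : 0 < 4 ^+ K i :> R by rewrite exprn_gt0 ?ltr0n.
have f_le j : f (i, j) <= 2^-1 * (zval R (z (i, j)) ^+ 2 / 4 ^+ K i + 1).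
  rewrite /f sqr_zval /level_sum /=; case: (z (i, j) != None); rewrite ?mulr1 ?mulr0 ?mul0r; last first.
    by rewrite add0r mulr1 invr_ge0 ler0n.
  have -> : 4 ^+ zlev (z (i, j)) / 4 ^+ K i = (2 ^+ zlev (z (i, j)) / 2 ^+ K i) ^+ 2 :> R.
    have E k : 4 ^+ k = (2 ^+ k) ^+ 2 :> R by rewrite -exprM mulnC exprM (_ : 2 ^+ 2 = 4) //; ring.
    by rewrite !E expr_div_n.
  have -> : 4 ^+ zlev (z (i, j)) / 2 ^+ (zlev (z (i, j)) + K i) = 2 ^+ zlev (z (i, j)) / 2 ^+ K i :> R.
    have E k : 4 ^+ k = (2 ^+ k) ^+ 2 :> R by rewrite -exprM mulnC exprM (_ : 2 ^+ 2 = 4) //; ring.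
    by rewrite E exprD; field; rewrite !expf_neq0 ?pnatr_eq0.
  by set x := _ / _; have := sqr_ge0 (x - 1); nra.
apply: (@le_trans _ _ (\sum_j 2^-1 * (zval R (z (i, j)) ^+ 2 / 4 ^+ K i + 1))).
  by apply: ler_sum => j _; apply: f_le.
rewrite -mulr_sumr big_split /= sumr_const card_ord -mulr_suml.
have /andP[le_n _] := scale i.
have : (\sum_j zval R (z (i, j)) ^+ 2) / 4 ^+ K i <= n%:R by rewrite ler_pdivrMr.
by lra.
Qed.

Definition light_term (R : realType) h n (e : rel 'I_h) (q : nat) (K : 'I_h -> nat)
    (z : 'I_h * 'I_n -> option (bool * nat)) (s : lift_data h n) (u v : 'I_h * 'I_n) : R :=
  if light_pair q K z u v then
    zval R (z u) * zval R (z v) * ((lift_adj e s u v)%:R - (e u.1 v.1)%:R / n%:R) else 0.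

Lemma light_sum_deviation (R : realType) h n (e : rel 'I_h) q m (b : bool) (K : {ffun 'I_h -> 'I_m})
    (z : 'I_h * 'I_n -> option (bool * nat)) (s : lift_data h n) :
  (forall i, q + K i < m)%N ->
  (-1) ^+ b * \sum_u \sum_v light_term R e q (fun i => K i) z s u v =
  \sum_(j < 2 * m) 256 * 2 ^+ (q + j) *
    light_deviation R e q j b K (restrict_labels m (fun i => K i) j z) s.
Proof.
move=> K_lt.
rewrite mulr_sumr /light_deviation.
under [RHS]eq_bigr do rewrite mulr_sumr.
rewrite [RHS]exchange_big; apply: eq_bigr => u _ /=.
rewrite mulr_sumr; under [RHS]eq_bigr do rewrite mulr_sumr.
rewrite [RHS]exchange_big; apply: eq_bigr => v _ /=.
rewrite (eq_bigr (fun j : 'I_(2 * m) =>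
  if light_pair q (fun i => K i) z u v &&
     (minn (level_sum (fun i => K i) z u) (level_sum (fun i => K i) z v) == j)
  then (-1) ^+ b * light_term R e q (fun i => K i) z s u v else 0)); last first.
  move=> j _; rewrite light_coef_restrict // /light_term.
  case: ifP => [/andP[-> _]|_]; last by rewrite mul0r mulr0.
  have x0 : 2 ^+ (q + j) != 0 :> R by rewrite expf_neq0 ?pnatr_eq0.
  move: (2 ^+ (q + j)) (_ - _) x0 => x y x0.
  by field.
rewrite -big_mkcond /=.
have [lt|nlt] := boolP (light_pair q (fun i => K i) z u v); last first.
  by rewrite /light_term (negPf nlt) mulr0 big_pred0.
have /and4P[_ _ le_v le_u] := lt.
have min_lt : (minn (level_sum (fun i => K i) z u) (level_sum (fun i => K i) z v) < 2 * m)%N.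
  rewrite gtn_min; apply/orP; left; rewrite /level_sum mul2n -addnn.
  by rewrite -addnS leq_add // ltnW // (leq_ltn_trans le_u (K_lt _)).
by rewrite (big_pred1 (Ordinal min_lt)) // => j; rewrite /= eq_sym.
Qed.

(** After undoing the normalisation, class [j] has weight 2^-j with j = min(p u, p v), at most 2^-(p
    u) + 2^-(p v). Each half is bounded by [light_variance], and 40 = 2 * 4 * 5 from d <= 4 * 4^q
    and |z|^2 <= 5 h n. *)
Lemma light_variance_total (R : realType) h n (e : rel 'I_h) q d m (b : bool) (K : {ffun 'I_h -> 'I_m})
    (z : 'I_h * 'I_n -> option (bool * nat)) :
  symmetric e -> regular e d -> (0 < n)%N -> (d <= 4 ^ q.+1)%N ->
  (forall i, q + K i < m)%N ->
  fibre_scale R z (fun i => K i) ->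
  \sum_u zval R (z u) ^+ 2 <= 5 * (h%:R * n%:R) ->
  \sum_(j < 2 * m) 256 * 2 ^+ (q + j) * (256 / n%:R * \sum_u \sum_v
    light_coef R e q j b K (restrict_labels m (fun i => K i) j z) u v ^+ 2 * (e u.1 v.1)%:R)
  <= 40 * (2 ^+ q * (h%:R * n%:R)).
Proof.
move=> sym reg n_gt0 le_dq K_lt scale z_le.
have n0 : 0 < n%:R :> R by rewrite ltr0n.
have q0 : 0 < 2 ^+ q :> R by rewrite exprn_gt0 ?ltr0n.
pose w u v : R := zval R (z u) ^+ 2 * zval R (z v) ^+ 2 * (e u.1 v.1)%:R.
pose p := level_sum (fun i => K i) z.
have w_ge0 u v : 0 <= w u v by apply: mulr_ge0; [apply: mulr_ge0; apply: sqr_ge0|apply: ler0n].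
apply: (@le_trans _ _ ((2 ^+ q * n%:R)^-1 * \sum_u \sum_v (w u v / 2 ^+ p u + w u v / 2 ^+ p v))).
  rewrite (eq_bigr (fun j : 'I_(2 * m) => (2 ^+ q * n%:R)^-1 * \sum_u \sum_v
     (if light_pair q (fun i => K i) z u v && (minn (p u) (p v) == j) then w u v / 2 ^+ j else 0))); last first.
    move=> j _; rewrite !mulr_sumr; apply: eq_bigr => u _; rewrite !mulr_sumr; apply: eq_bigr => v _.
    rewrite light_coef_restrict //; case: ifP => _; last by rewrite expr0n !mul0r !mulr0.
    rewrite /w !exprMn sqrr_sign exprD exprVn exprMn.
    have a0 : 2 ^+ q != 0 :> R by rewrite lt0r_neq0.
    have c0 : 2 ^+ j != 0 :> R by rewrite expf_neq0 ?pnatr_eq0.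
    have n1 : n%:R != 0 :> R by rewrite lt0r_neq0.
    move: (2 ^+ q) (2 ^+ j) (n%:R) a0 c0 n1 => a c n1 a0 c0 n10.
    by field; rewrite a0 c0 n10.
  rewrite -mulr_sumr ler_wpM2l ?invr_ge0 ?mulr_ge0 ?ler0n ?(ltW q0) //.
  rewrite exchange_big; apply: ler_sum => u _ /=; rewrite exchange_big; apply: ler_sum => v _ /=.
  rewrite -big_mkcond /=; case: (light_pair _ _ _ _ _) => /=; last first.
    by rewrite big_pred0 // addr_ge0 // divr_ge0 ?exprn_ge0 ?ler0n.
  case: (ltnP (minn (p u) (p v)) (2 * m)) => [min_lt|min_ge]; last first.
    rewrite big_pred0 => [|j]; first by rewrite addr_ge0 // divr_ge0 ?exprn_ge0 ?ler0n.
    by apply/negbTE; rewrite neq_ltn (leq_trans (ltn_ord j) min_ge) orbT.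
  rewrite (big_pred1 (Ordinal min_lt)) => [|j]; last by rewrite /= eq_sym.
  rewrite /= /minn; case: ifP => _; rewrite ?lerDl ?lerDr divr_ge0 ?exprn_ge0 ?ler0n //.
have := light_variance sym reg n_gt0 scale.
set S := \sum_u \sum_v _ => S_le.
have -> : \sum_u \sum_v (w u v / 2 ^+ p u + w u v / 2 ^+ p v) = S + S.
  rewrite -[X in _ = X + _]/S {2}/S [X in _ = _ + X]exchange_big /S -big_split /=; apply: eq_bigr => u _.
  rewrite -big_split /=; apply: eq_bigr => v _; rewrite /w /p [e v.1 u.1]sym; ring.
rewrite mulrC ler_pdivrMr ?mulr_gt0 //.
have d_le : d%:R <= 4 * (2 ^+ q * 2 ^+ q) :> R.
  by rewrite -exprD addnn -mul2n exprM (_ : 2 ^+ 2 = 4) -?exprS -?natrX ?ler_nat //; ring.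
have Z_ge0 : 0 <= \sum_v zval R (z v) ^+ 2 by apply: sumr_ge0 => v _; apply: sqr_ge0.
have le1 : S <= 4 * (2 ^+ q * 2 ^+ q) * n%:R * (5 * (h%:R * n%:R)).
  apply: (le_trans S_le); apply: ler_pM => //; first by rewrite mulr_ge0 ?ler0n.
  by rewrite ler_wpM2r ?ler0n.
have -> : 40 * (2 ^+ q * (h%:R * n%:R)) * (2 ^+ q * n%:R) =
  4 * (2 ^+ q * 2 ^+ q) * n%:R * (5 * (h%:R * n%:R)) + 4 * (2 ^+ q * 2 ^+ q) * n%:R * (5 * (h%:R * n%:R)) :> R by ring.
exact: lerD.
Qed.

(** A vertex of level k and scale K occurs only in classes j <= k + K, whose factors 2^j sum to at
    most 2 * 2^(k+K). [leq_level_dist] then bounds its total cost by 4 (4^k + 4^K), and 104 = 4 (5 +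
    21). *)
Lemma light_label_total (R : realType) h n q m (K : {ffun 'I_h -> 'I_m})
    (z : 'I_h * 'I_n -> option (bool * nat)) :
  fibre_scale R z (fun i => K i) ->
  \sum_u zval R (z u) ^+ 2 <= 5 * (h%:R * n%:R) ->
  \sum_(j < 2 * m) 256 * 2 ^+ (q + j) *
    (label_cost K (restrict_labels m (fun i => K i) j z))%:R
  <= 256 * 104 * (2 ^+ q * (h%:R * n%:R)) :> R.
Proof.
move=> scale z_le.
have le1 : \sum_(j < 2 * m) 256 * 2 ^+ (q + j) *
    (label_cost K (restrict_labels m (fun i => K i) j z))%:R <=
    \sum_u 256 * 2 ^+ q * (4 * (zval R (z u) ^+ 2 + 4 ^+ K u.1)).
  apply: (@le_trans _ _ (\sum_(j < 2 * m) \sum_u 256 * 2 ^+ q *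
     (if z u is Some (_, k) then if (j <= k + K u.1)%N then
        2 ^+ j * (2 * (1 + level_dist k (K u.1)))%:R else 0 else 0))).
    apply: ler_sum => j _; rewrite /label_cost natr_sum mulr_sumr; apply: ler_sum => u _.
    rewrite exprD mulrA -mulrA ler_wpM2l ?mulr_ge0 ?exprn_ge0 ?ler0n //.
    rewrite ffunE; case: (z u) => [[b k]|] /=; last by rewrite mulr0.
    case: ifP => _; last by rewrite mulr0.
    case: insubP => [k' _ kE|_] /=; last by rewrite mulr0 mulr_ge0 ?exprn_ge0 ?ler0n.
    by rewrite kE.
  rewrite exchange_big; apply: ler_sum => u _ /=; rewrite -mulr_sumr.
  rewrite ler_wpM2l ?mulr_ge0 ?exprn_ge0 ?ler0n //.
  rewrite sqr_zval; case: (z u) => [[b k]|] /=; last first.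
    by rewrite big1 // mulr0 add0r mulr_ge0 ?exprn_ge0 ?ler0n.
  rewrite -big_mkcond -mulr_suml mulr1 natrM.
  apply: (@le_trans _ _ (2 * 2 ^+ (k + K u.1) * (2 * (1 + level_dist k (K u.1))%:R))).
    by rewrite ler_wpM2r ?mulr_ge0 ?ler0n // sum_pow2_le.
  have := leq_level_dist R k (K u.1).
  set x := 2 ^+ _; set y := (1 + _)%:R; move=> xy.
  have -> : 2 * x * (2 * y) = 4 * (x * y) by ring.
  by rewrite ler_wpM2l ?ler0n.
apply: (le_trans le1); rewrite -mulr_sumr -mulr_sumr big_split /=.
have sumK : \sum_(u : 'I_h * 'I_n) 4 ^+ K u.1 <= 21 * (h%:R * n%:R) :> R.
  apply: le_trans (sum_fibre_scale scale z_le); rewrite sum_pairE; apply: ler_sum => i _.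
  by rewrite /= sumr_const card_ord -[leLHS]mulr_natl.
have q0 : 0 <= 256 * 2 ^+ q :> R by rewrite mulr_ge0 ?exprn_ge0 ?ler0n.
apply: (@le_trans _ _ (256 * 2 ^+ q * (4 * (5 * (h%:R * n%:R) + 21 * (h%:R * n%:R))))).
  by rewrite ler_wpM2l // ler_wpM2l ?ler0n // lerD.
by rewrite le_eqVlt; apply/orP; left; apply/eqP; ring.
Qed.

(** After summing 2^j over j <= k + K, half of the decay 4^-|k-K| reduces 2^(k+K) to 4^K and the
    other half makes the sum over levels converge, to at most 3 with both signs; 63 = 3 * 21. *)
Lemma light_absence_total (R : realType) h n q m (K : {ffun 'I_h -> 'I_m})
    (z : 'I_h * 'I_n -> option (bool * nat)) :
  fibre_scale R z (fun i => K i) ->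
  \sum_u zval R (z u) ^+ 2 <= 5 * (h%:R * n%:R) ->
  \sum_(j < 2 * m) 256 * 2 ^+ (q + j) * (n%:R * absence_cost R j K)
  <= 256 * 63 * (2 ^+ q * (h%:R * n%:R)).
Proof.
move=> scale z_le; have sumK := sum_fibre_scale scale z_le.
have le1 : \sum_(j < 2 * m) 2 ^+ j * absence_cost R j K <= \sum_i 3 * 4 ^+ K i.
  apply: (@le_trans _ _ (\sum_(j < 2 * m) \sum_i \sum_(p : bool * 'I_m)
     if (j <= p.2 + K i)%N then 2 ^+ j * 4^-1 ^+ (1 + level_dist p.2 (K i)) else 0)).
    apply: ler_sum => j _; rewrite /absence_cost mulr_sumr; apply: ler_sum => i _.
    by rewrite mulr_sumr big_mkcond.
  rewrite exchange_big; apply: ler_sum => i _ /=; rewrite exchange_big /=.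
  apply: (@le_trans _ _ (\sum_(p : bool * 'I_m) 4 ^+ K i * (2^-1 * 2^-1 ^+ level_dist p.2 (K i)))).
    apply: ler_sum => p _; rewrite -big_mkcond -mulr_suml /=.
    apply: (@le_trans _ _ (2 * 2 ^+ (p.2 + K i) * 4^-1 ^+ (1 + level_dist p.2 (K i)))).
      by rewrite ler_wpM2r ?exprn_ge0 ?invr_ge0 ?ler0n // sum_pow2_le.
    have -> : 4^-1 = 2^-1 * 2^-1 :> R by rewrite -invfM; congr _^-1; ring.
    have le_pow : 2 ^+ (p.2 + K i) * 2^-1 ^+ level_dist p.2 (K i) <= 4 ^+ K i :> R.
      rewrite exprVn ler_pdivrMr ?exprn_gt0 ?ltr0n //.
      have -> : 4 = 2 ^+ 2 :> R by ring.
      by rewrite -exprM -exprD -!natrX ler_nat leq_exp2l // /level_dist; lia.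
    rewrite exprMn add1n exprS.
    set x := 2 ^+ _ in le_pow *; set y := 2^-1 ^+ _ in le_pow *; set c := 4 ^+ _ in le_pow *.
    have y_ge0 : 0 <= y by rewrite exprn_ge0 ?invr_ge0 ?ler0n.
    have -> : 2 * x * (2^-1 * y * (2^-1 * y)) = (x * y) * (2^-1 * y) by field.
    by rewrite ler_wpM2r ?mulr_ge0 ?invr_ge0 ?ler0n.
  rewrite -mulr_sumr [leRHS]mulrC ler_wpM2l ?exprn_ge0 ?ler0n // sum_pairE /= big_bool /= -mulr_sumr.
  by have := sum_level_dist R m (K i); lra.
rewrite (eq_bigr (fun j : 'I_(2 * m) => 256 * 2 ^+ q * n%:R * (2 ^+ j * absence_cost R j K))) => [|j _]; last first.
  by rewrite exprD; ring.
rewrite -mulr_sumr.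
apply: (@le_trans _ _ (256 * 2 ^+ q * n%:R * \sum_i 3 * 4 ^+ K i)).
  by rewrite ler_wpM2l // !mulr_ge0 ?exprn_ge0 ?ler0n.
have -> : 256 * 2 ^+ q * n%:R * \sum_i 3 * 4 ^+ K i = 768 * 2 ^+ q * \sum_i n%:R * 4 ^+ K i :> R.
  by rewrite -!mulr_sumr; ring.
apply: (@le_trans _ _ (768 * 2 ^+ q * (21 * (h%:R * n%:R)))).
  by rewrite ler_wpM2l // !mulr_ge0 ?exprn_ge0 ?ler0n.
by rewrite le_eqVlt; apply/orP; left; apply/eqP; ring.
Qed.

Lemma light_total (R : realType) h n (e : rel 'I_h) q d m (eta : R) (K : {ffun 'I_h -> 'I_m})
    (z : 'I_h * 'I_n -> option (bool * nat)) (s : lift_data h n) :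
  symmetric e -> regular e d -> (0 < h)%N -> (0 < n)%N -> (d <= 4 ^ q.+1)%N ->
  (forall i, q + K i < m)%N ->
  256 * 4 ^+ m * eta <= 1 -> 0 <= eta ->
  ~~ light_failure e q m eta s ->
  fibre_scale R z (fun i => K i) ->
  \sum_u zval R (z u) ^+ 2 <= 5 * (h%:R * n%:R) ->
  `|\sum_u \sum_v light_term R e q (fun i => K i) z s u v| <= 256 * 168 * (2 ^+ q * (h%:R * n%:R)).
Proof.
move=> sym reg h_gt0 n_gt0 le_dq K_lt eta_le eta_ge0 ok scale z_le.
set X := \sum_u _.
suff le_b (b : bool) : (-1) ^+ b * X <= 256 * 168 * (2 ^+ q * (h%:R * n%:R)).
  rewrite ler_norml; have := le_b true; have := le_b false.
  by rewrite expr0 mul1r expr1 mulN1r lerNl => -> ->.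
rewrite (light_sum_deviation R e b z s K_lt).
have dev_le (j : 'I_(2 * m)) :
    light_deviation R e q j b K (restrict_labels m (fun i => K i) j z) s <=
    light_bound e q j b eta K (restrict_labels m (fun i => K i) j z).
  rewrite leNgt; apply/negP => lt_dev; move/negP: ok; apply.
  apply/existsP; exists j; apply/existsP; exists b; apply/existsP; exists K.
  apply/existsP; exists (restrict_labels m (fun i => K i) j z); rewrite lt_dev andbT.
  apply/forallP => u; rewrite ffunE; case: (z u) => [[b' k]|] //.
  by case: ifP => // le_j; case: insubP => //= k' _ kE; rewrite kE.
apply: (@le_trans _ _ (\sum_(j < 2 * m) 256 * 2 ^+ (q + j) *
    light_bound e q j b eta K (restrict_labels m (fun i => K i) j z))).
  by apply: ler_sum => j _; rewrite ler_wpM2l ?mulr_ge0 ?exprn_ge0 ?ler0n.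
rewrite /light_bound.
rewrite (eq_bigr (fun j : 'I_(2 * m) =>
  256 * 2 ^+ (q + j) * (256 / n%:R * \sum_u \sum_v
    light_coef R e q j b K (restrict_labels m (fun i => K i) j z) u v ^+ 2 * (e u.1 v.1)%:R) +
  256 * 2 ^+ (q + j) * (label_cost K (restrict_labels m (fun i => K i) j z))%:R +
  256 * 2 ^+ (q + j) * (n%:R * absence_cost R j K) +
  256 * 2 ^+ (q + j) * (eta * n%:R))); last by move=> j _; rewrite !mulrDr.
rewrite !big_split /=.
have le1 := light_variance_total b sym reg n_gt0 le_dq K_lt scale z_le.
have le2 := light_label_total q scale z_le.
have le3 := light_absence_total q scale z_le.
have le4 : \sum_(j < 2 * m) 256 * 2 ^+ (q + j) * (eta * n%:R) <= 1 * (2 ^+ q * (h%:R * n%:R)).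
  rewrite (eq_bigr (fun j : 'I_(2 * m) => 2 ^+ q * n%:R * (256 * eta) * 2 ^+ j)) => [|j _]; last first.
    by rewrite exprD; ring.
  rewrite -mulr_sumr mul1r.
  have sum2 : \sum_(j < 2 * m) 2 ^+ j <= 4 ^+ m :> R.
    have -> : 4 ^+ m = 2 ^+ (2 * m) :> R by rewrite exprM (_ : 2 ^+ 2 = 4) //; ring.
    elim: (2 * m)%N => [|N IH]; first by rewrite big_ord0 expr0 ler01.
    by rewrite big_ord_recr /= exprS; lra.
  apply: (@le_trans _ _ (2 ^+ q * n%:R * (256 * eta) * 4 ^+ m)).
    by rewrite ler_wpM2l // !mulr_ge0 ?exprn_ge0 ?ler0n.
  have -> : 2 ^+ q * n%:R * (256 * eta) * 4 ^+ m = 2 ^+ q * (256 * 4 ^+ m * eta * n%:R) by ring.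
  rewrite ler_wpM2l ?exprn_ge0 ?ler0n // ler_wpM2r ?ler0n //.
  by apply: (le_trans eta_le); rewrite ler1n.
set T := 2 ^+ q * _ in le1 le2 le3 le4 *.
(* The margin is 256 * 168 - 256 * (104 + 63) - 41 = 215. *)
have -> : 256 * 168 * T = 40 * T + 256 * 104 * T + 256 * 63 * T + 1 * T + 215 * T by ring.
have T_ge0 : 0 <= 215 * T by rewrite !mulr_ge0 ?exprn_ge0 ?ler0n.
by apply: ler_wpDr T_ge0 _; rewrite !lerD.
Qed.

(** * Heavy pairs of a dyadic vector *)

(** Vertices violating a degree condition are deleted one at a time; each deletion loses at most
    [Da] or [Db] edges. *)
Lemma peel_bipartite (T : finType) (r : rel T) (Da Db : nat) (A B : {set T}) :
  symmetric r ->
  exists P : {set T} * {set T}, [/\ P.1 \subset A, P.2 \subset B,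
    forall u, u \in P.1 -> (Da < \sum_(v in P.2) r u v)%N,
    forall v, v \in P.2 -> (Db < \sum_(u in P.1) r v u)%N &
    (\sum_(u in A) \sum_(v in B) r u v <=
       Da * #|A| + Db * #|B| + \sum_(u in P.1) \sum_(v in P.2) r u v)%N].
Proof.
move=> sym; elim: {A B}(#|A| + #|B|)%N {-2}A {-2}B (leqnn (#|A| + #|B|)) => [|N IH] A B le_N.
  exists (A, B); have [A0 B0] : A = set0 /\ B = set0.
    by split; apply/eqP; rewrite -cards_eq0; lia.
  by split; rewrite //= ?leq_addl // A0 ?B0 => u; rewrite inE.
have [/forallP okA|/forallPn[u]] := boolP [forall u, (u \in A) ==> (Da < \sum_(v in B) r u v)%N]; last first.
  rewrite negb_imply -leqNgt => /andP[uA deg_u].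
  have cardA := cardsD1 u A; rewrite uA add1n in cardA.
  have [|P [PA PB degA degB le_P]] := IH (A :\ u) B; first by lia.
  exists P; split=> //; first exact: subset_trans PA (subD1set _ _).
  by rewrite (big_setD1 u) //= cardA; lia.
have [/forallP okB|/forallPn[v]] := boolP [forall v, (v \in B) ==> (Db < \sum_(u in A) r v u)%N]; last first.
  rewrite negb_imply -leqNgt => /andP[vB deg_v].
  have cardB := cardsD1 v B; rewrite vB add1n in cardB.
  have [|P [PA PB degA degB le_P]] := IH A (B :\ v); first by lia.
  exists P; split=> //; first exact: subset_trans PB (subD1set _ _).
  rewrite exchange_big (big_setD1 v) //= exchange_big /= cardB.
  have -> : (\sum_(i in A) r i v = \sum_(i in A) r v i)%N by apply: eq_bigr => i _; rewrite sym.
  by lia.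
exists (A, B); split; rewrite //= ?leq_addl // => u uA.
  by have := okA u; rewrite uA.
by have := okB u; rewrite uA.
Qed.

(** Deleting a vertex u with at most [D] neighbours loses at most D g(u) in its row and, by
    symmetry, as much in its column. *)
Lemma peel_weighted (R : realType) (T : finType) (r : rel T) (D : nat) (f : T -> T -> R)
    (g : T -> R) (U : {set T}) :
  symmetric r -> (forall u v, f u v = f v u) -> (forall u v, 0 <= f u v <= g u) ->
  exists2 W : {set T}, W \subset U &
    (forall u, u \in W -> (D < \sum_(v in W) r u v)%N) /\
    \sum_(u in U) \sum_(v in U) f u v * (r u v)%:R <=
      2 * D%:R * \sum_(u in U) g u + \sum_(u in W) \sum_(v in W) f u v * (r u v)%:R.
Proof.
move=> sym fsym fg.
have g_ge0 u : 0 <= g u by have /andP[] := fg u u; apply: le_trans.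
have F_ge0 u v : 0 <= f u v * (r u v)%:R by rewrite mulr_ge0 ?ler0n //; have /andP[] := fg u v.
elim: {U}#|U| {-2}U (leqnn #|U|) => [|N IH] U le_N.
  have -> : U = set0 by apply/eqP; rewrite -cards_eq0; lia.
  exists set0; rewrite ?sub0set //; split=> [u|]; first by rewrite inE.
  by rewrite !big_set0 mulr0 addr0.
have [/forallP ok|/forallPn[u]] := boolP [forall u, (u \in U) ==> (D < \sum_(v in U) r u v)%N].
  exists U => //; split=> [u uU|]; first by have := ok u; rewrite uU.
  by rewrite lerDr mulr_ge0 ?mulr_ge0 ?ler0n // sumr_ge0.
rewrite negb_imply -leqNgt => /andP[uU deg_u].
have cardU := cardsD1 u U; rewrite uU add1n in cardU.
have [|W WU [degW le_W]] := IH (U :\ u); first by lia.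
exists W; first exact: subset_trans WU (subD1set _ _).
split=> //.
have row : \sum_(v in U) f u v * (r u v)%:R <= D%:R * g u.
  apply: (@le_trans _ _ (\sum_(v in U) g u * (r u v)%:R)).
    by apply: ler_sum => v _; rewrite ler_wpM2r ?ler0n //; have /andP[] := fg u v.
  by rewrite -mulr_sumr mulrC ler_wpM2r // -natr_sum ler_nat.
have col : \sum_(v in U :\ u) f v u * (r v u)%:R <= D%:R * g u.
  apply: le_trans row; rewrite [leRHS](big_setD1 u) //= (eq_bigr (fun v => f u v * (r u v)%:R)).
    by rewrite lerDr.
  by move=> v _; rewrite fsym sym.
rewrite (big_setD1 u) //= [X in _ <= 2 * _ * X + _](big_setD1 u) //=.
have -> : \sum_(i in U :\ u) \sum_(v in U) f i v * (r i v)%:R =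
  \sum_(i in U :\ u) f i u * (r i u)%:R + \sum_(i in U :\ u) \sum_(v in U :\ u) f i v * (r i v)%:R.
  by rewrite -big_split /=; apply: eq_bigr => i _; rewrite (big_setD1 u).
by rewrite mulrDr; lra.
Qed.

Lemma lift_degree (R : ringType) h n (e : rel 'I_h) d (s : lift_data h n) v :
  symmetric e -> irreflexive e -> regular e d ->
  \sum_u (lift_adj e s u v)%:R = d%:R :> R.
Proof.
move=> sym irr reg; rewrite sum_pairE -(sum_base_regular R v.1 sym reg); apply: eq_bigr => i _.
rewrite /lift_adj /=; case eiv : (e i v.1) => /=; last by rewrite big1.
case: ltnP => _.
  rewrite (bigD1 ((s (i, v.1))^-1%g v.2)) //= permKV eqxx big1 ?addr0 // => j ne.
  by rewrite (_ : (_ == _) = false) //; apply: contraNF ne => /eqP <-; rewrite permK.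
by rewrite (bigD1 (s (v.1, i) v.2)) //= eqxx big1 ?addr0 // => j ne; rewrite eq_sym (negPf ne).
Qed.

Lemma lift_degree_card h n (e : rel 'I_h) d (s : lift_data h n) (A : {set 'I_h * 'I_n}) v :
  symmetric e -> irreflexive e -> regular e d ->
  (\sum_(u in A) lift_adj e s u v <= d)%N.
Proof.
move=> sym irr reg; rewrite -(ler_nat Rdefinitions.R) -(lift_degree _ s v sym irr reg) natr_sum.
rewrite [leRHS](bigID (fun u => u \in A)) /= lerDl; apply: sumr_ge0 => u _; exact: ler0n.
Qed.

(** A level gap of q gives |z u z v| <= (z v)^2 / 2^q, and each v has only d <= 4 * 4^q
    neighbours. *)
Lemma far_sum (R : realType) h n (e : rel 'I_h) d q
    (z : 'I_h * 'I_n -> option (bool * nat)) (s : lift_data h n) :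
  symmetric e -> irreflexive e -> regular e d -> (d <= 4 ^ q.+1)%N ->
  \sum_u \sum_v (if (zlev (z u) + q <= zlev (z v))%N then
     `|zval R (z u)| * `|zval R (z v)| * (lift_adj e s u v)%:R else 0)
  <= 4 * 2 ^+ q * \sum_v zval R (z v) ^+ 2.
Proof.
move=> sym irr reg le_dq; rewrite exchange_big mulr_sumr; apply: ler_sum => v _ /=.
have q0 : 0 < 2 ^+ q :> R by rewrite exprn_gt0 ?ltr0n.
apply: (@le_trans _ _ (\sum_u zval R (z v) ^+ 2 / 2 ^+ q * (lift_adj e s u v)%:R)).
  apply: ler_sum => u _; case: ifP => [le_uv|_]; last exact: mulr_ge0 (divr_ge0 (sqr_ge0 _) (ltW q0)) (ler0n _ _).
  rewrite ler_wpM2r ?ler0n // ler_pdivlMr // !normr_zval sqr_zval.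
  case: (z u != None); rewrite ?mulr0 ?mul0r ?mulr_ge0 ?exprn_ge0 ?ler0n //.
  case: (z v != None); rewrite ?mulr0 ?mul0r // !mulr1 mulrAC -exprD.
  have -> : 4 = 2 ^+ 2 :> R by ring.
  rewrite -exprM -exprD -!natrX ler_nat leq_exp2l //; lia.
rewrite -mulr_sumr (lift_degree _ s v sym irr reg).
have d_le : d%:R <= 4 * (2 ^+ q * 2 ^+ q) :> R.
  by rewrite -exprD addnn -mul2n exprM (_ : 2 ^+ 2 = 4) -?exprS -?natrX ?ler_nat //; ring.
rewrite mulrAC ler_pdivrMr //.
have -> : 4 * 2 ^+ q * zval R (z v) ^+ 2 * 2 ^+ q = zval R (z v) ^+ 2 * (4 * (2 ^+ q * 2 ^+ q)) by ring.
by rewrite ler_wpM2l ?sqr_ge0.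
Qed.

(** Deliberately asymmetric: a pair of labelled vertices that is not light is heavy in at least one
    of its two orders. *)
Definition heavy_pair h n (q : nat) (K : 'I_h -> nat) (z : 'I_h * 'I_n -> option (bool * nat))
    (u v : 'I_h * 'I_n) : bool :=
  [&& z u != None, z v != None & q + K u.1 < zlev (z v)]%N.

(** By the arithmetic-geometric mean inequality the |z u| on fibre i average at most 2^(K i), and
    heaviness gives 2^(K i) |z v| <= (z v)^2 / 2^q. Each v sees d adjacent fibres. *)
Lemma heavy_mean (R : realType) h n (e : rel 'I_h) d q K
    (z : 'I_h * 'I_n -> option (bool * nat)) :
  symmetric e -> regular e d -> (0 < n)%N -> (d <= 4 ^ q.+1)%N -> fibre_scale R z K ->
  \sum_u \sum_v (if heavy_pair q K z u v then
     `|zval R (z u)| * `|zval R (z v)| * ((e u.1 v.1)%:R / n%:R) else 0)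
  <= 4 * 2 ^+ q * \sum_v zval R (z v) ^+ 2.
Proof.
move=> sym reg n_gt0 le_dq scale; rewrite exchange_big mulr_sumr; apply: ler_sum => v _ /=.
have n0 : 0 < n%:R :> R by rewrite ltr0n.
have q0 : 0 < 2 ^+ q :> R by rewrite exprn_gt0 ?ltr0n.
have d_le : d%:R <= 4 * (2 ^+ q * 2 ^+ q) :> R.
  by rewrite -exprD addnn -mul2n exprM (_ : 2 ^+ 2 = 4) -?exprS -?natrX ?ler_nat //; ring.
rewrite sum_pairE.
apply: (@le_trans _ _ (\sum_i zval R (z v) ^+ 2 / 2 ^+ q * (e i v.1)%:R)); last first.
  rewrite -mulr_sumr (sum_base_regular R v.1 sym reg).
  rewrite mulrAC ler_pdivrMr //.
  have -> : 4 * 2 ^+ q * zval R (z v) ^+ 2 * 2 ^+ q = zval R (z v) ^+ 2 * (4 * (2 ^+ q * 2 ^+ q)) by ring.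
  by rewrite ler_wpM2l ?sqr_ge0.
apply: ler_sum => i _; rewrite /heavy_pair /=.
have [lt_l|le_l] := ltnP (q + K i) (zlev (z v)); last first.
  rewrite big1 => [|j _]; last by rewrite !andbF.
  exact: mulr_ge0 (divr_ge0 (sqr_ge0 _) (ltW q0)) (ler0n _ _).
have [zv|nzv] := boolP (z v == None).
  rewrite big1 => [|j _]; last by rewrite !andbF.
  exact: mulr_ge0 (divr_ge0 (sqr_ge0 _) (ltW q0)) (ler0n _ _).
apply: (@le_trans _ _ (\sum_j 2^-1 * (zval R (z (i, j)) ^+ 2 / 2 ^+ K i + 2 ^+ K i) *
    (`|zval R (z v)| * ((e i v.1)%:R / n%:R)))).
  apply: ler_sum => j _; rewrite andbT.
  have K0 : 0 < 2 ^+ K i :> R by rewrite exprn_gt0 ?ltr0n.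
  have rhs_ge0 : 0 <= 2^-1 * (zval R (z (i, j)) ^+ 2 / 2 ^+ K i + 2 ^+ K i) :> R.
    by rewrite mulr_ge0 ?invr_ge0 ?ler0n // addr_ge0 ?(ltW K0) // divr_ge0 ?sqr_ge0 ?(ltW K0).
  case: ifP => _; last by rewrite mulr_ge0 // mulr_ge0 ?mulr_ge0 ?ler0n ?invr_ge0.
  rewrite -mulrA ler_wpM2r ?mulr_ge0 ?ler0n ?invr_ge0 //.
  rewrite -(@real_normK _ (zval R (z (i, j)))) ?num_real //.
  set a := `|_|; set c := 2 ^+ K i in K0 *.
  rewrite ler_pdivlMl ?ltr0n // -subr_ge0.
  have -> : a ^+ 2 / c + c - 2 * a = (a - c) ^+ 2 / c by field; rewrite lt0r_neq0.
  by rewrite mulr_ge0 ?sqr_ge0 ?invr_ge0 ?(ltW K0).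
rewrite -mulr_suml -mulr_sumr big_split /= sumr_const card_ord -mulr_suml.
have /andP[le_n _] := scale i.
have K0 : 0 < 2 ^+ K i :> R by rewrite exprn_gt0 ?ltr0n.
have E4 : 4 ^+ K i = 2 ^+ K i * 2 ^+ K i :> R.
  by rewrite -exprD addnn -mul2n exprM (_ : 2 ^+ 2 = 4) //; ring.
apply: (@le_trans _ _ (n%:R * 2 ^+ K i * (`|zval R (z v)| * ((e i v.1)%:R / n%:R)))).
  rewrite ler_wpM2r ?mulr_ge0 ?ler0n ?invr_ge0 //.
  have : (\sum_j zval R (z (i, j)) ^+ 2) / 2 ^+ K i <= n%:R * 2 ^+ K i.
    by rewrite ler_pdivrMr // -mulrA -E4.
  by rewrite -[_ *+ n]mulr_natl; lra.
have -> : n%:R * 2 ^+ K i * (`|zval R (z v)| * ((e i v.1)%:R / n%:R)) =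
    2 ^+ K i * `|zval R (z v)| * (e i v.1)%:R by field; rewrite lt0r_neq0.
rewrite ler_wpM2r ?ler0n // ler_pdivlMr // normr_zval sqr_zval nzv !mulr1 mulrAC -!exprD.
have -> : 4 = 2 ^+ 2 :> R by ring.
rewrite -exprM -!natrX ler_nat leq_exp2l //; lia.
Qed.

Definition near_levels (q k l : nat) : bool := (k < l + q)%N && (l < k + q)%N.

(** Two geometric series, in 2 and in 4/5, with sums at most 2 * 4^q and 5; hence 7 = 2 + 5. *)
Lemma sum_core_cap (R : realType) q :
  \sum_(y < (2 * q).+1) 2 ^+ y * (core_cap q y)%:R <= 256 * 7 * 4 ^+ q :> R.
Proof.
have sum2 N : \sum_(y < N) 2 ^+ y <= 2 ^+ N :> R.
  elim: N => [|N IH]; first by rewrite big_ord0 expr0 ler01.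
  by rewrite big_ord_recr /= exprS; lra.
have sum45 N : \sum_(y < N) (4 / 5) ^+ y <= 5 :> R.
  suff -> : \sum_(y < N) (4 / 5) ^+ y = 5 - 5 * (4 / 5) ^+ N :> R.
    by rewrite gerBl mulr_ge0 ?exprn_ge0 ?ler0n // divr_ge0 ?ler0n.
  elim: N => [|N IH]; first by rewrite big_ord0 expr0 mulr1 subrr.
  by rewrite big_ord_recr IH /= exprS; field.
apply: (@le_trans _ _ (\sum_(y < (2 * q).+1) 256 * (2 ^+ y + 4 ^+ q * (4 / 5) ^+ y))).
  apply: ler_sum => y _; rewrite /core_cap natrM natrD mulrCA ler_wpM2l ?ler0n // mulrDr mulr1 lerD2l.
  have -> : 4 / 5 = 2 * (2 / 5) :> R by field.
  rewrite exprMn mulrCA ler_wpM2l ?exprn_ge0 ?ler0n // expr_div_n mulrA ler_pdivlMr ?exprn_gt0 ?ltr0n //.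
  by rewrite -!natrX -!natrM ler_nat leq_trunc_div.
rewrite -mulr_sumr big_split /= -mulr_sumr -mulrA ler_wpM2l ?ler0n //.
have le1 := sum2 (2 * q).+1; have le2 := sum45 (2 * q).+1.
have E : 2 ^+ (2 * q).+1 = 2 * 4 ^+ q :> R by rewrite exprS exprM (_ : 2 ^+ 2 = 4) //; ring.
have le3 : 4 ^+ q * \sum_(y < (2 * q).+1) (4 / 5) ^+ y <= 4 ^+ q * 5 :> R.
  by rewrite ler_wpM2l ?exprn_ge0 ?ler0n.
by rewrite E in le1; lra.
Qed.

Lemma sum_near_core_cap (R : realType) m q l :
  \sum_(k < m | near_levels q k l) 2 ^+ k * (core_cap q (q + k - l))%:R
  <= 256 * 7 * (2 ^+ l * 2 ^+ q) :> R.
Proof.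
have q0 : 0 < 2 ^+ q :> R by rewrite exprn_gt0 ?ltr0n.
rewrite -(ler_pM2l q0) mulr_sumr.
pose A := [set k : 'I_m | near_levels q k l].
pose f (k : 'I_m) : 'I_(2 * q).+1 := inord (q + k - l).
have fE k : k \in A -> f k = (q + k - l)%N :> nat.
  by rewrite inE => /andP[lt1 lt2]; rewrite /f inordK //; lia.
pose F (y : 'I_(2 * q).+1) : R := 2 ^+ y * (core_cap q y)%:R.
apply: (@le_trans _ _ (2 ^+ l * \sum_(k in A) F (f k))).
  rewrite mulr_sumr [leRHS](eq_bigl (fun k : 'I_m => near_levels q k l)) => [|k]; last by rewrite inE.
  apply: ler_sum => k near; have kA : k \in A by rewrite inE.
  rewrite /F fE // !mulrA -!exprD; have /andP[lt1 lt2] := near.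
  by rewrite (_ : (l + (q + k - l) = q + k)%N) //; lia.
rewrite -(big_imset F) /=; last first.
  move=> k k' kA k'A /(congr1 val) /=; rewrite !fE //.
  move: kA k'A; rewrite !inE => /andP[? ?] /andP[? ?] eq_y; apply: val_inj => /=; lia.
apply: (@le_trans _ _ (2 ^+ l * \sum_y F y)).
  rewrite ler_wpM2l ?exprn_ge0 ?ler0n // [leRHS](bigID (fun y => y \in f @: A)) /= lerDl.
  by apply: sumr_ge0 => y _; rewrite mulr_ge0 ?exprn_ge0 ?ler0n.
apply: (@le_trans _ _ (2 ^+ l * (256 * 7 * 4 ^+ q))).
  by rewrite ler_wpM2l ?exprn_ge0 ?ler0n // sum_core_cap.
have -> : 4 ^+ q = 2 ^+ q * 2 ^+ q :> R by rewrite -exprMn -natrM.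
by rewrite le_eqVlt; apply/orP; left; apply/eqP; ring.
Qed.

Definition heavy_left h n (q : nat) (K : 'I_h -> nat) (z : 'I_h * 'I_n -> option (bool * nat))
    (k l : nat) : {set 'I_h * 'I_n} :=
  [set u | [&& z u != None, zlev (z u) == k & q + K u.1 < l]%N].

Definition level_set h n (z : 'I_h * 'I_n -> option (bool * nat)) (l : nat) :
    {set 'I_h * 'I_n} := [set v | (z v != None) && (zlev (z v) == l)].

(** The mass bound on the fibre gives |A_i| 4^k <= n 4^(K i), and q + K i < l turns this into the
    density 4^-y with y = q + k - l that [is_core] asks for. *)
Lemma heavy_left_density (R : realType) h n q K (z : 'I_h * 'I_n -> option (bool * nat)) k l
    (A : {set 'I_h * 'I_n}) i :
  fibre_scale R z K -> (l < k + q)%N -> A \subset heavy_left q K z k l ->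
  (#|fibre_part A i| * 4 ^ (q + k - l) <= n)%N.
Proof.
move=> scale lt_lk /subsetP AS.
have [->|[u]] := set_0Vmem (fibre_part A i); first by rewrite cards0 mul0n.
rewrite inE => /andP[uA /eqP ui]; have := AS u uA; rewrite inE => /and3P[_ _]; rewrite ui => lt_l.
have le1 : (#|fibre_part A i| * 4 ^ k <= n * 4 ^ K i)%N.
  rewrite -(ler_nat R) !natrM !natrX; have /andP[le_n _] := scale i.
  apply: le_trans le_n.
  have -> : #|fibre_part A i|%:R * 4 ^+ k = \sum_(v in fibre_part A i) 4 ^+ k :> R.
    by rewrite sumr_const -[RHS]mulr_natl.
  rewrite big_mkcond sum_pairE /= (bigD1 i) //= [X in _ + X]big1 ?addr0; last first.
    by move=> i' ne; rewrite big1 // => j _; rewrite inE /= (negPf ne) andbF.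
  apply: ler_sum => j _; case: ifP => [|_]; last exact: sqr_ge0.
  rewrite inE => /andP[/AS]; rewrite inE => /and3P[nz /eqP lev _] _.
  by rewrite sqr_zval nz lev mulr1.
have l0 : (0 < 4 ^ l)%N by rewrite expn_gt0.
rewrite -(leq_pmul2r l0) -mulnA -expnD (_ : (q + k - l + l = k + q)%N); last by lia.
rewrite expnD mulnA; apply: (leq_trans (_ : _ <= n * 4 ^ K i * 4 ^ q)%N).
  by rewrite leq_mul2r le1 orbT.
rewrite -mulnA -expnD leq_mul2l leq_exp2l //; apply/orP; right; lia.
Qed.

(** Weight of all edges lost in peeling. On the left, the sum over l <= k + q of 64 * 2^(k+l) is at
    most 128 * 2^q * 4^k; on the right, [sum_near_core_cap] gives 256 * 7. *)
Lemma heavy_peeled_total (R : realType) h n q m K (z : 'I_h * 'I_n -> option (bool * nat)) :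
  \sum_(p : 'I_m * 'I_m | near_levels q p.1 p.2) 2 ^+ (p.1 + p.2) *
    (64 * #|heavy_left q K z p.1 p.2| + core_cap q (q + p.1 - p.2) * #|level_set z p.2|)%:R
  <= (128 + 256 * 7) * 2 ^+ q * \sum_u zval R (z u) ^+ 2.
Proof.
rewrite (eq_bigr (fun p : 'I_m * 'I_m => 2 ^+ (p.1 + p.2) * (64 * #|heavy_left q K z p.1 p.2|)%:R +
   2 ^+ (p.1 + p.2) * (core_cap q (q + p.1 - p.2) * #|level_set z p.2|)%:R)); last first.
  by move=> p _; rewrite natrD mulrDr.
rewrite big_split /= 2!mulrDl; apply: lerD.
  apply: (@le_trans _ _ (\sum_u \sum_(p : 'I_m * 'I_m | near_levels q p.1 p.2)
     (if (z u != None) && (zlev (z u) == p.1) then 64 * 2 ^+ (p.1 + p.2) else 0))).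
    rewrite exchange_big; apply: ler_sum => p _ /=.
    rewrite natrM mulrCA mulrA -sum1_card natr_sum mulr_sumr big_mkcond; apply: ler_sum => u _.
    rewrite inE; case: (z u != None) => //=; case: (zlev _ == _) => //=.
    by case: ifP => _; rewrite ?mulr1 ?mulr_ge0 ?exprn_ge0 ?ler0n.
  rewrite mulr_sumr; apply: ler_sum => u _; rewrite sqr_zval.
  case: (z u != None) => /=; last by rewrite big1 // !mulr0.
  rewrite mulr1 big_mkcond sum_pairE /=.
  have [k_lt|k_ge] := ltnP (zlev (z u)) m; last first.
    rewrite big1 ?mulr_ge0 ?exprn_ge0 ?ler0n // => k _; rewrite big1 // => l _.
    by rewrite (_ : (_ == _) = false) ?if_same //; apply/eqP; have := ltn_ord k; lia.
  rewrite (bigD1 (Ordinal k_lt)) //= [X in _ + X]big1 ?addr0; last first.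
    move=> k ne; rewrite big1 // => l _; rewrite (_ : (_ == _) = false) ?if_same //.
    by apply/eqP => E; move/eqP: ne; apply; apply: val_inj.
  rewrite eqxx; apply: (@le_trans _ _ (64 * 2 ^+ zlev (z u) * \sum_(l < m | (l <= zlev (z u) + q)%N) 2 ^+ l)).
    rewrite mulr_sumr [leRHS]big_mkcond; apply: ler_sum => l _; rewrite /near_levels.
    case: (ltnP l) => [lt_l|_]; last first.
      by rewrite andbF; case: ifP => _; rewrite ?mulr_ge0 ?exprn_ge0 ?ler0n.
    by rewrite (ltnW lt_l) andbT exprD mulrA; case: ifP => _; rewrite ?mulr_ge0 ?exprn_ge0 ?ler0n.
  apply: (@le_trans _ _ (64 * 2 ^+ zlev (z u) * (2 * 2 ^+ (zlev (z u) + q)))).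
    by rewrite ler_wpM2l ?mulr_ge0 ?exprn_ge0 ?ler0n // sum_pow2_le.
  have -> : 4 ^+ zlev (z u) = 2 ^+ zlev (z u) * 2 ^+ zlev (z u) :> R by rewrite -exprMn -natrM.
  by rewrite exprD le_eqVlt; apply/orP; left; apply/eqP; ring.
apply: (@le_trans _ _ (\sum_v \sum_(p : 'I_m * 'I_m | near_levels q p.1 p.2)
     (if (z v != None) && (zlev (z v) == p.2) then
        2 ^+ (p.1 + p.2) * (core_cap q (q + p.1 - p.2))%:R else 0))).
  rewrite exchange_big; apply: ler_sum => p _ /=.
  rewrite natrM mulrA -sum1_card natr_sum mulr_sumr big_mkcond; apply: ler_sum => v _.
  by rewrite inE; case: ifP => _; rewrite ?mulr1.
rewrite mulr_sumr; apply: ler_sum => v _; rewrite sqr_zval.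
case: (z v != None) => /=; last by rewrite big1 // !mulr0.
rewrite mulr1 big_mkcond sum_pairE exchange_big /=.
have [l_lt|l_ge] := ltnP (zlev (z v)) m; last first.
  rewrite big1 ?mulr_ge0 ?exprn_ge0 ?ler0n // => l _; rewrite big1 // => k _.
  by rewrite (_ : (_ == _) = false) ?if_same //; apply/eqP; have := ltn_ord l; lia.
rewrite (bigD1 (Ordinal l_lt)) //= [X in _ + X]big1 ?addr0; last first.
  move=> l ne; rewrite big1 // => k _; rewrite (_ : (_ == _) = false) ?if_same //.
  by apply/eqP => E; move/eqP: ne; apply; apply: val_inj.
rewrite eqxx -big_mkcond /=.
rewrite (eq_bigr (fun k : 'I_m => 2 ^+ zlev (z v) * (2 ^+ k * (core_cap q (q + k - zlev (z v)))%:R))); last first.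
  by move=> k _; rewrite exprD; ring.
rewrite -mulr_sumr.
apply: (@le_trans _ _ (2 ^+ zlev (z v) * (256 * 7 * (2 ^+ zlev (z v) * 2 ^+ q)))).
  by rewrite ler_wpM2l ?exprn_ge0 ?ler0n // sum_near_core_cap.
have -> : 4 ^+ zlev (z v) = 2 ^+ zlev (z v) * 2 ^+ zlev (z v) :> R by rewrite -exprMn -natrM.
by rewrite le_eqVlt; apply/orP; left; apply/eqP; ring.
Qed.

Lemma near_levels_large q m k l :
  near_levels q k l -> (m <= k)%N || (m <= l)%N -> ((m - q <= k) && (m - q <= l))%N.
Proof. by rewrite /near_levels; lia. Qed.

(** What peeling leaves is a core, so absence of large cores bounds [P.1] by n/E. Every vertex of
    [P.2] has a neighbour in [P.1], whose vertices have degree d, so |P.2| <= d |P.1|. *)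
Lemma heavy_core (R : realType) h n (e : rel 'I_h) d q m E K (z : 'I_h * 'I_n -> option (bool * nat))
    (s : lift_data h n) :
  symmetric e -> irreflexive e -> regular e d ->
  ~~ has_large_core e q E s -> fibre_scale R z K ->
  forall p : 'I_m * 'I_m, exists P : {set 'I_h * 'I_n} * {set 'I_h * 'I_n},
    [/\ P.1 \subset heavy_left q K z p.1 p.2, P.2 \subset level_set z p.2,
      (near_levels q p.1 p.2 -> E * (#|P.1| + #|P.2|) <= (1 + d) * n)%N &
      (\sum_(u in heavy_left q K z p.1 p.2) \sum_(v in level_set z p.2) lift_adj e s u v <=
       64 * #|heavy_left q K z p.1 p.2| + core_cap q (q + p.1 - p.2) * #|level_set z p.2| +
       \sum_(u in P.1) \sum_(v in P.2) lift_adj e s u v)%N].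
Proof.
move=> sym irr reg ok scale p.
have rsym := lift_adj_sym s sym irr.
have [P [P1 P2 deg1 deg2 le_P]] := peel_bipartite 64 (core_cap q (q + p.1 - p.2))
  (heavy_left q K z p.1 p.2) (level_set z p.2) rsym.
exists P; split=> // near; have /andP[lt1 lt2] := near.
have lt_y : (q + p.1 - p.2 < (2 * q).+1)%N by lia.
have size1 : (E * #|P.1| <= n)%N.
  rewrite leqNgt; apply: contra ok => lt_n.
  apply/existsP; exists (Ordinal lt_y); apply/existsP; exists P.1; rewrite lt_n.
  apply/existsP; exists P.2; apply/and3P; split.
  - by apply/forallP => i; exact: (heavy_left_density i scale lt2 P1).
  - by apply/forall_inP => u /deg1.
  - by apply/forall_inP => v /deg2.
have size2 : (#|P.2| <= d * #|P.1|)%N.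
  apply: (@leq_trans (\sum_(v in P.2) \sum_(u in P.1) lift_adj e s v u)).
    rewrite -sum1_card; apply: leq_sum => v /deg2; exact: leq_ltn_trans.
  rewrite exchange_big mulnC -sum_nat_const; apply: leq_sum => u _.
  exact: (lift_degree_card s P.2 u sym irr reg).
apply: (@leq_trans (E * ((1 + d) * #|P.1|))); first by rewrite leq_mul2l mulnDl mul1n leq_add2l size2 orbT.
by rewrite mulnCA leq_mul2l size1 orbT.
Qed.

(** The vertices of level at least m - q are few because of their mass, the cores because there are
    at most m^2 of them. Each kind takes at most n / (128 h), so the union meets the size cap of
    [dense_small_set]. *)
Lemma small_union_card (R : realType) h n q m E d (z : 'I_h * 'I_n -> option (bool * nat))
    (P : 'I_m * 'I_m -> {set 'I_h * 'I_n} * {set 'I_h * 'I_n}) :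
  (0 < h)%N -> (0 < m)%N ->
  (128 * h * (m * m * (1 + d)) <= E)%N -> (640 * h * h <= 4 ^ (m - q))%N ->
  \sum_u zval R (z u) ^+ 2 <= 5 * (h%:R * n%:R) ->
  (forall p : 'I_m * 'I_m, near_levels q p.1 p.2 -> E * (#|(P p).1| + #|(P p).2|) <= (1 + d) * n)%N ->
  (64 * h * #|[set u | (z u != None) && (m - q <= zlev (z u))%N] :|:
     \bigcup_(p : 'I_m * 'I_m | near_levels q p.1 p.2) ((P p).1 :|: (P p).2)| <= n)%N.
Proof.
move=> h_gt0 m_gt0 leE lem z_le leP.
set U1 := [set u | _]; set U2 := \bigcup_(p | _) _.
have card1 : (128 * h * #|U1| <= n)%N.
  have le1 : (4 ^ (m - q) * #|U1| <= 5 * (h * n))%N.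
    rewrite -(ler_nat R) [(5 * _)%:R]natrM [(h * n)%:R]natrM; apply: le_trans z_le.
    rewrite natrM mulrC mulr_natl -sumr_const big_mkcond; apply: ler_sum => u _.
    rewrite inE sqr_zval; case: (z u != None) => /=; last by rewrite mulr0.
    case: leqP => [le_m|_]; last by rewrite mulr1 exprn_ge0 ?ler0n.
    by rewrite mulr1 -natrX ler_nat leq_exp2l.
  have le2 : (5 * h * (128 * h * #|U1|) <= 5 * h * n)%N.
    rewrite -[(5 * h * n)%N]mulnA; apply: leq_trans le1; apply: leq_trans (leq_mul lem (leqnn _)).
    by rewrite leq_eqVlt; apply/orP; left; apply/eqP; ring.
  by move: le2; rewrite leq_pmul2l // muln_gt0 h_gt0.
have card2 : (128 * h * #|U2| <= n)%N.
  have le1 : (#|U2| <= \sum_(p : 'I_m * 'I_m | near_levels q p.1 p.2) (#|(P p).1| + #|(P p).2|))%N.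
    rewrite /U2; elim/big_rec2: _ => [|p a S _ IH]; first by rewrite cards0.
    apply: leq_trans (leq_card_setU _ _) _; apply: leq_add => //.
    exact: leq_card_setU.
  have le2 : (E * #|U2| <= m * m * ((1 + d) * n))%N.
    apply: leq_trans (leq_mul (leqnn E) le1) _; rewrite big_distrr /=.
    apply: (@leq_trans (\sum_(p : 'I_m * 'I_m) (1 + d) * n)).
      by rewrite big_mkcond; apply: leq_sum => p _; case: ifP => // /leP.
    by rewrite sum_nat_const card_prod !card_ord.
  have le3 : (m * m * (1 + d) * (128 * h * #|U2|) <= m * m * (1 + d) * n)%N.
    rewrite -[(_ * n)%N]mulnA; apply: leq_trans le2; apply: leq_trans (leq_mul leE (leqnn _)).
    by rewrite leq_eqVlt; apply/orP; left; apply/eqP; ring.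
  by move: le3; rewrite leq_pmul2l // !muln_gt0 m_gt0.
apply: leq_trans (leq_mul (leqnn _) (leq_card_setU U1 U2)) _.
move: card1 card2; rewrite mulnDr -!mulnA; move: (h * #|U1|)%N (h * #|U2|)%N => a b; lia.
Qed.

Lemma heavy_total (R : realType) h n (e : rel 'I_h) d q m D E K (z : 'I_h * 'I_n -> option (bool * nat))
    (s : lift_data h n) :
  symmetric e -> irreflexive e -> regular e d -> (0 < h)%N -> (0 < m)%N ->
  (128 * h * (m * m * (1 + d)) <= E)%N -> (640 * h * h <= 4 ^ (m - q))%N ->
  ~~ has_large_core e q E s -> ~~ dense_small_set e D s ->
  fibre_scale R z K -> \sum_u zval R (z u) ^+ 2 <= 5 * (h%:R * n%:R) ->
  exists2 W : {set 'I_h * 'I_n}, (#|W| <= D)%N &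
    \sum_u \sum_v (if heavy_pair q K z u v && near_levels q (zlev (z u)) (zlev (z v)) then
      `|zval R (z u)| * `|zval R (z v)| * (lift_adj e s u v)%:R else 0)
    <= 40 * 244 * (2 ^+ q * (h%:R * n%:R)) +
       \sum_(u in W) \sum_(v in W) `|zval R (z u)| * `|zval R (z v)| * (lift_adj e s u v)%:R.
Proof.
move=> sym irr reg h_gt0 m_gt0 leE lem okcore okdense scale z_le.
have [P PP] := fin_all_exists (heavy_core (m := m) sym irr reg okcore scale).
set nrl := fun p : 'I_m * 'I_m => near_levels q p.1 p.2.
have leP p : nrl p -> (E * (#|(P p).1| + #|(P p).2|) <= (1 + d) * n)%N by have [_ _ + _] := PP p; apply.
have := small_union_card h_gt0 m_gt0 leE lem z_le leP.
set U := _ :|: _ => cardU.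
pose za u := `|zval R (z u)|.
have za_ge0 u : 0 <= za u by apply: normr_ge0.
pose f u v := if near_levels q (zlev (z u)) (zlev (z v)) then za u * za v else 0.
pose r := lift_adj e s.
have fsym u v : f u v = f v u by rewrite /f /near_levels andbC mulrC.
have f_ge0 u v : 0 <= f u v by rewrite /f; case: ifP => // _; apply: mulr_ge0.
have fr_ge0 u v : 0 <= f u v * (r u v)%:R by rewrite mulr_ge0 ?ler0n.
have fg u v : 0 <= f u v <= 2 ^+ q * zval R (z u) ^+ 2.
  rewrite f_ge0 /= /f; case: ifP => [/andP[lt1 lt2]|_]; last first.
    by apply: mulr_ge0; [rewrite exprn_ge0 ?ler0n | apply: sqr_ge0].
  rewrite /za !normr_zval sqr_zval; case: (z u != None); rewrite ?mulr0 ?mul0r ?mulr0 //.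
  case: (z v != None); rewrite ?mulr0 ?mulr1 -?exprD ?mulr_ge0 ?exprn_ge0 ?ler0n //.
  have -> : 4 = 2 ^+ 2 :> R by ring.
  rewrite -exprM -!exprD -!natrX ler_nat leq_exp2l //; lia.
(* Threshold 15 leaves inner degrees at least 16, so [W] would be a dense small set if it had more
   than [D] vertices. *)
have [W WU [degW le_W]] := @peel_weighted R _ r 15 f (fun u => 2 ^+ q * zval R (z u) ^+ 2) U
  (lift_adj_sym s sym irr) fsym fg.
exists W.
  rewrite leqNgt; apply: contra okdense => lt_D; apply/existsP; exists W; rewrite lt_D /=.
  apply/andP; split.
    by apply: leq_trans cardU; rewrite leq_mul2l subset_leq_card ?orbT.
  rewrite mulnC -sum_nat_const; apply: leq_sum => u /degW; exact.
(* [t1] collects pairs with both levels below [m], before peeling with Q = [S] and after it with Q =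
   [P]; [t3] collects near pairs with a level at least [m]. What survives in [t1 P] and [t3] lies
   inside [U]. *)
pose t1 (Q : 'I_m * 'I_m -> {set 'I_h * 'I_n} * {set 'I_h * 'I_n}) u v : R :=
  \sum_(p | nrl p) 2 ^+ (p.1 + p.2) * ((u \in (Q p).1) && (v \in (Q p).2))%:R * (r u v)%:R.
pose S (p : 'I_m * 'I_m) := (heavy_left q K z p.1 p.2, level_set z p.2) : {set 'I_h * 'I_n} * {set 'I_h * 'I_n}.
pose t3 u v : R := if (m <= zlev (z u))%N || (m <= zlev (z v))%N then f u v * (r u v)%:R else 0.
have t3_ge0 u v : 0 <= t3 u v by rewrite /t3; case: ifP.
have t1_ge0 Q u v : 0 <= t1 Q u v by apply: sumr_ge0 => p _; rewrite !mulr_ge0 ?exprn_ge0 ?ler0n.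
have t1E Q : \sum_u \sum_v t1 Q u v =
    \sum_(p | nrl p) 2 ^+ (p.1 + p.2) * (\sum_(u in (Q p).1) \sum_(v in (Q p).2) r u v)%:R.
  rewrite /t1; under eq_bigr do rewrite exchange_big /=.
  rewrite exchange_big /=; apply: eq_bigr => p _.
  rewrite natr_sum mulr_sumr [RHS]big_mkcond; apply: eq_bigr => u _.
  case: (u \in _); last by rewrite big1 // => v _; rewrite mulr0 mul0r.
  rewrite natr_sum mulr_sumr [RHS]big_mkcond; apply: eq_bigr => v _ /=.
  by case: (v \in _); rewrite ?mulr1 // mulr0 mul0r.
have step1 : \sum_u \sum_v (if heavy_pair q K z u v && near_levels q (zlev (z u)) (zlev (z v)) then
      za u * za v * (r u v)%:R else 0) <= \sum_u \sum_v (t1 S u v + t3 u v).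
  apply: ler_sum => u _; apply: ler_sum => v _.
  case: ifP => [/andP[/and3P[nzu nzv lt_l] near]|_]; last by rewrite addr_ge0.
  case: (boolP ((m <= zlev (z u))%N || (m <= zlev (z v))%N)) => [big|].
    by rewrite /t3 big /f near lerDr.
  rewrite negb_or -!ltnNge => /andP[ltu ltv].
  apply: (@le_trans _ _ (t1 S u v)); last by rewrite lerDl.
  rewrite /t1 (bigD1 (Ordinal ltu, Ordinal ltv)) //=.
  rewrite !inE nzu nzv lt_l !eqxx /= mulr1 /za !normr_zval nzu nzv !mulr1 -exprD lerDl.
  by apply: sumr_ge0 => p _; rewrite !mulr_ge0 ?exprn_ge0 ?ler0n.
have step2 : \sum_u \sum_v (t1 P u v + t3 u v) <= \sum_(u in U) \sum_(v in U) f u v * (r u v)%:R.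
  rewrite [leRHS]big_mkcond; apply: ler_sum => u _.
  apply: (@le_trans _ _ (\sum_v (if (u \in U) && (v \in U) then f u v * (r u v)%:R else 0))); last first.
    by case: (u \in U) => /=; rewrite ?[leRHS]big_mkcond // big1.
  apply: ler_sum => v _.
  have PU p : nrl p -> (P p).1 \subset U /\ (P p).2 \subset U.
    move=> np; split; apply: subset_trans (subsetUr _ _);
      apply: (subset_trans _ (bigcup_sup p np)); rewrite ?subsetUl ?subsetUr //.
  have levP p : u \in (P p).1 -> v \in (P p).2 ->
      [/\ z u != None, z v != None, zlev (z u) = p.1 & zlev (z v) = p.2].
    have [/subsetP P1 /subsetP P2 _ _] := PP p.
    move=> /P1; rewrite inE => /and3P[-> /eqP -> _] /P2; rewrite inE => /andP[-> /eqP ->].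
    by [].
  case: (boolP ((m <= zlev (z u))%N || (m <= zlev (z v))%N)) => big.
    rewrite /t1 big1 ?add0r => [|p np]; last first.
      case: (boolP (_ && _)) => [/andP[uP vP]|_]; last by rewrite mulr0 mul0r.
      have [_ _ lu lv] := levP p uP vP.
      by move: big; rewrite lu lv leqNgt ltn_ord leqNgt ltn_ord.
    rewrite /t3 big; case: ifP => [//|nU].
    rewrite /f; case: ifP => [near|_]; last by rewrite mul0r.
    have [zu|nzu] := eqVneq (z u) None; first by rewrite /za zu normr0 !mul0r.
    have [zv|nzv] := eqVneq (z v) None; first by rewrite /za zv normr0 mulr0 mul0r.
    move: nU; rewrite !inE nzu nzv /=.
    by have /andP[-> ->] := near_levels_large near big.
  rewrite /t3 (negPf big) addr0.
  move: big; rewrite negb_or -!ltnNge => /andP[ltu ltv].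
  rewrite /t1 (bigID (fun p => p == (Ordinal ltu, Ordinal ltv))) /= [X in _ + X]big1 ?addr0; last first.
    move=> p /andP[_ ne]; case: (boolP (_ && _)) => [/andP[uP vP]|_]; last by rewrite mulr0 mul0r.
    have [_ _ lu lv] := levP p uP vP; case/negP: ne; apply/eqP.
    by move: p lu lv {uP vP} => [p1 p2] /= lu lv; congr (_, _); apply: val_inj.
  have rhs_ge0 : 0 <= (if (u \in U) && (v \in U) then f u v * (r u v)%:R else 0) by case: ifP.
  case: (boolP (nrl (Ordinal ltu, Ordinal ltv))) => near; last first.
    by rewrite big1 // => p /andP[np /eqP pE]; rewrite pE (negPf near) in np.
  rewrite (big_pred1 (Ordinal ltu, Ordinal ltv)) => [|p]; last first.
    by apply/andP/eqP => [[_ /eqP] //|->].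
  case: (boolP (_ && _)) => [/andP[uP vP]|_]; last by rewrite mulr0 mul0r.
  have [nzu nzv _ _] := levP _ uP vP.
  have [/subsetP PU1 /subsetP PU2] := PU _ near.
  rewrite (PU1 u uP) (PU2 v vP) /= /f; move: near; rewrite /nrl /= => ->.
  by rewrite mulr1 /za !normr_zval nzu nzv !mulr1 -exprD.
have step3 : \sum_u \sum_v t1 S u v <= (128 + 256 * 7) * 2 ^+ q * \sum_u zval R (z u) ^+ 2 +
    \sum_u \sum_v t1 P u v.
  apply: (le_trans _ (lerD (heavy_peeled_total R q m K z) (lexx _))).
  rewrite !t1E -big_split /=; apply: ler_sum => p np.
  by rewrite -mulrDr ler_wpM2l ?exprn_ge0 ?ler0n // -natrD ler_nat; have [_ _ _] := PP p.
apply: (le_trans step1).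
have -> : \sum_u \sum_v (t1 S u v + t3 u v) = \sum_u \sum_v t1 S u v + \sum_u \sum_v t3 u v.
  by rewrite -big_split /=; apply: eq_bigr => u _; rewrite big_split.
move: step2; have -> : \sum_u \sum_v (t1 P u v + t3 u v) = \sum_u \sum_v t1 P u v + \sum_u \sum_v t3 u v.
  by rewrite -big_split /=; apply: eq_bigr => u _; rewrite big_split.
move=> step2.
have leW : \sum_(u in W) \sum_(v in W) f u v * (r u v)%:R <=
    \sum_(u in W) \sum_(v in W) za u * za v * (r u v)%:R.
  apply: ler_sum => u _; apply: ler_sum => v _; rewrite ler_wpM2r ?ler0n // /f.
  by case: ifP => // _; apply: mulr_ge0.
set T := 2 ^+ q * (h%:R * n%:R).
have le1 : (128 + 256 * 7) * 2 ^+ q * \sum_u zval R (z u) ^+ 2 <= (128 + 256 * 7) * 5 * T.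
  have -> : (128 + 256 * 7) * 5 * T = (128 + 256 * 7) * 2 ^+ q * (5 * (h%:R * n%:R)) by rewrite /T; ring.
  by rewrite ler_wpM2l // mulr_ge0 ?exprn_ge0 ?ler0n // -?natrM -?natrD ler0n.
have le2 : 2 * 15%:R * \sum_(u in U) 2 ^+ q * zval R (z u) ^+ 2 <= 30 * 5 * T.
  rewrite -mulr_sumr.
  have sub : \sum_(u in U) zval R (z u) ^+ 2 <= 5 * (h%:R * n%:R).
    apply: le_trans z_le; rewrite [leRHS](bigID (fun u => u \in U)) /= lerDl.
    by apply: sumr_ge0 => u _; apply: sqr_ge0.
  have -> : 30 * 5 * T = 2 * 15%:R * (2 ^+ q * (5 * (h%:R * n%:R))) by rewrite /T; ring.
  by rewrite ler_wpM2l ?mulr_ge0 ?ler0n // ler_wpM2l ?exprn_ge0 ?ler0n.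
have T_ge0 : 0 <= T by rewrite mulr_ge0 ?exprn_ge0 ?mulr_ge0 ?ler0n.
(* The constants are (128 + 256 * 7) * 5 + 30 * 5 = 9750 <= 40 * 244. *)
move: leW; rewrite -/za; set XW := \sum_(u in W) \sum_(v in W) za u * za v * _ => leW.
lra.
Qed.

(** * The dyadic quadratic form *)

(** The least admissible k has n 4^k <= n + 4 * 5 h n, so k < 4^k <= 20 h + 1. *)
Lemma fibre_scale_exists (R : realType) h n m (z : 'I_h * 'I_n -> option (bool * nat)) :
  (0 < n)%N -> (20 * h < m)%N ->
  \sum_u zval R (z u) ^+ 2 <= 5 * (h%:R * n%:R) ->
  exists2 K : {ffun 'I_h -> 'I_m}, fibre_scale R z (fun i => K i) &
    forall i, (K i <= 20 * h)%N.
Proof.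
move=> n_gt0 lt_m z_le.
have n0 : 0 < n%:R :> R by rewrite ltr0n.
pose S i := \sum_j zval R (z (i, j)) ^+ 2.
have S_le i : S i <= 5 * (h%:R * n%:R).
  apply: le_trans z_le; rewrite sum_pairE (bigD1 i) //= lerDl.
  by apply: sumr_ge0 => i' _; apply: sumr_ge0 => j _; apply: sqr_ge0.
suff Kex i : exists k : 'I_m, (S i <= n%:R * 4 ^+ k <= n%:R + 4 * S i) && (k <= 20 * h)%N.
  have [K0 K0P] := fin_all_exists Kex.
  exists [ffun i => K0 i] => i; rewrite ffunE; first by have /andP[] := K0P i.
  by have /andP[] := K0P i.
have ex : exists k, S i <= n%:R * 4 ^+ k.
  exists (5 * h)%N; apply: (le_trans (S_le i)); rewrite mulrA mulrC ler_wpM2l ?ler0n //.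
  by rewrite -natrM -natrX ler_nat ltnW // ltn_expl.
case: (ex_minnP ex) => k le_k k_min.
have k_up : n%:R * 4 ^+ k <= n%:R + 4 * S i.
  case: k k_min {le_k} => [|k] k_min.
    by rewrite expr0 mulr1 lerDl mulr_ge0 ?ler0n // sumr_ge0 // => j _; apply: sqr_ge0.
  have : n%:R * 4 ^+ k <= S i.
    by rewrite leNgt; apply/negP => /ltW /k_min; rewrite ltnn.
  by rewrite exprS; have := ler0n R n; nra.
have k_le : (k <= 20 * h)%N.
  rewrite -ltnS; apply: (leq_trans (ltn_expl k (isT : 1 < 4)%N)).
  rewrite -(ler_nat R) natrX -(ler_pM2l n0); apply: (le_trans k_up).
  have -> : (20 * h).+1%:R = 20 * h%:R + 1 :> R by rewrite -natr1 natrM.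
  have -> : n%:R * (20 * h%:R + 1) = n%:R + 4 * (5 * (h%:R * n%:R)) :> R by ring.
  by rewrite lerD2l ler_wpM2l ?ler0n.
exists (Ordinal (leq_ltn_trans k_le lt_m)).
by rewrite /= le_k k_up k_le.
Qed.

Definition dyadic_form (R : unitRingType) h n (e : rel 'I_h)
    (z : 'I_h * 'I_n -> option (bool * nat)) (s : lift_data h n) : R :=
  \sum_u \sum_v zval R (z u) * zval R (z v) * ((lift_adj e s u v)%:R - (e u.1 v.1)%:R / n%:R).

Definition local_mass (R : numDomainType) h n (e : rel 'I_h)
    (z : 'I_h * 'I_n -> option (bool * nat)) (s : lift_data h n) (W : {set 'I_h * 'I_n}) : R :=
  \sum_(u in W) \sum_(v in W) `|zval R (z u)| * `|zval R (z v)| * (lift_adj e s u v)%:R.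

(** Pointwise form of the splitting into light, far and near heavy pairs, with M the adjacency and N
    the mean. A pair may be counted several times on the right, where all terms are nonnegative. *)
Lemma pair_split_bound (R : realType) (a b M N : R) (light far1 far2 hv1 hv2 near : bool) :
  0 <= M -> 0 <= N -> (a != 0 -> b != 0 -> ~~ light -> hv1 || hv2) ->
  (~~ far1 -> ~~ far2 -> near) ->
  `|a * b * (M - N) - (if light then a * b * (M - N) else 0)| <=
  (if far1 then `|a| * `|b| * M else 0) + (if far2 then `|a| * `|b| * M else 0) +
  ((if hv1 && near then `|a| * `|b| * M else 0) + (if hv2 && near then `|a| * `|b| * M else 0)) +
  ((if hv1 then `|a| * `|b| * N else 0) + (if hv2 then `|a| * `|b| * N else 0)).
Proof.
move=> M_ge0 N_ge0 hv nr.
have x_ge0 : 0 <= `|a| * `|b| * M by rewrite !mulr_ge0.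
have y_ge0 : 0 <= `|a| * `|b| * N by rewrite !mulr_ge0.
have le_xy : `|a * b * (M - N)| <= `|a| * `|b| * M + `|a| * `|b| * N.
  rewrite !normrM -mulrDr ler_wpM2l ?mulr_ge0 // (le_trans (ler_normB _ _)) //.
  by rewrite !ger0_norm.
case: light hv => hv.
  move: x_ge0 y_ge0; rewrite subrr normr0 => {le_xy hv nr}.
  move: (_ * M) (_ * N) => x y x_ge0 y_ge0.
  by case: far1; case: far2; case: hv1; case: hv2; case: near => /=; lra.
rewrite subr0; apply: (le_trans le_xy).
have [a0|a0] := eqVneq a 0.
  by rewrite a0 normr0 !mul0r !if_same !addr0.
have [b0|b0] := eqVneq b 0.
  by rewrite b0 normr0 !mulr0 !mul0r !if_same !addr0.
have {hv} := hv a0 b0 isT; move: nr x_ge0 y_ge0 => {le_xy}.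
move: (_ * M) (_ * N) => x y.
by case: far1; case: far2; case: hv1; case: hv2; case: near => //= nr x_ge0 y_ge0 _;
  try (by have := nr isT isT); lra.
Qed.

Lemma dyadic_form_bound (R : realType) h n (e : rel 'I_h) d q m D E
    (z : 'I_h * 'I_n -> option (bool * nat)) (s : lift_data h n) :
  symmetric e -> irreflexive e -> regular e d -> (0 < h)%N -> (0 < n)%N ->
  (d <= 4 ^ q.+1)%N ->
  (q + 20 * h < m)%N -> (128 * h * (m * m * (1 + d)) <= E)%N -> (640 * h * h <= 4 ^ (m - q))%N ->
  ~~ has_large_core e q E s -> ~~ dense_small_set e D s ->
  ~~ light_failure e q m ((256 * 4 ^+ m)^-1 : R) s ->
  \sum_u zval R (z u) ^+ 2 <= 5 * (h%:R * n%:R) ->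
  exists2 W : {set 'I_h * 'I_n}, (#|W| <= D)%N &
    `|dyadic_form R e z s| <= 256 * 256 * (2 ^+ q * (h%:R * n%:R)) + 2 * local_mass R e z s W.
Proof.
move=> sym irr reg h_gt0 n_gt0 le_dq lt_m leE lem okcore okdense oklight z_le.
have [K scale K_le] := fibre_scale_exists n_gt0 (leq_ltn_trans (leq_addl q _) lt_m) z_le.
have K_lt i : (q + K i < m)%N by apply: leq_ltn_trans lt_m; rewrite leq_add2l.
have m_gt0 : (0 < m)%N by apply: leq_ltn_trans lt_m.
have c_gt0 : 0 < 256 * 4 ^+ m :> R by rewrite mulr_gt0 ?exprn_gt0 ?ltr0n.
have eta_le : 256 * 4 ^+ m * (256 * 4 ^+ m)^-1 <= 1 :> R by rewrite divff // lt0r_neq0.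
have eta_ge0 : 0 <= (256 * 4 ^+ m)^-1 :> R by rewrite invr_ge0 ltW.
have Llight := light_total sym reg h_gt0 n_gt0 le_dq K_lt eta_le eta_ge0 oklight scale z_le.
have [W W_le Lheavy] := heavy_total sym irr reg h_gt0 m_gt0 leE lem okcore okdense scale z_le.
exists W => //.
have Lmean := heavy_mean sym reg n_gt0 le_dq scale.
have Lfar := far_sum R z s sym irr reg le_dq.
pose r := lift_adj e s.
have rsym := lift_adj_sym s sym irr.
pose za u := `|zval R (z u)|.
pose kk := fun i => nat_of_ord (K i).
pose F1 u v : R := if (zlev (z u) + q <= zlev (z v))%N then za u * za v * (r u v)%:R else 0.
pose H1 u v : R := if heavy_pair q kk z u v && near_levels q (zlev (z u)) (zlev (z v)) then
      za u * za v * (r u v)%:R else 0.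
pose M1 u v : R := if heavy_pair q kk z u v then za u * za v * ((e u.1 v.1)%:R / n%:R) else 0.
pose T u v : R := zval R (z u) * zval R (z v) * ((r u v)%:R - (e u.1 v.1)%:R / n%:R).
have pt u v : `|T u v - light_term R e q kk z s u v| <=
    F1 u v + F1 v u + (H1 u v + H1 v u) + (M1 u v + M1 v u).
  rewrite /T /light_term /F1 /H1 /M1 /r (rsym v u) [e v.1 u.1]sym [za v * za u]mulrC.
  have -> : near_levels q (zlev (z v)) (zlev (z u)) = near_levels q (zlev (z u)) (zlev (z v)).
    by rewrite /near_levels andbC.
  apply: pair_split_bound; rewrite ?ler0n ?divr_ge0 ?ler0n //.
    move=> zu zv; rewrite /light_pair /heavy_pair.
    have -> : z u != None by apply: contraNneq zu => ->.
    have -> : z v != None by apply: contraNneq zv => ->.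
    by rewrite /= negb_and -!ltnNge.
  by rewrite /near_levels -!ltnNge => -> ->.
have swap (G : 'I_h * 'I_n -> 'I_h * 'I_n -> R) :
    \sum_u \sum_v (G u v + G v u) = 2 * \sum_u \sum_v G u v.
  rewrite (eq_bigr (fun u => \sum_v G u v + \sum_v G v u)) => [|u _]; last by rewrite big_split.
  by rewrite big_split /= [X in _ + X]exchange_big /=; ring.
have diff : `|dyadic_form R e z s - \sum_u \sum_v light_term R e q kk z s u v| <=
    2 * (\sum_u \sum_v F1 u v) + 2 * (\sum_u \sum_v H1 u v) + 2 * (\sum_u \sum_v M1 u v).
  rewrite /dyadic_form -sumrB; apply: (le_trans (ler_norm_sum _ _ _)).
  rewrite -!swap -!big_split /=; apply: ler_sum => u _.
  rewrite -sumrB; apply: (le_trans (ler_norm_sum _ _ _)).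
  rewrite -!big_split /=; apply: ler_sum => v _; exact: pt.
set L := \sum_u \sum_v light_term R e q kk z s u v in diff.
set X := dyadic_form R e z s in diff *.
have tri : `|X| <= `|X - L| + `|L| by rewrite -{1}(subrK L X) ler_normD.
set TT := 2 ^+ q * (h%:R * n%:R) in Llight Lheavy *.
have TT_ge0 : 0 <= TT by rewrite mulr_ge0 ?exprn_ge0 ?mulr_ge0 ?ler0n.
have sumz : 4 * 2 ^+ q * \sum_v zval R (z v) ^+ 2 <= 20 * TT.
  have -> : 20 * TT = 4 * 2 ^+ q * (5 * (h%:R * n%:R)) by rewrite /TT; ring.
  by rewrite ler_wpM2l ?mulr_ge0 ?exprn_ge0 ?ler0n.
have LF : \sum_u \sum_v F1 u v <= 20 * TT := le_trans Lfar sumz.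
have LM : \sum_u \sum_v M1 u v <= 20 * TT := le_trans Lmean sumz.
have LH : \sum_u \sum_v H1 u v <= 40 * 244 * TT + local_mass R e z s W := Lheavy.
have LL : `|L| <= 256 * 168 * TT := Llight.
move: LF LM LH LL diff tri; clear -TT_ge0.
move: (\sum_u \sum_v F1 u v) (\sum_u \sum_v H1 u v) (\sum_u \sum_v M1 u v) `|X - L| `|L| `|X| (local_mass _ _ _ _ _).
(* 40 + 2 * 40 * 244 + 40 + 256 * 168 = 62608 <= 256 * 256. *)
move=> f hh mm xl l x w; lra.
Qed.

(** * Dyadic rounding *)

(** Coordinates are moved one by one to an end of their interval, chosen by the sign of the slope,
    so [Q] never decreases. *)
Lemma affine_vertex (F : realDomainType) (V : finType) (Q : {ffun V -> F} -> F)
    (P : V -> F -> Prop) (lo hi x : {ffun V -> F}) :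
  (forall (y : {ffun V -> F}) u, exists B C, forall t,
    Q [ffun v => if v == u then t else y v] = t * B + C) ->
  (forall u, lo u <= x u <= hi u) -> (forall u, P u (lo u)) -> (forall u, P u (hi u)) ->
  exists2 y : {ffun V -> F}, (forall u, P u (y u)) & Q x <= Q y.
Proof.
move=> affine x_in P_lo P_hi.
suff [y [y_in _ le_xy]] : exists y : {ffun V -> F},
    [/\ forall u, u \in enum V -> P u (y u), forall u, lo u <= y u <= hi u & Q x <= Q y].
  by exists y => // u; apply: y_in; rewrite mem_enum.
elim: (enum V) => [|u r [y [yP y_in le_xy]]]; first by exists x.
have [B [C QE]] := affine y u.
have yE : [ffun v => if v == u then y u else y v] = y.
  by apply/ffunP => v; rewrite ffunE; case: eqP => [->|].
have Qy : Q y = y u * B + C by rewrite -QE yE.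
have [t [Pt t_in le_t]] : exists t, [/\ P u t, lo u <= t <= hi u & y u * B <= t * B].
  have /andP[le_lo le_hi] := y_in u; have le_lohi := le_trans le_lo le_hi.
  have [B_ge0|/ltW B_le0] := lerP 0 B.
    by exists (hi u); split; rewrite ?lexx ?le_lohi ?ler_wpM2r.
  by exists (lo u); split; rewrite ?lexx ?le_lohi ?ler_wnM2r.
exists [ffun v => if v == u then t else y v]; split.
- by move=> v; rewrite inE ffunE; case: eqP => [->|_] //=; apply: yP.
- by move=> v; rewrite ffunE; case: eqP => [->|].
- by rewrite (le_trans le_xy) // Qy QE lerD2r.
Qed.

Lemma quad_form_affine (F : comPzRingType) (V : finType) (A : V -> V -> F)
    (y : {ffun V -> F}) u :
  A u u = 0 -> exists B C, forall t,
  let y' := [ffun v => if v == u then t else y v] in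
  \sum_v \sum_w y' v * y' w * A v w = t * B + C.
Proof.
move=> Auu.
exists (\sum_(w | w != u) y w * A u w + \sum_(v | v != u) y v * A v u).
exists (\sum_(v | v != u) \sum_(w | w != u) y v * y w * A v w) => t /=.
rewrite (bigD1 u) //= (bigD1 u) //= !ffunE eqxx Auu mulr0 add0r mulrDr -!addrA; congr (_ + _).
  rewrite mulr_sumr; apply: eq_bigr => w /negPf w_u.
  by rewrite ffunE w_u mulrA.
rewrite mulr_sumr -big_split; apply: eq_bigr => v /negPf v_u /=.
rewrite (bigD1 u) //= !ffunE eqxx v_u; congr (_ + _); first by ring.
by apply: eq_bigr => w /negPf w_u; rewrite ffunE w_u.
Qed.

(** Consecutive powers of 2 around t cost the factor 4. For 0 <= t < 1 the bracket is 0 and 1, which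
    costs the additive 1; negative t is reflected. *)
Lemma dyadic_bracket (F : archiRealFieldType) (t : F) :
  exists lo hi : option (bool * nat), [/\ zval F lo <= t <= zval F hi,
    zval F lo ^+ 2 <= 4 * t ^+ 2 + 1 & zval F hi ^+ 2 <= 4 * t ^+ 2 + 1].
Proof.
wlog t_ge0 : t / 0 <= t.
  move=> IH; have [|/ltW t_le0] := lerP 0 t; first exact: IH.
  have neg (x : option (bool * nat)) : zval F (omap (fun p => (~~ p.1, p.2)) x) = - zval F x.
    by case: x => [[b k]|] /=; rewrite ?oppr0 // signrN mulNr.
  have [|lo [hi [/andP[le_lo le_hi] lo2 hi2]]] := IH (- t); first by rewrite oppr_ge0.
  exists (omap (fun p => (~~ p.1, p.2)) hi), (omap (fun p => (~~ p.1, p.2)) lo).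
  by rewrite !neg !sqrrN lerNl le_hi lerNr le_lo -[t ^+ 2]sqrrN.
have ex : exists k, t < 2 ^+ k.
  have := Num.Theory.truncnS_gt t; set b := (Num.truncn t).+1 => t_lt.
  exists b; apply: (lt_trans t_lt).
  by rewrite -natrX ltr_nat ltn_expl.
case: (ex_minnP ex) => -[|k] t_lt k_min.
  exists None, (Some (false, 0%N)); rewrite /= expr0 mulr1 t_ge0 ltW // expr1n expr0n.
  by have t2 := sqr_ge0 t; split => //=; lra.
have le_t : 2 ^+ k <= t.
  by rewrite leNgt; apply/negP => /k_min; rewrite ltnn.
exists (Some (false, k)), (Some (false, k.+1)).
rewrite /= expr0 !mul1r le_t ltW //; have p_ge0 : 0 <= 2 ^+ k :> F by rewrite exprn_ge0.
rewrite [2 ^+ k.+1]exprS exprMn; have p2_le : (2 ^+ k) ^+ 2 <= t ^+ 2 by rewrite lerXn2r.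
by have t2 := sqr_ge0 t; split=> //; lra.
Qed.

Lemma dyadic_rounding (F : archiRealFieldType) (V : finType) (A : V -> V -> F) (x : V -> F) :
  (forall u, A u u = 0) ->
  exists2 z : V -> option (bool * nat), (forall u, zval F (z u) ^+ 2 <= 4 * x u ^+ 2 + 1) &
    `|\sum_u \sum_v x u * x v * A u v| <= `|\sum_u \sum_v zval F (z u) * zval F (z v) * A u v|.
Proof.
wlog form_ge0 : A / 0 <= \sum_u \sum_v x u * x v * A u v.
  move=> IH A0; have [form_ge0|form_le0] := lerP 0 (\sum_u \sum_v x u * x v * A u v).
    exact: IH.
  have opp (y : V -> F) : \sum_u \sum_v y u * y v * - A u v = - \sum_u \sum_v y u * y v * A u v.
    rewrite -sumrN; apply: eq_bigr => u _; rewrite -sumrN; apply: eq_bigr => v _; exact: mulrN.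
  have [||z z_le] := IH (fun u v => - A u v); rewrite ?opp.
  - by rewrite oppr_ge0 ltW.
  - by move=> u; rewrite A0 oppr0.
  - by rewrite !normrN; exists z.
move=> A0.
have [lo loP] := fin_all_exists (fun u => dyadic_bracket (x u)).
have [hi hiP] := fin_all_exists loP.
pose Q (y : {ffun V -> F}) := \sum_u \sum_v y u * y v * A u v.
pose P u t := exists2 c, t = zval F c & zval F c ^+ 2 <= 4 * x u ^+ 2 + 1.
have [||||y yP le_xy] := @affine_vertex F V Q P [ffun u => zval F (lo u)]
    [ffun u => zval F (hi u)] [ffun u => x u].
- by move=> y u; apply: quad_form_affine.
- by move=> u; rewrite !ffunE; have [] := hiP u.
- by move=> u; rewrite ffunE; exists (lo u) => //; have [] := hiP u.
- by move=> u; rewrite ffunE; exists (hi u) => //; have [] := hiP u.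
have [z zP z_le] := fin_all_exists2 yP.
exists z => //; rewrite ger0_norm //.
move: le_xy; rewrite /Q.
rewrite (eq_bigr (fun u => \sum_v x u * x v * A u v)) => [|u _]; last first.
  by apply: eq_bigr => v _; rewrite !ffunE.
move/le_trans; apply; apply: (le_trans (ler_norm _)).
rewrite (eq_bigr (fun u => \sum_v zval F (z u) * zval F (z v) * A u v)) // => u _.
by apply: eq_bigr => v _; rewrite !zP.
Qed.

(** * Eigenvalues *)

(** In a unitary eigenbasis the form is diagonal, and [l] is its largest diagonal entry. *)
Lemma hermitian_rayleigh m (A : 'M[algC]_m) : (0 < m)%N -> A \is hermsymmx ->
  exists2 l : algR, largest_eigenvalue A (algRval l) &
    forall x : 'rV_m, (x *m A *m (map_mx Num.conj x^T)) 0 0 <= algRval l * (x *m (map_mx Num.conj x^T)) 0 0.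
Proof.
move=> m_gt0 hermA.
have /mxOverP d_real := hermitian_spectral_diag_real hermA.
have /orthomx_spectralP AE := hermitian_normalmx hermA.
have uniP := spectral_unitarymx A; have unitP := spectral_unit A.
move: (spectralmx A) (spectral_diag A) AE uniP unitP d_real => P d AE uniP unitP d_real.
have r_real : {in xpredT, forall i : 'I_m, d 0 i \is Creal} by move=> i _.
have [i _ i_max] := @real_arg_maxP _ _ (Ordinal m_gt0) xpredT (fun i => d 0 i) isT r_real.
exists (in_algR (d_real 0 i)); first split.
- apply/eigenvalueP; exists (row i P).
    rewrite AE !mulmxA rowE -[_ *m P *m _]mulmxA mulmxV // mulmx1.
    by rewrite -[delta_mx 0 i *m diag_mx d]rowE row_diag_mx -scalemxAl.
  rewrite rowE; apply/eqP => P0.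
  have /matrixP/(_ 0 i) : delta_mx 0 i = 0 :> 'rV[algC]_m.
    by rewrite -[delta_mx 0 i](mulmxK unitP) P0 mul0mx.
  by rewrite !mxE !eqxx => /eqP; rewrite oner_eq0.
- move=> a /eigenvalueP[v vA v0].
  pose w := v *m invmx P.
  have wD : w *m diag_mx d = a *: w.
    by rewrite /w scalemxAl -vA [in RHS]AE !mulmxA mulmxK.
  have w0 : w != 0.
    by apply: contra_neq v0 => w0; rewrite -[v](mulmxKV unitP) -/w w0 mul0mx.
  have /rV0Pn[j wj0] := w0.
  have : d 0 j = a.
    apply: (mulfI wj0); have /rowP/(_ j) := wD.
    by rewrite mul_mx_diag !mxE => ->; rewrite mulrC.
  by move=> <-; apply: i_max.
move=> x; pose w := x *m invmx P.
have invP : invmx P = map_mx Num.conj P^T by rewrite invmx_unitary.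
have wC : map_mx Num.conj w^T = P *m map_mx Num.conj x^T.
  by rewrite /w invP trmx_mul map_mxM map_trmx trmxK -map_mx_comp (map_mx_id (@conjCK _)).
have -> : x *m A *m map_mx Num.conj x^T = w *m diag_mx d *m map_mx Num.conj w^T.
  by rewrite wC {1}AE /w !mulmxA.
have -> : x *m map_mx Num.conj x^T = w *m map_mx Num.conj w^T.
  by rewrite wC /w !mulmxA mulmxKV.
rewrite mul_mx_diag !mxE mulr_sumr; apply: ler_sum => j _.
by rewrite !mxE mulrAC [leLHS]mulrC ler_wpM2r ?mul_conjC_ge0 //; apply: i_max.
Qed.

Lemma adjacency_rayleigh (T : finType) (r : rel T) (S : {set T}) : symmetric r -> S != set0 ->
  exists2 l : algR, largest_eigenvalue (adj_mx r S) (algRval l) & forall y : T -> algR,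
    \sum_(u in S) \sum_(v in S) y u * y v * (r u v)%:R <= l * \sum_(u in S) y u ^+ 2.
Proof.
move=> sym S0.
have herm : adj_mx r S \is hermsymmx.
  apply: realsym_hermsym.
    apply/is_hermitianmxP; rewrite expr0 scale1r map_mx_id //.
    by apply/matrixP => i j; rewrite !mxE sym.
  by apply/mxOverP => i j; rewrite mxE realn.
have [|l l_max le_l] := hermitian_rayleigh _ herm; first by rewrite card_gt0.
exists l => // y0; pose y u := algRval (y0 u).
have y_real u : y u \is Creal by apply: algRvalP.
suff : \sum_(u in S) \sum_(v in S) y u * y v * (r u v)%:R <= algRval l * \sum_(u in S) y u ^+ 2.
  have -> : \sum_(u in S) y u ^+ 2 = algRval (\sum_(u in S) y0 u ^+ 2) by rewrite rmorph_sum.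
  rewrite (eq_bigr (fun u => algRval (\sum_(v in S) y0 u * y0 v * (r u v)%:R))) => [|u _].
    by rewrite -rmorph_sum -rmorphM.
  by rewrite rmorph_sum; apply: eq_bigr => v _; rewrite !rmorphM rmorph_nat.
have := le_l (\row_p y (enum_val p)).
have yC (p : 'I_#|S|) : (map_mx Num.conj (\row_p y (enum_val p))^T) p 0 = y (enum_val p).
  by rewrite !mxE conj_Creal.
rewrite !mxE (eq_bigr (fun p : 'I_#|S| => \sum_(k < #|S|)
    y (enum_val k) * y (enum_val p) * (r (enum_val k) (enum_val p))%:R)) => [|p _]; last first.
  by rewrite yC !mxE mulr_suml; apply: eq_bigr => k _; rewrite !mxE mulrAC.
rewrite exchange_big /= [X in _ <= algRval l * X](eq_bigr (fun p : 'I_#|S| => y (enum_val p) ^+ 2)) => [|p _].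
  move=> le_form; rewrite big_enum_val [X in _ <= algRval l * X]big_enum_val /=.
  rewrite (eq_bigr (fun p : 'I_#|S| => \sum_(k < #|S|)
    y (enum_val p) * y (enum_val k) * (r (enum_val p) (enum_val k))%:R)) // => p _.
  by rewrite big_enum_val.
by rewrite yC mxE expr2.
Qed.

Lemma sum_enum_setT (R : nmodType) (T : finType) (F : T -> R) :
  \sum_(p < #|[set: T]|) F (enum_val p) = \sum_u F u.
Proof. by rewrite -big_enum_val; apply: eq_bigl => u; rewrite inE. Qed.

Lemma symmetric_eigenvalue_real (V : finType) (M : V -> V -> algC) (x : V -> algC) a u0 :
  (forall u v, M u v = M v u) -> (forall u v, M u v \is Creal) -> x u0 != 0 ->
  (forall v, \sum_u x u * M u v = a * x v) -> a \is Creal.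
Proof.
move=> sym M_real x0 eig.
pose N := \sum_v x v * (x v)^*.
have N0 : N != 0.
  rewrite /N (bigD1 u0) //= gt_eqF // ltr_wpDr ?sumr_ge0 // => [v _|]; first exact: mul_conjC_ge0.
  by rewrite mul_conjC_gt0.
pose q := \sum_v \sum_u x u * M u v * (x v)^*.
have qN : q = a * N.
  rewrite /q mulr_sumr; apply: eq_bigr => v _; by rewrite -mulr_suml eig mulrA.
have qC : q^* = q.
  rewrite /q rmorph_sum exchange_big; apply: eq_bigr => u _ /=.
  rewrite rmorph_sum; apply: eq_bigr => v _.
  by rewrite !rmorphM /= conjCK (conj_Creal (M_real _ _)) sym; ring.
have NC : N^* = N.
  by rewrite /N rmorph_sum; apply: eq_bigr => v _; rewrite rmorphM /= conjCK mulrC.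
apply/CrealP; apply: (mulIf N0).
by move: qC; rewrite qN rmorphM /= NC.
Qed.

(** The eigenvalue of a symmetric real matrix is real. The eigenvector is multiplied by the
    conjugate of a nonzero coordinate, so that its real part is nonzero there. *)
Lemma new_eigenvector_real h n (e : rel 'I_h) (s : lift_data h n) a :
  symmetric e -> irreflexive e -> new_eigenvalue e s a ->
  exists b : algR, a = algRval b /\ exists y : 'I_h * 'I_n -> algR,
  [/\ exists u, y u != 0, forall i, \sum_j y (i, j) = 0 &
      forall v, \sum_u y u * (lift_adj e s u v)%:R = b * y v].
Proof.
move=> sym irr [x x0 [x_fibre x_eig]].
have rsym := lift_adj_sym s sym irr.
pose x' u := x 0 (enum_rank_in (in_setT u) u).
have x'E p : x' (enum_val p) = x 0 p by rewrite /x' enum_valK_in.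
have eig v : \sum_u x' u * (lift_adj e s u v)%:R = a * x' v.
  have /rowP/(_ (enum_rank_in (in_setT v) v)) := x_eig.
  rewrite !mxE -/(x' v) => <-.
  rewrite -sum_enum_setT; apply: eq_bigr => p _.
  by rewrite x'E mxE enum_rankK_in ?inE.
have fib i : \sum_j x' (i, j) = 0.
  apply: etrans (x_fibre i); rewrite [RHS]big_mkcond /=.
  rewrite [RHS](eq_bigr (fun p => if (enum_val p).1 == i then x' (enum_val p) else 0)) => [|p _]; last by rewrite x'E.
  rewrite (sum_enum_setT (fun u => if u.1 == i then x' u else 0)).
  rewrite sum_pairE (bigD1 i) //= [X in _ + X]big1 ?addr0 => [|k /negPf ki]; last by rewrite big1 // => j _; rewrite ki.
  by apply: eq_bigr => j _; rewrite eqxx.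
have [u0 xu0] : exists u, x' u != 0.
  by have /rV0Pn[p xp] := x0; exists (enum_val p); rewrite x'E.
have a_real : a \is Creal.
  apply: (@symmetric_eigenvalue_real _ (fun u v => (lift_adj e s u v)%:R) x' a u0) => //.
  by move=> u v; rewrite rsym.
pose c := (x' u0)^*.
exists (in_algR a_real); split => //.
exists (fun u => in_algR (Creal_Re (c * x' u))); split.
- exists u0; apply: contra_neq xu0 => /(congr1 algRval) /= Re0.
  have sq_real : `|x' u0| ^+ 2 \is Creal by rewrite rpredX // normr_real.
  move: Re0; rewrite /c -normCKC (Creal_ReP _ sq_real) => /eqP.
  by rewrite sqrf_eq0 normr_eq0 => /eqP.
- move=> i; apply: val_inj; rewrite /= raddf_sum /=.
  by rewrite -(raddf_sum (@Re algC)) -mulr_sumr fib mulr0 raddf0.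
- move=> v; apply: val_inj; rewrite /= raddf_sum /=.
  rewrite -ReMl // mulrCA -eig mulr_sumr raddf_sum; apply: eq_bigr => u _.
  by rewrite (rmorph_nat algRval) [RHS]/= mulrA [RHS]ReMr ?realn.
Qed.

Lemma new_eigenvalue_dyadic h n (e : rel 'I_h) (s : lift_data h n) a :
  symmetric e -> irreflexive e -> (0 < h)%N -> (0 < n)%N -> new_eigenvalue e s a ->
  exists2 z : 'I_h * 'I_n -> option (bool * nat),
    \sum_u zval algR (z u) ^+ 2 <= 5 * (h%:R * n%:R) &
    exists2 b : algR, a = algRval b & `|b| * (h%:R * n%:R) <= `|dyadic_form algR e z s|.
Proof.
move=> sym irr h_gt0 n_gt0 /(new_eigenvector_real sym irr)[b [-> [y [[u0 y0] y_fibre y_eig]]]].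
pose A u v : algR := (lift_adj e s u v)%:R - (e u.1 v.1)%:R / n%:R.
pose N := \sum_u y u ^+ 2.
have N_gt0 : 0 < N.
  rewrite /N (bigD1 u0) //= ltr_wpDr ?sumr_ge0 // => [v _|]; first exact: sqr_ge0.
  by rewrite lt0r sqrf_eq0 y0 sqr_ge0.
have form_y : \sum_u \sum_v y u * y v * A u v = b * N.
  rewrite exchange_big /= /N mulr_sumr; apply: eq_bigr => v _.
  have -> : \sum_u y u * y v * A u v =
      (\sum_u y u * (lift_adj e s u v)%:R) * y v - (\sum_u y u * (e u.1 v.1)%:R) * (y v / n%:R).
    rewrite !mulr_suml -sumrB; apply: eq_bigr => u _; rewrite /A.
    by move: (_ %:R) ((e _ _)%:R) (n%:R^-1) => ? ? ?; ring.
  rewrite y_eig [X in _ - X * _](_ : _ = 0); first by rewrite mul0r subr0 expr2 mulrA.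
  rewrite sum_pairE big1 // => i _ /=.
  by rewrite -mulr_suml y_fibre mul0r.
pose c := Num.sqrt (h%:R * n%:R / N).
have c2 : c ^+ 2 * N = h%:R * n%:R.
  by rewrite sqr_sqrtr ?divr_ge0 ?mulr_ge0 ?ler0n ?ltW // divfK ?lt0r_neq0.
have [|z z_le le_form] := @dyadic_rounding algR _ A (fun u => c * y u).
  by move=> u; rewrite /A irr lift_adj_irr // mul0r subr0.
exists z.
  apply: (le_trans (ler_sum _ (fun u _ => z_le u))); rewrite big_split /= -mulr_sumr.
  rewrite (eq_bigr (fun u => c ^+ 2 * y u ^+ 2)) => [|u _]; last by rewrite exprMn.
  rewrite -mulr_sumr -/N c2 sumr_const card_prod !card_ord natrM.
  by move: (h%:R * n%:R) => t; lra.
exists b => //; apply: le_trans le_form.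
have -> : \sum_u \sum_v c * y u * (c * y v) * A u v = c ^+ 2 * (b * N).
  rewrite -form_y mulr_sumr; apply: eq_bigr => u _.
  by rewrite mulr_sumr; apply: eq_bigr => v _; move: (A u v) => t; ring.
by rewrite [c ^+ 2 * _]mulrCA c2 normrM [`|_ * n%:R|]ger0_norm // mulr_ge0 ?ler0n.
Qed.

Lemma zval_int (R : pzRingType) x : zval R x = (zval int x)%:~R.
Proof. by case: x => [[b k]|] //=; rewrite rmorphM !rmorphXn rmorphN1. Qed.

Lemma sum_sqr_zval_le_trans (F1 F2 : numDomainType) (V : finType)
    (z : V -> option (bool * nat)) N :
  \sum_u zval F1 (z u) ^+ 2 <= N%:R -> \sum_u zval F2 (z u) ^+ 2 <= N%:R.
Proof.
have intE (F : numDomainType) : \sum_u zval F (z u) ^+ 2 = (\sum_u zval int (z u) ^+ 2)%:~R.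
  by rewrite rmorph_sum; apply: eq_bigr => u _; rewrite zval_int -rmorphXn.
have natE (F : numDomainType) : N%:R = N%:Z%:~R :> F by [].
by rewrite (intE F1) (intE F2) (natE F1) (natE F2) 2!ler_int.
Qed.

(** Multiplied by n, both sides are images of integers that do not depend on the field. *)
Lemma dyadic_form_bound_trans (F1 F2 : numFieldType) h n (e : rel 'I_h) (s : lift_data h n)
    (z : 'I_h * 'I_n -> option (bool * nat)) W c :
  (0 < n)%N ->
  `|dyadic_form F1 e z s| <= c%:R + 2 * local_mass F1 e z s W ->
  `|dyadic_form F2 e z s| <= c%:R + 2 * local_mass F2 e z s W.
Proof.
move=> n_gt0.
have n0 (F : numFieldType) : 0 < n%:R :> F by rewrite ltr0n.
have formE (F : numFieldType) : n%:R * dyadic_form F e z s = (\sum_u \sum_v zval int (z u) *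
    zval int (z v) * (n%:Z * (lift_adj e s u v)%:Z - (e u.1 v.1)%:Z))%:~R.
  rewrite /dyadic_form mulr_sumr rmorph_sum; apply: eq_bigr => u _ /=.
  rewrite mulr_sumr rmorph_sum; apply: eq_bigr => v _ /=.
  rewrite !rmorphM rmorphB rmorphM /= (zval_int F (z u)) (zval_int F (z v)).
  set x := (zval int (z u))%:~R; set y := (zval int (z v))%:~R.
  transitivity (x * y * (n%:R * (lift_adj e s u v)%:R - (e u.1 v.1)%:R)) => //.
  rewrite [LHS]mulrCA mulrBr; congr (_ * (_ - _)).
  by rewrite mulrCA divff ?mulr1 // lt0r_neq0 ?n0.
have massE (F : numFieldType) : local_mass F e z s W = (local_mass int e z s W)%:~R.
  rewrite /local_mass rmorph_sum; apply: eq_bigr => u _; rewrite rmorph_sum.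
  by apply: eq_bigr => v _; rewrite !rmorphM rmorph_nat (zval_int F (z u)) (zval_int F (z v)) -!intr_norm.
have key (F : numFieldType) : (`|dyadic_form F e z s| <= c%:R + 2 * local_mass F e z s W) =
    (`|\sum_u \sum_v zval int (z u) * zval int (z v) *
      (n%:Z * (lift_adj e s u v)%:Z - (e u.1 v.1)%:Z)| <=
      n%:Z * (c%:Z + 2 * local_mass int e z s W)).
  rewrite -(ler_pM2l (n0 F)) -[in LHS](ger0_norm (ltW (n0 F))) -normrM formE massE -intr_norm.
  by rewrite normr_nat -(ler_int F) rmorphM rmorphD rmorphM.
by rewrite !key.
Qed.

(* The test vector is [2 ^ q] at the centre of the star and 1 on its leaves. *)
Lemma star_eigenvalue (V : finType) (r : rel V) (v : V) (d q : nat) (l : algR) :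
  symmetric r -> irreflexive r -> #|[set u | r v u]| = d -> (0 < d)%N -> (4 ^ q <= d)%N ->
  (forall y : V -> algR, let S := v |: [set u | r v u] in
    \sum_(u in S) \sum_(w in S) y u * y w * (r u w)%:R <= l * \sum_(u in S) y u ^+ 2) ->
  2 ^+ q <= l.
Proof.
pose y u : algR := if u == v then 2 ^+ q else 1.
move=> sym irr deg d_gt0 le_qd /(_ y); set L := [set u | r v u] => /=.
have vL : v \notin L by rewrite inE irr.
have yv : y v = 2 ^+ q by rewrite /y eqxx.
have yL u : u \in L -> y u = 1.
  by move=> uL; rewrite /y; case: eqP => // uv; rewrite -uv uL in vL.
have y_ge0 u : 0 <= y u by rewrite /y; case: ifP => _; rewrite ?exprn_ge0 ?ler0n.
have pos u w : 0 <= y u * y w * (r u w)%:R by rewrite !mulr_ge0 ?ler0n.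
have p_ge0 : 0 <= 2 ^+ q :> algR by rewrite exprn_ge0 ?ler0n.
have cardL : \sum_(u in L) 1 = d%:R :> algR by rewrite sumr_const deg.
rewrite !big_setU1 //= !yv irr.
have -> : \sum_(u in L) 2 ^+ q * y u * (r v u)%:R = 2 ^+ q * d%:R :> algR.
  rewrite -cardL mulr_sumr; apply: eq_bigr => u uL.
  by move: (uL); rewrite inE => ->; rewrite yL // !mulr1.
have -> : \sum_(u in L) y u ^+ 2 = d%:R.
  by rewrite -cardL; apply: eq_bigr => u uL; rewrite yL // expr1n.
have le_rows : 2 ^+ q * d%:R <= \sum_(u in L) \sum_(w in v |: L) y u * y w * (r u w)%:R.
  rewrite -cardL mulr_sumr; apply: ler_sum => u uL.
  rewrite big_setU1 //= yv yL // sym; move: (uL); rewrite inE => -> .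
  by rewrite mul1r !mulr1 lerDl sumr_ge0 // => w _; have := pos u w; rewrite yL.
have d0 : 0 < d%:R :> algR by rewrite ltr0n.
have p2_le : (2 ^+ q) ^+ 2 <= d%:R :> algR.
  by rewrite -exprM mulnC exprM -natrX -natrX ler_nat.
move: le_rows p_ge0 d0 p2_le.
move: (\sum_(u in L) _) (2 ^+ q) (d%:R) => rows p D le_rows p_ge0 D_gt0 p2_le le_l.
have {}le_l : 2 * (p * D) <= l * (p ^+ 2 + D) by rewrite mulr0 add0r in le_l; lra.
have l_ge0 : 0 <= l.
  rewrite leNgt; apply/negP => l_lt0.
  have : l * (p ^+ 2 + D) < 0 by rewrite pmulr_llt0 // ltr_wpDl ?sqr_ge0.
  by have := mulr_ge0 p_ge0 (ltW D_gt0); lra.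
rewrite -(ler_pM2r D_gt0); have : l * (p ^+ 2 + D) <= l * (D + D) by rewrite ler_wpM2l ?lerD2r.
lra.
Qed.

(** * Choice of the induced subgraph and proof of the theorem *)

(** The set W varies with the eigenvector, but G' must serve all new eigenvalues. It is taken to
    maximise the largest eigenvalue over all nonempty sets of at most h d vertices, so it dominates
    every W and also a star, which gives 2^q. *)
Lemma good_lift_of_dyadic_bound (R : realType) h n (e : rel 'I_h) d q (s : lift_data h n) :
  symmetric e -> irreflexive e -> regular e d -> (2 <= d)%N -> (4 ^ q <= d)%N ->
  (0 < h)%N -> (0 < n)%N ->
  (forall z, \sum_u zval R (z u) ^+ 2 <= 5 * (h%:R * n%:R) ->
    exists2 W : {set 'I_h * 'I_n}, (#|W| <= h * d)%N &
    `|dyadic_form R e z s| <= 256 * 256 * (2 ^+ q * (h%:R * n%:R)) + 2 * local_mass R e z s W) ->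
  good_lift d e s.
Proof.
move=> sym irr reg d_ge2 le_qd h_gt0 n_gt0 bound.
have rsym := lift_adj_sym s sym irr; have rirr := lift_adj_irr s irr.
have le_dh : (d <= h)%N.
  by rewrite -(reg (Ordinal h_gt0)) -[leqRHS]card_ord max_card.
have lexists (S : {set 'I_h * 'I_n}) : exists l : algR, S != set0 ->
    largest_eigenvalue (adj_mx (lift_adj e s) S) (algRval l) /\ forall y : _ -> algR,
    \sum_(u in S) \sum_(v in S) y u * y v * (lift_adj e s u v)%:R <= l * \sum_(u in S) y u ^+ 2.
  (* The matrix of the empty set has no eigenvalue; 0 is a default value, and the maximum below
     excludes that set. *)
  have [->|S0] := eqVneq S set0; first by exists 0.
  by have [l] := adjacency_rayleigh rsym S0; exists l.
have [l lP] := fin_all_exists lexists.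
pose v0 : 'I_h * 'I_n := (Ordinal h_gt0, Ordinal n_gt0).
pose star := v0 |: [set u | lift_adj e s v0 u].
have deg : #|[set u | lift_adj e s v0 u]| = d.
  apply/eqP; rewrite -(eqr_nat algR) -(lift_degree _ s v0 sym irr reg).
  rewrite -sum1_card natr_sum big_mkcond /=; apply/eqP/eq_bigr => u _.
  by rewrite inE rsym; case: lift_adj.
have star0 : star != set0 by apply/set0Pn; exists v0; rewrite setU11.
have star_le : (#|star| <= h * d)%N.
  (* d + 1 <= 2 d <= h d, since 2 <= d <= h. *)
  rewrite cardsU1 deg; apply: leq_trans (leq_mul (leq_trans d_ge2 le_dh) (leqnn d)).
  by case: (_ \notin _); lia.
pose P (S : {set 'I_h * 'I_n}) := (S != set0) && (#|S| <= h * d)%N.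
have Pstar : P star by rewrite /P star0.
case: (@Order.TotalTheory.arg_maxP _ _ _ star P l Pstar) => S /andP[S0 S_le] S_max.
have le_star : 2 ^+ q <= l S.
  apply: le_trans (S_max _ Pstar).
  apply: (star_eigenvalue rsym rirr deg (leq_trans _ d_ge2) le_qd) => //.
  by have [] := lP star star0.
have lS_ge0 : 0 <= l S by apply: le_trans le_star; rewrite exprn_ge0.
exists S; split => //; exists (algRval (l S)); split; first by have [] := lP S S0.
move=> a new_a.
have [z z_le [b -> le_form]] := new_eigenvalue_dyadic sym irr h_gt0 n_gt0 new_a.
have N_nat (F : numDomainType) : 5 * (h%:R * n%:R) = (5 * (h * n))%:R :> F.
  by rewrite !natrM.
have [|W W_le leW] := bound z; first by rewrite N_nat; apply: sum_sqr_zval_le_trans; rewrite -N_nat; exact: z_le.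
have c_nat (F : numDomainType) :
    256 * 256 * (2 ^+ q * (h%:R * n%:R)) = (256 * 256 * (2 ^ q * (h * n)))%:R :> F.
  by rewrite !natrM natrX.
rewrite c_nat in leW.
have {}leW := dyadic_form_bound_trans algR n_gt0 leW; rewrite -c_nat in leW.
have N_gt0 : 0 < h%:R * n%:R :> algR by rewrite mulr_gt0 ?ltr0n.
have massW : local_mass algR e z s W <= 5 * (l S * (h%:R * n%:R)).
  have [->|W0] := eqVneq W set0.
    by rewrite /local_mass big_set0 !mulr_ge0 ?ler0n.
  have [_ /(_ (fun u => `|zval algR (z u)|)) le_mass] := lP W W0.
  apply: (le_trans le_mass).
  have sq_ge0 : 0 <= \sum_(u in W) `|zval algR (z u)| ^+ 2 by apply: sumr_ge0 => u _; apply: sqr_ge0.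
  have lW : l W <= l S by apply: S_max; rewrite /P W0.
  apply: (le_trans (ler_wpM2r sq_ge0 lW)).
  rewrite [leRHS]mulrCA ler_wpM2l //; apply: le_trans z_le.
  rewrite [leRHS](bigID (mem W)) /= -[leLHS]addr0 lerD ?sumr_ge0 // => [|u _]; last exact: sqr_ge0.
  by apply: ler_sum => u _; rewrite real_normK ?num_real.
(* 256 * 256 multiplies 2^q <= l S; 10 = 2 * 5 comes from twice the local mass with |z|^2 <= 5 h n.
   The sum 65546 is below 1189248. *)
suff le_b : `|b| <= (256 * 256 + 10) * l S.
  have -> : `|algRval b| = algRval `|b| by [].
  apply: (@le_trans _ _ (algRval ((256 * 256 + 10) * l S))); first exact: le_b.
  rewrite rmorphM; apply: ler_wpM2r; first by rewrite -(rmorph0 algRval); exact: lS_ge0.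
  rewrite rmorphD rmorphM !rmorph_nat -natrM -natrD ler_nat.
  by [].
rewrite -(ler_pM2r N_gt0); apply: (le_trans le_form); apply: (le_trans leW).
have := ler_wpM2r (ltW N_gt0) le_star; move: massW => {lP S_max bound le_form leW}.
move: (local_mass _ _ _ _ _) (2 ^+ q) (h%:R * n%:R) (l S) => x p N L; lra.
Qed.

Theorem theorem2 (d h : nat) (e : rel 'I_h) :
  (2 <= d)%N -> simple_graph e -> regular e d ->
  exists N : nat, forall n : nat, (N <= n)%N ->
    exists Good : {set lift_data h n},
      (forall s, s \in Good -> good_lift d e s) /\
      (#|Good|%:R / #|[set: lift_data h n]|%:R : rat)
        >= 1 - ((n ^ (h * d))%:R)^-1.
Proof.
move=> d_ge2 [sym irr] reg; have [h0|h_gt0] := posnP h.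
  (* For h = 0 the required probability is 1 - 1 = 0. *)
  exists 0%N => n _; exists set0; split; first by move=> s; rewrite inE.
  by rewrite h0 mul0n expn0 invr1 subrr divr_ge0 ?ler0n.
pose q := trunc_log 4 d; have d_gt0 : (0 < d)%N := ltnW d_ge2.
have le_qd : (4 ^ q <= d)%N by apply: trunc_logP.
have le_dq : (d <= 4 ^ q.+1)%N by apply/ltnW/trunc_log_ltn.
(* [m] exceeds all light levels and makes 4^(m-q) >= 640 h^2; [E] makes the union of m^2 cores
   small. Neither depends on n. *)
pose m := (q + 20 * h + 1 + 640 * h * h)%N; pose E := (128 * h * (m * m * (1 + d)))%N.
have m_gt0 : (0 < m)%N by rewrite /m; lia.
have E_gt0 : (0 < E)%N by rewrite /E !muln_gt0 h_gt0 m_gt0.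
have lt_m : (q + 20 * h < m)%N by rewrite /m; lia.
have lem : (640 * h * h <= 4 ^ (m - q))%N.
  have : (640 * h * h <= m - q)%N by rewrite /m; lia.
  by move/leq_trans; apply; rewrite ltnW // ltn_expl.
pose R : realType := Rdefinitions.R; pose eta : R := (256 * 4 ^+ m)^-1.
have eta_gt0 : 0 < eta by rewrite invr_gt0 mulr_gt0 ?exprn_gt0 ?ltr0n.
have [N1 rare1] := dense_small_set_rare R (h * d) sym irr h_gt0.
have [N2 rare2] := large_core_rare R (h * d) sym irr reg le_dq E_gt0.
have [N3 rare3] := light_failure_rare q m (h * d) sym irr eta_gt0.
exists (maxn 1 (maxn N1 (maxn N2 N3))) => n; rewrite !geq_max => /and4P[n_gt0 n1 n2 n3].
pose B1 := [set s : lift_data h n | dense_small_set e (h * d) s].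
pose B2 := [set s : lift_data h n | has_large_core e q E s].
pose B3 := [set s : lift_data h n | light_failure e q m eta s].
exists (~: (B1 :|: B2 :|: B3)); split.
  move=> s; rewrite !inE !negb_or => /andP[/andP[ok1 ok2] ok3].
  apply: (good_lift_of_dyadic_bound (R := R) sym irr reg d_ge2 le_qd h_gt0 n_gt0) => z z_le.
  exact: (dyadic_form_bound sym irr reg h_gt0 n_gt0 le_dq lt_m (leqnn E) lem ok2 ok1 ok3 z_le).
have p_gt0 : (0 < n ^ (h * d))%N by rewrite expn_gt0 n_gt0.
have L_gt0 : (0 < #|[set: lift_data h n]|)%N by apply/card_gt0P; exists [ffun=> 1%g]; rewrite inE.
have bad : (#|B1 :|: B2 :|: B3| * n ^ (h * d) <= #|[set: lift_data h n]|)%N.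
  rewrite cardsT; have le_U : (#|B1 :|: B2 :|: B3| <= #|B1| + #|B2| + #|B3|)%N.
    by rewrite (leq_trans (leq_card_setU _ _)) // leq_add2r leq_card_setU.
  have third a b c u p L : (u <= a + b + c -> a * (3 * p) <= L -> b * (3 * p) <= L ->
      c * (3 * p) <= L -> u * p <= L)%N.
    by move=> le_u; have := leq_mul le_u (leqnn p); rewrite !mulnDl ![(_ * (3 * p))%N]mulnCA; lia.
  exact: third le_U (rare1 n n1) (rare2 n n2) (rare3 n n3).
have cardE := cardsC (B1 :|: B2 :|: B3); rewrite -cardsT in cardE.
move: bad L_gt0 p_gt0 cardE; move: #|_ :|: _| #|~: _| #|[set: _]| (n ^ _)%N => u g L p.
move=> bad L_gt0 p_gt0 cardE.
have L0 : 0 < L%:R :> rat by rewrite ltr0n.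
have p0 : 0 < p%:R :> rat by rewrite ltr0n.
have gE : g%:R = L%:R - u%:R :> rat by rewrite -cardE natrD [X in X - _]addrC addrK.
rewrite gE mulrBl divff ?lt0r_neq0 // lerD2l lerN2 ler_pdivrMr // mulrC ler_pdivlMr //.
by rewrite -natrM ler_nat.
Qed.
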